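(* Fix $0<\epsilon<1$, let $q=q(n)$ satisfy $n^{-1}\log^2 n\le q\le 1/2$, put $p=1-q$, and let $P$ be a random poset drawn from $\Omega(n,p)$. When $q\ge \frac18 n^{-1/4}\log^3 n$, set $z=\log n+4\log q-8\log\log n$. Then asymptotically almost surely (as $n\to\infty$) \[ \dim(P) > \begin{cases} n-(2+\epsilon)\log(qn)/q & \text{if } n^{-1}\log^2 n\le q\le n^{-4/5},\\ n-32\,(n\log n/q)^{1/2} & \text{if } n^{-4/5}\le q\le (32)^{1/3}n^{-1/3}\log^{1/3}n,\\ n-8qn & \text{if } (32)^{1/3}n^{-1/3}\log^{1/3}n\le q\le \tfrac18 n^{-1/4}\log^3 n,\\ n-24qn/z & \text{if } \tfrac18 n^{-1/4}\log^3 n\le q\le 1/2. \end{cases} \]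
   Context: $\log$ is the natural logarithm. For a positive integer $n$, fix disjoint sets $A$ and $A'$, each of size $n$. $\Omega(n,p)$ is the probability space of posets $P$ on ground set $A\cup A'$ in which $A\subseteq\operatorname{Min}(P)$ (every element of $A$ is minimal) and $A'\subseteq\operatorname{Max}(P)$ (every element of $A'$ is maximal), and such that, independently for each pair $(a,a')\in A\times A'$, one has $a<a'$ in $P$ with probability $p$ (so $a,a'$ are incomparable with probability $q=1-p$). Here $p=p(n)$ may depend on $n$. A statement holds asymptotically almost surely (a.a.s.) if its probability tends to $1$ as $n\to\infty$. The dimension $\dim(P)$ of a poset $P$ is the least positive integer $d$ for which there are linear extensions $L_1,\dots,L_d$ of $P$ such that $x\le y$ in $P$ if and only if $x\le y$ in $L_j$ for each $j\in\{1,\dots,d\}$. *)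

(* Defs.v *)
From HB Require Import structures.
From mathcomp Require Import all_boot all_order all_algebra.
From mathcomp Require Import all_classical all_reals all_analysis.

Set Implicit Arguments.
Unset Strict Implicit.
Unset Printing Implicit Defensive.

Import Order.TTheory GRing.Theory Num.Theory.
Import numFieldNormedType.Exports.

Local Open Scope ring_scope.

(* Posets are given by their (reflexive) order relation on a finite type. *)

Definition partial_order (T : finType) (le : rel T) : Prop :=
  [/\ reflexive le, antisymmetric le & transitive le].

Definition linear_extension (T : finType) (le L : rel T) : Prop :=
  [/\ partial_order L, total L & subrel le L].

Definition realizer (T : finType) (le : rel T) (d : nat) (L : 'I_d -> rel T)
    : Prop :=
  (forall j, linear_extension le (L j)) /\
  (forall x y, le x y <-> forall j, L j x y).

Definition has_realizer (T : finType) (le : rel T) (d : nat) : Prop :=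
  exists L : 'I_d -> rel T, realizer le L.

(* The default value 0 is never taken on partial orders: see [poset_dimP]. *)
Definition poset_dim (T : finType) (le : rel T) : nat :=
  if pselect (exists d, (0 < d)%N && `[< has_realizer le d >]) is left ex_d
  then ex_minn ex_d else 0%N.

(* A is the left copy of 'I_n and A' the right one. A poset on A + A' with    *)
(* A contained in Min(P) and A' contained in Max(P) is determined by the set  *)
(* E of pairs (a, a') with a < a' in P, and every E occurs: see               *)
(* [bip_le_partial_order], [bip_leP].                                         *)
Definition bip_le (n : nat) (E : {set 'I_n * 'I_n}) : rel ('I_n + 'I_n) :=
  fun x y => (x == y) ||
    match x, y with
    | inl a, inr a' => (a, a') \in E
    | _, _ => false
    end.

(* The probability, in Omega(n, p), of an event expressed in terms of E: each *)
(* pair belongs to E independently with probability p.                        *)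
Definition Pr (R : realType) (n : nat) (p : R)
    (event : pred {set 'I_n * 'I_n}) : R :=
  \sum_(E : {set 'I_n * 'I_n} | event E)
    \prod_(e : 'I_n * 'I_n) (if e \in E then p else 1 - p).

Definition minimal (T : finType) (le : rel T) (x : T) : Prop :=
  forall y, le y x -> y = x.

Definition maximal (T : finType) (le : rel T) (x : T) : Prop :=
  forall y, le x y -> y = x.

Lemma bip_le_partial_order n (E : {set 'I_n * 'I_n}) :
  [/\ partial_order (bip_le E),
      forall a, minimal (bip_le E) (inl a),
      forall a', maximal (bip_le E) (inr a')
    & forall a a', bip_le E (inl a) (inr a') = ((a, a') \in E)].
Proof.
rewrite /bip_le; split=> //; first split.
- by move=> x; rewrite eqxx.
- move=> x y /andP[/orP[/eqP//|]].
  by case: x => x; case: y.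
- move=> y x z /orP[/eqP->//|xy] /orP[/eqP<-|yz]; first by rewrite xy orbT.
  by move: xy yz; case: x y z => x [] y [].
- by move=> a y /orP[/eqP//|]; case: y.
- by move=> a y /orP[/eqP//|]; case: y.
Qed.

Lemma bip_leP n (le : rel ('I_n + 'I_n)) : partial_order le ->
  (forall a, minimal le (inl a)) -> (forall a', maximal le (inr a')) ->
  le =2 bip_le [set e | le (inl e.1) (inr e.2)].
Proof.
move=> [refl _ _] minA maxA x y; rewrite /bip_le.
have [->|neq_xy] := eqVneq x y; first by rewrite refl.
case: x y neq_xy => [a|a'] [b|b'] neq_xy /=; last 1 first.
- by apply/negP => /maxA /eqP; rewrite eq_sym (negPf neq_xy).
- by apply/negP => /minA /eqP; rewrite (negPf neq_xy).
- by rewrite inE.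
- by apply/negP => /maxA.
Qed.

Lemma Pr_total (R : realType) n (p : R) : Pr p (@predT {set 'I_n * 'I_n}) = 1.
Proof.
rewrite /Pr (reindex_onto (fun f : {ffun 'I_n * 'I_n -> bool} => [set e | f e])
  (fun E : {set 'I_n * 'I_n} => [ffun e => e \in E])) /=; last first.
  by move=> E _; apply/setP => e; rewrite inE ffunE.
transitivity (\prod_(e : 'I_n * 'I_n) \sum_(b : bool) (if b then p else 1 - p)).
  rewrite bigA_distr_bigA /=; apply: eq_big => [f|f _].
    by apply/eqP/ffunP => e; rewrite ffunE inE.
  by apply: eq_bigr => e _; rewrite inE.
by rewrite big1// => e _; rewrite big_bool /= addrC subrK.
Qed.

Lemma linear_extension_separating (T : finType) (le : rel T) (x y : T) :
  partial_order le ->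
  exists L, linear_extension le L /\ (~~ le x y -> ~~ L x y).
Proof.
pose ht (l : rel T) := #|[set u : T * T | ~~ l u.1 u.2]|.
(* incomparable [u] and [v] can be made comparable, with [u] below [v] *)
have step (l : rel T) u v : partial_order l -> ~~ l u v -> ~~ l v u ->
  exists l', [/\ partial_order l', subrel l l', l' u v & (ht l' < ht l)%N].
  move=> [rl al tl] nuv nvu.
  exists (fun a b => l a b || l a u && l v b); split.
  - split.
    + by move=> a; rewrite rl.
    + move=> a b /andP[/orP[ab|/andP[au vb]] /orP[ba|/andP[bu va]]].
      * by apply: al; rewrite ab.
      * by case/negP: nvu; exact: (tl _ _ _ va (tl _ _ _ ab bu)).
      * by case/negP: nvu; exact: (tl _ _ _ (tl _ _ _ vb ba) au).
      * by case/negP: nvu; exact: (tl _ _ _ va au).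
    + move=> b a c /orP[ab|/andP[au vb]] /orP[bc|/andP[bu vc]].
      * by rewrite (tl _ _ _ ab bc).
      * by rewrite (tl _ _ _ ab bu) vc orbT.
      * by rewrite au (tl _ _ _ vb bc) orbT.
      * by rewrite au vc orbT.
  - by move=> a b ->.
  - by rewrite !rl orbT.
  - apply: proper_card; apply/properP; split.
      by apply/fintype.subsetP => -[a b]; rewrite !inE /= negb_or => /andP[].
    by exists (u, v); rewrite !inE //= !rl orbT.
have ext (l : rel T) : partial_order l -> exists L, linear_extension l L.
  have [k] := ubnP (ht l); elim: k l => // k IHk l ltk pol.
  have [tot|] := pselect (total l); first by exists l; split.
  move=> /existsNP[u /existsNP[v /negP]]; rewrite negb_or => /andP[nuv nvu].
  have [l' [pol' sub _ lt']] := step l u v pol nuv nvu.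
  have [//|L [poL totL subL]] := IHk l' _ pol'; first exact: leq_trans lt' ltk.
  by exists L; split=> // a b /sub/subL.
move=> po; have [xy|nxy] := boolP (le x y).
  by have [L ?] := ext le po; exists L.
have neq : x <> y by move=> exy; move: nxy; rewrite exy; case: po => ->.
have [l [pol sub lyx]] : exists l, [/\ partial_order l, subrel le l & l y x].
  have [yx|nyx] := boolP (le y x); first by exists le; split.
  by have [l [? ? ? _]] := step le y x po nyx nxy; exists l; split.
have [L [poL totL subL]] := ext l pol.
exists L; split; first by split=> // a b /sub/subL.
move=> _; apply/negP => Lxy; apply: neq; case: poL => _ aL _.
by apply: aL; rewrite Lxy subL.
Qed.

Lemma poset_dimP (T : finType) (le : rel T) : partial_order le ->
  [/\ (0 < poset_dim le)%N, has_realizer le (poset_dim le)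
    & forall d, (0 < d)%N -> has_realizer le d -> (poset_dim le <= d)%N].
Proof.
move=> po; rewrite /poset_dim; case: pselect => [ex_d|[]]; last first.
  have /choice[f fP] : forall u : option (T * T), exists L : rel T,
      linear_extension le L /\
      (if u is Some (x, y) then ~~ le x y -> ~~ L x y else True).
    case=> [[x y]|]; first exact: linear_extension_separating.
    case: (pickP (@predT T)) => [x _|noT].
      by have [L []] := linear_extension_separating x x po; exists L.
    by exists le; do 2?split=> //; move=> x; have := noT x.
  exists #|{: option (T * T)}|; apply/andP; split.
    by apply/card_gt0P; exists None.
  apply/asboolP; exists (fun j => f (enum_val j)); split.
    by move=> j; case: (fP (enum_val j)).
  move=> x y; split=> [xy j|all_xy]; first by case: (fP (enum_val j)) => -[_ _ ->].
  have := all_xy (enum_rank (Some (x, y))); rewrite enum_rankK => fxy.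
  by apply: contraT => /(fP (Some (x, y))).2; rewrite fxy.
case: ex_minnP => d /andP[d0 /asboolP rd] dmin; split=> // d' d'0 rd'.
by apply: dmin; rewrite d'0; apply/asboolP.
Qed.

(* Main.v *)
Require Import Defs.
From mathcomp Require Import all_boot all_order all_algebra.
From mathcomp Require Import all_classical all_reals all_analysis.
From mathcomp Require Import zify ring lra.

Set Implicit Arguments.
Unset Strict Implicit.
Unset Printing Implicit Defensive.

Import Order.TTheory GRing.Theory Num.Theory.
Import numFieldNormedType.Exports.

Local Open Scope ring_scope.
Local Notation setX := finset.setX.

(** Call G the random set of pairs (a, a') that are incomparable in P, so that
    every pair belongs to G independently with probability q; pairs of G are
    edges. A linear extension L of P reverses (a, a') when a' < a in L. If it
    does, then every element of A above a is joined by an edge to every element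
    of A' below a', and a realizer must reverse every edge.

    Suppose that d = n - s linear extensions realize P. Going through them in
    turn, let a_j be the highest element of A in L_j that is not among
    a_0, ..., a_(j-1), and b_j the lowest such element of A' ([greedy]). What
    remains are s-element sets X and Y, and if L_j reverses an edge (x, y) of
    X x Y, then a_j is joined to y and x to b_j. The a_j are distinct and so are
    the b_j: hence the edges asked for by different j are different, and they lie
    outside X x Y, so that reversing all edges of X x Y is very unlikely. The
    point is that it is unlikely enough to survive a union bound over all
    possible choices of the data extracted from the realizer.

    For q <= n^(-4/5) counting 4-cycles is enough: each edge of X x Y closes a
    4-cycle with a_j and b_j, there are only about n^4 q^4 <= 1/q of these, and
    destroying them leaves a large independent rectangle ([realizer_c4_prob],
    [sparse_prob]).

    For larger q, of L_j only the list T_j of the k highest elements of X and the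
    list S_j of the k lowest elements of Y are recorded. As G contains no
    complete bipartite K_(k,k), a reversed edge (x, y) has x in T_j or y in S_j
    ([cover_structure]). In the first case y must be joined to x and to the
    entries of T_j before x, which is decided by the trace H of G on X x Y, and to
    a_j, which is an independent event. So, given H, the edge e = (x, y) is
    reversed only if G meets a certain set of pairs outside X x Y, the block of e.
    If E is a set of edges of H whose blocks are pairwise disjoint, then all of E
    is reversed with probability at most exp(- sum_(e in E) (1 - q)^(size of the
    block of e)) ([trace_cover_prob]).

    It remains to find E for which this sum exceeds the logarithm of the number of
    choices, which is of order k n log n. The blocks are small on average because
    i elements of X rarely have more than about q^i s common neighbours in Y;
    exceptional i-subsets may exist, as X and Y depend on G, but a maximal family
    of disjoint ones is small, and deleting its union destroys all of them
    ([bad_family_prob], [delete_bad]). In the two middle ranges E consists of the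
    edges that involve only the heads of the lists ([select_shallow], with
    Jensen's inequality for the sum); in the last range these are too few, and E
    is an independent set in the graph of pairs of edges with intersecting blocks
    ([select_independent]). The resulting estimate is [realizer_prob_le]; it is
    evaluated in [middle_prob] and [dense_prob]. *)

(** * Random subsets of a finite set *)

Section RandomSubset.
Context (R : realType) (T : finType).
Implicit Types (q : R) (G D : {set T}) (f g : {set T} -> R).

Definition weight q G : R := \prod_(e : T) (if e \in G then q else 1 - q).

Definition expect q f : R := \sum_(G : {set T}) weight q G * f G.

(** Events are arbitrary propositions, decided classically, so that statements
    about realizers need no boolean form. *)
Definition prob q (P : {set T} -> Prop) : R := expect q (fun G => (`[< P G >])%:R).

Definition supported D f := forall G, f G = f (G :&: D).

Lemma weight_ge0 q G : 0 <= q <= 1 -> 0 <= weight q G.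
Proof.
by move=> /andP[q0 q1]; apply: prodr_ge0 => e _; case: ifP; rewrite ?subr_ge0.
Qed.

Lemma sum_weight q : \sum_(G : {set T}) weight q G = 1.
Proof.
rewrite (reindex_onto (fun f : {ffun T -> bool} => [set e | f e])
  (fun E : {set T} => [ffun e => e \in E])) /=; last first.
  by move=> E _; apply/setP => e; rewrite inE ffunE.
transitivity (\prod_(e : T) \sum_(b : bool) (if b then q else 1 - q)).
  rewrite bigA_distr_bigA /=; apply: eq_big => [f|f _].
    by apply/eqP/ffunP => e; rewrite ffunE inE.
  by apply: eq_bigr => e _; rewrite inE.
by rewrite big1// => e _; rewrite big_bool /= addrC subrK.
Qed.

Lemma expect_const q (c : R) : expect q (fun=> c) = c.
Proof. by rewrite /expect -mulr_suml sum_weight mul1r. Qed.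

Lemma expect_le q f g : 0 <= q <= 1 -> (forall G, f G <= g G) -> expect q f <= expect q g.
Proof.
by move=> q01 fg; apply: ler_sum => G _; rewrite ler_wpM2l ?fg ?weight_ge0.
Qed.

Lemma expect_sum q (I : finType) (A : {pred I}) (F : I -> {set T} -> R) :
  expect q (fun G => \sum_(i in A) F i G) = \sum_(i in A) expect q (F i).
Proof.
rewrite /expect exchange_big /=; apply: eq_bigr => G _.
by rewrite mulr_sumr.
Qed.

Lemma ExZ q (c : R) f : expect q (fun G => c * f G) = c * expect q f.
Proof. by rewrite /expect mulr_sumr; apply: eq_bigr => G _; rewrite mulrCA. Qed.

Lemma eq_expect q f g : f =1 g -> expect q f = expect q g.
Proof. by move=> fg; apply: eq_bigr => G _; rewrite fg. Qed.

Lemma prob_le q (P Q : {set T} -> Prop) : 0 <= q <= 1 ->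
  (forall G, P G -> Q G) -> prob q P <= prob q Q.
Proof.
move=> q01 PQ; apply: expect_le => // G; rewrite ler_nat.
by case: asboolP => // /PQ QG; case: asboolP.
Qed.

Lemma prob_ge0 q P : 0 <= q <= 1 -> 0 <= prob q P.
Proof. by move=> q01; rewrite -(expect_const q 0); apply: expect_le. Qed.

Lemma prob_le1 q P : 0 <= q <= 1 -> prob q P <= 1.
Proof.
by move=> q01; rewrite -(expect_const q 1); apply: expect_le => // G; rewrite lern1 leq_b1.
Qed.

Lemma prob_exists q (I : finType) (P : I -> {set T} -> Prop) : 0 <= q <= 1 ->
  prob q (fun G => exists i, P i G) <= \sum_i prob q (P i).
Proof.
move=> q01; rewrite -(expect_sum q predT); apply: expect_le => // G.
case: asboolP => [[i PiG]|_]; last by apply: sumr_ge0.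
rewrite (bigD1 i) //=; case: asboolP => // _.
by rewrite lerDl sumr_ge0.
Qed.

Lemma prob_or q (P Q : {set T} -> Prop) : 0 <= q <= 1 ->
  prob q (fun G => P G \/ Q G) <= prob q P + prob q Q.
Proof.
move=> q01.
apply: le_trans (_ : prob q (fun G => exists b, if b : bool then P G else Q G) <= _).
  by apply: prob_le => // G [HP|HQ]; [exists true|exists false].
by apply: le_trans (prob_exists _ q01) _; rewrite big_bool.
Qed.

Lemma prob_compl q (P : {set T} -> Prop) :
  prob q P = 1 - prob q (fun G => ~ P G).
Proof.
apply/eqP; rewrite eq_sym subr_eq -{1}(expect_const q 1) /prob /expect -big_split /=.
apply/eqP/eq_bigr => G _; rewrite -mulrDr asbool_neg.
by case: asboolP => _; rewrite /= ?addr0 ?add0r.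
Qed.

(** Markov's inequality. *)
Lemma markov_prob q f (c : R) : 0 <= q <= 1 -> (forall G, 0 <= f G) -> 0 < c ->
  prob q (fun G => c <= f G) <= expect q f / c.
Proof.
move=> q01 f0 c0; rewrite ler_pdivlMr// mulrC -ExZ; apply: expect_le => // G.
by case: asboolP => [cf|_]; rewrite ?mulr1 ?mulr0.
Qed.

(** Exchanging the parts of two independent samples outside D preserves their
    joint law. This replaces conditioning: G1 fixes what happens in D, and G2
    is fresh elsewhere. *)
Lemma expect_resample q D f :
  expect q f = expect q (fun G1 => expect q (fun G2 => f (G1 :&: D :|: G2 :\: D))).
Proof.
pose sw (u : {set T} * {set T}) :=
  (u.1 :&: D :|: u.2 :\: D, u.2 :&: D :|: u.1 :\: D).
(* the exchange of the two samples outside D *)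
have swK : involutive sw.
  move=> [A B]; rewrite /sw /=; congr (_, _); apply/setP => e; rewrite !inE;
  by case: (e \in A); case: (e \in B); case: (e \in D).
transitivity (\sum_(u : {set T} * {set T}) weight q u.1 * weight q u.2 * f u.1).
  rewrite -(pair_bigA _ (fun A B : {set T} => weight q A * weight q B * f A)) /=.
  apply: eq_bigr => A _; rewrite -mulr_suml -mulr_sumr.
  by rewrite sum_weight mulr1.
rewrite (reindex_inj (inv_inj swK)) /=.
rewrite -(pair_bigA _ (fun A B : {set T} => weight q (sw (A, B)).1 *
  weight q (sw (A, B)).2 * f (sw (A, B)).1)) /=.
apply: eq_bigr => A _; rewrite [RHS]mulr_sumr; apply: eq_bigr => B _.
rewrite mulrA; congr (_ * _); rewrite /weight -!big_split /=.
apply: eq_bigr => e _; rewrite !inE.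
by case: (e \in A); case: (e \in B); case: (e \in D) => //=; rewrite mulrC.
Qed.

Lemma expect_mul_disjoint q D1 D2 f g : [disjoint D1 & D2] ->
  supported D1 f -> supported D2 g ->
  expect q (fun G => f G * g G) = expect q f * expect q g.
Proof.
move=> dis sf sg; rewrite (expect_resample q D1).
rewrite {3}/expect mulr_suml; apply: eq_bigr => A _; rewrite -mulrA; congr (_ * _).
rewrite -ExZ; apply: eq_expect => B.
have d0 e : e \in D1 -> e \in D2 -> false.
  by move=> e1 e2; move/pred0P: dis => /(_ e) /=; rewrite e1 e2.
congr (_ * _).
  rewrite sf [RHS]sf; congr f; apply/setP => e; rewrite !inE.
  by case: (e \in A); case: (e \in B); case: (e \in D1).
rewrite sg [RHS]sg; congr g; apply/setP => e; rewrite !inE.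
move: (d0 e).
by case: (e \in A); case: (e \in B); case: (e \in D1); case: (e \in D2) => // /(_ isT isT).
Qed.

Lemma expect_prod_disjoint q (I : finType) (D : I -> {set T})
    (F : I -> {set T} -> R) (A : {set I}) :
  {in A &, forall i j, i != j -> [disjoint D i & D j]} ->
  {in A, forall i, supported (D i) (F i)} ->
  expect q (fun G => \prod_(i in A) F i G) = \prod_(i in A) expect q (F i).
Proof.
have [k] := ubnP #|A|; elim: k A => // k IHk A; rewrite ltnS => ltk dis sup.
have [->|[i iA]] := set_0Vmem A.
  by under eq_expect do rewrite big_set0; rewrite expect_const big_set0.
rewrite (big_setD1 i) //= -IHk; last first.
- by move=> j; rewrite inE => /andP[_ jA]; apply: sup.
- by move=> j l; rewrite !inE => /andP[_ jA] /andP[_ lA]; apply: dis.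
- by move: ltk; rewrite (cardsD1 i A) iA.
rewrite -(@expect_mul_disjoint _ (D i) (\bigcup_(j in A :\ i) D j)).
- by apply: eq_expect => G; rewrite (big_setD1 i).
- rewrite -setI_eq0; apply/eqP/setP => e; rewrite !inE.
  apply/negP => /andP[ei /bigcupP[j]]; rewrite !inE => /andP[ji jA] ej.
  by have := dis _ _ jA iA ji => /pred0P /(_ e) /=; rewrite ei ej.
- exact: sup.
- move=> G; apply: eq_bigr => j jA; have jA' : j \in A by move: jA; rewrite inE => /andP[].
  rewrite (sup j jA') [RHS](sup j jA'); congr (F j).
  rewrite -finset.setIA; congr (_ :&: _); apply/esym/finset.setIidPr.
  exact: (finset.bigcup_sup j).
Qed.

Lemma prob_subset q D : prob q (fun G => D \subset G) = q ^+ #|D|.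
Proof.
have -> : prob q (fun G => D \subset G) =
    expect q (fun G => \prod_(e in D) (e \in G)%:R).
  apply: eq_expect => G; rewrite asboolb.
  have [sDG|/subsetPn[e eD eG]] := boolP (D \subset G).
    by rewrite big1// => e eD; rewrite (fintype.subsetP sDG).
  by rewrite (bigD1 e) //= (negPf eG) mul0r.
rewrite (@expect_prod_disjoint _ _ (fun e => [set e]) (fun e G => (e \in G)%:R)).
- rewrite -prodr_const; apply: eq_bigr => e _.
  rewrite /expect (reindex_onto (fun f : {ffun T -> bool} => [set e | f e])
  (fun E : {set T} => [ffun e => e \in E])) /=; last first.
    by move=> E _; apply/setP => x; rewrite inE ffunE.
  transitivity (\prod_(x : T) \sum_(b : bool) (if b then q else 1 - q) *
     (if x == e then b%:R else 1)).
    rewrite bigA_distr_bigA /=; apply: eq_big => [f|f _].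
      by apply/eqP/ffunP => x; rewrite ffunE inE.
    rewrite big_split /= inE; congr (_ * _).
      by apply: eq_bigr => x _; rewrite inE.
    by rewrite -big_mkcond /= big_pred1_eq.
  rewrite (bigD1 e) //= eqxx big_bool /= mulr1 mulr0 addr0 big1 ?mulr1//.
  by move=> x /negPf ->; rewrite big_bool /= !mulr1 addrC subrK.
- move=> x y _ _ xy; rewrite -setI_eq0; apply/eqP/setP => z; rewrite !inE.
  by apply/negP => /andP[/eqP -> /eqP]; apply/eqP.
- by move=> e _ G; rewrite !inE eqxx andbT.
Qed.

End RandomSubset.

(** * Exponential bounds for disjoint blocks *)

Section RandomSubset2.
Context (R : realType) (T : finType).
Implicit Types (q : R) (G D : {set T}) (f g : {set T} -> R).

(** Complementation turns the law with parameter q into the one with parameter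
    1 - q; it transfers statements about edges to non-edges. *)
Lemma expect_setC q f : expect q f = expect (1 - q) (fun G => f (~: G)).
Proof.
rewrite /expect (reindex_inj (@finset.setC_inj _)); apply: eq_bigr => G _; congr (_ * _).
by apply: eq_bigr => e _; rewrite inE; case: (e \in G); rewrite //= subKr.
Qed.

Lemma prob_disjoint q D : prob q (fun G => [disjoint D & G]) = (1 - q) ^+ #|D|.
Proof.
rewrite -prob_subset /prob expect_setC; apply: eq_expect => G.
by rewrite !asboolb finset.disjoints_subset finset.setCK.
Qed.

Lemma supported_asbool D (P : {set T} -> Prop) :
  (forall G, P G <-> P (G :&: D)) -> @supported R _ D (fun G => (`[< P G >])%:R).
Proof. by move=> PD G; congr (_%:R); rewrite (asbool_equiv_eq (PD G)). Qed.

Lemma subset_setI_iff D G : D \subset G <-> D \subset G :&: D.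
Proof. by rewrite finset.subsetI subxx andbT. Qed.

(** Chernoff's bound for the number of blocks contained in the sample: the
    indicators are independent as the blocks are disjoint. For lam >= 0 this
    bounds the upper tail, for lam <= 0 the lower tail. *)
Lemma count_tail_prob q (I : finType) (D : I -> {set T}) (A : {set I}) (k : nat)
    (lam t : R) : 0 <= q <= 1 ->
  {in A &, forall i j, i != j -> [disjoint D i & D j]} ->
  {in A, forall i, #|D i| = k} ->
  prob q (fun G => lam * t <= lam * #|[set i in A | D i \subset G]|%:R) <=
  expR ((expR lam - 1) * q ^+ k * #|A|%:R - lam * t).
Proof.
move=> q01 dis cD.
pose F i G : R := 1 + (expR lam - 1) * (`[< (D i \subset G : Prop) >])%:R.
have prodF G : \prod_(i in A) F i G =
    expR (lam * #|[set i in A | D i \subset G]|%:R).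
  rewrite -sum1_card natr_sum mulr_sumr expR_sum [RHS](eq_bigl
    (fun i => (i \in A) && (D i \subset G))); last by move=> i; rewrite inE.
  rewrite [RHS]big_mkcondr /=; apply: eq_bigr => i _; rewrite /F asboolb.
  by case: ifP; rewrite ?mulr1 ?mulr0 ?addr0// addrC subrK.
have ExF : expect q (fun G => \prod_(i in A) F i G) =
    (1 + (expR lam - 1) * q ^+ k) ^+ #|A|.
  rewrite (@expect_prod_disjoint _ _ _ _ D) //; last first.
    move=> i iA G; rewrite /F; congr (1 + _ * _).
    exact: (supported_asbool (P := fun G => D i \subset G)
      (subset_setI_iff (D i))).
  rewrite -prodr_const; apply: eq_bigr => i iA.
  transitivity (expect q (fun _ : {set T} => 1) + expect q (fun G => (expR lam - 1) *
    (`[< (D i \subset G : Prop) >])%:R)).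
    by rewrite /expect -big_split; apply: eq_bigr => G _; rewrite /F mulrDr.
  by rewrite expect_const ExZ; have := prob_subset q (D i); rewrite /prob cD// => ->.
have -> : expR ((expR lam - 1) * q ^+ k * #|A|%:R - lam * t) =
   expR ((expR lam - 1) * q ^+ k) ^+ #|A| / expR (lam * t).
  by rewrite expRD expRN -expRM_natr.
apply: le_trans (_ : expect q (fun G => \prod_(i in A) F i G) / expR (lam * t) <= _).
  apply: le_trans (markov_prob (f := fun G => \prod_(i in A) F i G) _ _ _) => //.
  - by apply: prob_le => // G; rewrite prodF ler_expR.
  - by move=> G; rewrite prodF expR_ge0.
  - exact: expR_gt0.
rewrite ler_pM2r ?invr_gt0 ?expR_gt0// ExF.
have a1 : -1 <= (expR lam - 1) * q ^+ k.
  have /andP[qk0 qk1] : 0 <= q ^+ k <= 1.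
    by case/andP: q01 => q0 q1; rewrite exprn_ge0 ?exprn_ile1.
  by have := expR_gt0 lam; nra.
by apply: lerXn2r; rewrite ?nnegrE ?expR_ge0 ?expR_ge1Dx//; lra.
Qed.

(** The blocks are met independently, block i with probability 1 - (1 -
    q)^(size of block i), and 1 - t <= exp(- t). *)
Lemma hit_all_blocks_prob q (I : finType) (D : I -> {set T}) (A : {set I}) : 0 <= q <= 1 ->
  {in A &, forall i j, i != j -> [disjoint D i & D j]} ->
  prob q (fun G => forall i, i \in A -> ~~ [disjoint D i & G]) <=
  expR (- \sum_(i in A) (1 - q) ^+ #|D i|).
Proof.
move=> q01 dis.
pose F i G : R := (`[< (~~ [disjoint D i & G] : Prop) >])%:R.
have -> : prob q (fun G => forall i, i \in A -> ~~ [disjoint D i & G]) =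
    expect q (fun G => \prod_(i in A) F i G).
  apply: eq_expect => G; case: asboolP => [H|/existsNP[i /not_implyP[iA]]].
    by rewrite big1// => i iA; rewrite /F asboolb H.
  by move=> /negP /negbTE H; rewrite (bigD1 i) //= /F asboolb H mul0r.
rewrite (@expect_prod_disjoint _ _ _ _ D) //; last first.
  move=> i iA; apply: (supported_asbool (P := fun G => ~~ [disjoint D i & G])) => G.
  rewrite -!setI_eq0; have -> // : D i :&: (G :&: D i) = D i :&: G.
  by apply/setP => e; rewrite !inE; case: (e \in D i); rewrite ?andbT ?andbF.
rewrite -sumrN expR_sum; apply: ler_prod => i iA.
rewrite (@prob_ge0 _ _ q (fun G => ~~ [disjoint D i & G])) //=.
rewrite (_ : expect _ _ = 1 - (1 - q) ^+ #|D i|); first exact: expR_ge1Dx.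
rewrite -prob_disjoint; rewrite [LHS](prob_compl q (fun G => ~~ [disjoint D i & G])).
congr (1 - _); apply: eq_expect => G.
by rewrite asbool_neg !asboolb negbK.
Qed.

End RandomSubset2.

(** * Unlikely configurations of a random bipartite graph *)

Section GraphEvents.
Context (R : realType) (V : finType).
Implicit Types (q : R) (G : {set V * V}) (X Y I J : {set V}).

Lemma prob_false (T : finType) q (P : {set T} -> Prop) : (forall H, ~ P H) ->
  prob q P = 0.
Proof.
move=> nP; rewrite -[RHS](expect_const T q 0).
by apply: eq_expect => H; case: asboolP => // /nP.
Qed.

Lemma prob_union (T : finType) q (I : finType) (A : {set I})
    (P : I -> {set T} -> Prop) (c : R) : 0 <= q <= 1 ->
  (forall i, i \in A -> prob q (P i) <= c) ->
  prob q (fun H => exists i, i \in A /\ P i H) <= #|A|%:R * c.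
Proof.
move=> q01 PPc; apply: le_trans (prob_exists _ q01) _.
rewrite (bigID [in A]) /= [X in _ + X]big1 ?addr0.
  rewrite mulr_natl -sumr_const.
  apply: ler_sum => i iA; apply: le_trans (PPc _ iA).
  by apply: prob_le => // H [].
by move=> i /negP iA; apply: prob_false => H [].
Qed.

Lemma card_ksets_le (W : finType) k : (#|[set I : {set W} | #|I| == k]| <= #|W| ^ k)%N.
Proof.
rewrite card_draws; apply: (@leq_trans (#|W| ^_ k)).
  by rewrite -bin_ffact leq_pmulr ?fact_gt0.
elim: k => // k IHk; rewrite ffactnSr expnSr leq_mul//.
exact: leq_subr.
Qed.

Definition common_nb G Y I : {set V} := [set y in Y | setX I [set y] \subset G].

Lemma biclique_prob q k : 0 <= q <= 1 ->
  prob q (fun G => exists I J, [/\ #|I| = k, #|J| = k & setX I J \subset G]) <=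
  (#|V| ^ k.*2)%:R * q ^+ (k * k).
Proof.
move=> q01.
pose A := setX [set I : {set V} | #|I| == k] [set I : {set V} | #|I| == k].
apply: le_trans (_ : prob q (fun G => exists u, u \in A /\ setX u.1 u.2 \subset G) <= _).
  apply: prob_le => // G [I [J [cI cJ sG]]]; exists (I, J); split => //.
  by rewrite finset.in_setX !inE cI cJ !eqxx.
apply: le_trans (prob_union (c := q ^+ (k * k)) _ _) _ => //.
  move=> [I J]; rewrite finset.in_setX !inE /= => /andP[/eqP cI /eqP cJ].
  by rewrite prob_subset cardsX cI cJ.
have /andP[q0 _] := q01.
apply: ler_wpM2r; first exact: exprn_ge0.
rewrite ler_nat cardsX -addnn expnD.
by apply: leq_mul; apply: card_ksets_le.
Qed.

Lemma few_edges_prob q m : 0 <= q <= 1 ->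
  prob q (fun G => exists X Y, [/\ #|X| = m, #|Y| = m &
     #|G :&: setX X Y|%:R <= 99 / 100 * q * m%:R ^+ 2]) <=
  (#|V| ^ m.*2)%:R * expR (- (q * m%:R ^+ 2 / (200 * 201))).
Proof.
move=> q01.
pose A := setX [set I : {set V} | #|I| == m] [set I : {set V} | #|I| == m].
apply: le_trans (_ : prob q (fun G => exists u, u \in A /\
    #|G :&: setX u.1 u.2|%:R <= 99 / 100 * q * m%:R ^+ 2) <= _).
  apply: prob_le => // G [I [J [cI cJ sG]]]; exists (I, J); split => //.
  by rewrite finset.in_setX !inE cI cJ !eqxx.
apply: le_trans (prob_union (c := expR (- (q * m%:R ^+ 2 / (200 * 201)))) _ _) _ => //.
  move=> [I J]; rewrite finset.in_setX !inE /= => /andP[/eqP cI /eqP cJ].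
  have tail := @count_tail_prob R _ q _ (fun e => [set e]) (setX I J) 1 (- (1 / 200))
    (99 / 100 * q * m%:R ^+ 2) q01.
  apply: le_trans (le_trans _ (tail _ _)) _.
  - apply: prob_le => // G le_e;     (* the lower tail: the exponent is negative, which reverses the
       comparison *)
have n0 : - (1 / 200) < 0 :> R by lra.
    rewrite (ler_nM2l n0).
    have -> : [set e in setX I J | [set e] \subset G] = G :&: setX I J.
      by apply/setP => e; rewrite !inE finset.sub1set andbC.
    exact: le_e.
  - move=> x y _ _ xy; rewrite -setI_eq0; apply/eqP/setP => z; rewrite !inE.
    by apply/negP => /andP[/eqP -> /eqP]; apply/eqP.
  - by move=> x _; rewrite cards1.
  - have : expR (- (1 / 200)) - 1 <= - (1 / 201) :> R.
      rewrite expRN; have e1 : 1 + 1 / 200 <= expR (1 / 200) :> R by exact: expR_ge1Dx.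
      have : (expR (1 / 200))^-1 <= (1 + 1 / 200)^-1 :> R.
        by rewrite lef_pV2 ?posrE ?expR_gt0//; lra.
      rewrite (_ : (1 + 1 / 200)^-1 = 200 / 201); last by field.
      lra.
    have : 0 <= q * m%:R ^+ 2 by case/andP: q01 => q0 _; rewrite mulr_ge0 ?exprn_ge0.
    rewrite ler_expR cardsX cI cJ expr1 natrM.
    set e := expR _; nra.
apply: ler_wpM2r; first exact: expR_ge0.
rewrite ler_nat cardsX -addnn expnD.
by apply: leq_mul; apply: card_ksets_le.
Qed.

(** A family of l disjoint i-sets gives l * s disjoint blocks I x {y}, about
    q^i l s of which are expected inside G. Taking l sets at once makes the
    bound beat the number of choices of Y, which a single set could not do. *)
Lemma bad_family_prob q s i l (lam tau : R) : 0 <= q <= 1 -> 0 <= lam ->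
  prob q (fun G => exists Y (F : {set {set V}}), [/\ #|Y| = s, #|F| = l,
      {in F &, forall I J, I != J -> [disjoint I & J]},
      {in F, forall I, #|I| = i}
    & {in F, forall I, tau < #|common_nb G Y I|%:R}]) <=
  (#|V| ^ s * #|V| ^ (i * l))%:R *
    expR (l%:R * ((expR lam - 1) * q ^+ i * s%:R - lam * tau)).
Proof.
move=> q01 lam0.
pose A2 := [set F : {set {set V}} | F \subset [set I : {set V} | #|I| == i] & #|F| == l].
pose A := setX [set I : {set V} | #|I| == s] A2.
pose okF (F : {set {set V}}) := {in F &, forall I J, I != J -> [disjoint I & J]}.
apply: le_trans (_ : prob q (fun G => exists u, u \in A /\ (okF u.2 /\
    {in u.2, forall I, tau < #|common_nb G u.1 I|%:R})) <= _).
  apply: prob_le => // G [Y [F [cY cF dF cI bad]]]; exists (Y, F); split => //.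
  rewrite finset.in_setX !inE cY cF !eqxx andbT; apply/fintype.subsetP => I /cI cI'.
  by rewrite inE cI'.
apply: le_trans (prob_union (c := expR (l%:R * ((expR lam - 1) * q ^+ i * s%:R - lam * tau))) _ _) _ => //.
  move=> [Y F]; rewrite finset.in_setX !inE /= => /and3P[/eqP cY /fintype.subsetP sF /eqP cF].
  have cI I : I \in F -> #|I| = i by move=> /sF; rewrite inE => /eqP.
  have [dF|ndF] := asboolP (okF F); last first.
    by rewrite prob_false ?expR_ge0// => H [].
  pose D (u : {set V} * V) := setX u.1 [set u.2].
  have tail := @count_tail_prob R _ q _ D (setX F Y) i lam (l%:R * tau) q01.
  apply: le_trans (le_trans _ (tail _ _)) _.
  - apply: prob_le => // G [_ bad]; apply: ler_wpM2l => //.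
    have -> : #|[set u in setX F Y | D u \subset G]| = (\sum_(I in F) #|common_nb G Y I|)%N.
      rewrite -sum1_card (eq_bigl (fun u : {set V} * V => (u.1 \in F) && (u.2 \in common_nb G Y u.1))).
        rewrite -(pair_big_dep (fun I => I \in F) (fun I y => y \in common_nb G Y I) (fun _ _ => 1%N)) /=.
        by apply: eq_bigr => I _; rewrite sum1_card.
      by move=> [I y]; rewrite !inE /= andbA.
    rewrite natr_sum -cF mulr_natl -sumr_const; apply: ler_sum => I IF.
    exact/ltW/bad.
  - move=> [I y] [J z]; rewrite !finset.in_setX /= => /andP[IF yY] /andP[JF zY] IJ.
    rewrite -setI_eq0; apply/eqP/setP => -[a b]; rewrite !inE /=.
    apply/negP => /andP[/andP[aI /eqP by'] /andP[aJ /eqP bz]].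
    have [eIJ|nIJ] := eqVneq I J.
      by move: IJ; rewrite eIJ -by' -bz eqxx.
    by have := dF _ _ IF JF nIJ => /pred0P /(_ a) /=; rewrite aI aJ.
  - by move=> [I y]; rewrite finset.in_setX /= => /andP[/cI cI' _]; rewrite cardsX cards1 muln1.
  - by rewrite ler_expR cardsX cF cY natrM; lra.
apply: ler_wpM2r; first exact: expR_ge0.
rewrite ler_nat cardsX leq_mul ?card_ksets_le// /A2 cards_draws.
apply: (@leq_trans (#|[set I : {set V} | #|I| == i]| ^ l)).
  set m := #|_|; have := card_ksets_le 'I_m l.
  by rewrite card_draws card_ord.
rewrite expnM; case: (l) => [|l']; first by rewrite !expn0.
by rewrite leq_exp2r// card_ksets_le.
Qed.

Lemma indep_prob q m : 0 <= q <= 1 ->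
  prob q (fun G => exists X Y, [/\ #|X| = m, #|Y| = m & [disjoint setX X Y & G]]) <=
  ('C(#|V|, m) ^ 2)%:R * (1 - q) ^+ (m * m).
Proof.
move=> q01.
pose A := setX [set I : {set V} | #|I| == m] [set I : {set V} | #|I| == m].
apply: le_trans (_ : prob q (fun G => exists u, u \in A /\
    [disjoint setX u.1 u.2 & G]) <= _).
  apply: prob_le => // G [I [J [cI cJ sG]]]; exists (I, J); split => //.
  by rewrite finset.in_setX !inE cI cJ !eqxx.
apply: le_trans (prob_union (c := (1 - q) ^+ (m * m)) _ _) _ => //.
  move=> [I J]; rewrite finset.in_setX !inE /= => /andP[/eqP cI /eqP cJ].
  by rewrite prob_disjoint cardsX cI cJ.
by rewrite cardsX card_draws mulnn.
Qed.

Definition c4 G (a x b y : V) :=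
  [&& a != x, b != y, (a, b) \in G, (a, y) \in G, (x, b) \in G & (x, y) \in G].

(** The vertices x in 4-cycles are at most as many as the labelled 4-cycles,
    of which at most n^4 q^4 are expected. *)
Lemma c4_prob q (c : R) : 0 <= q <= 1 -> 0 < c ->
  prob q (fun G => c <= #|[set x | [exists a, exists b, exists y, c4 G a x b y]]|%:R)
  <= (#|V| ^ 4)%:R * q ^+ 4 / c.
Proof.
move=> q01 c0; have /andP[q0 _] := q01.
pose E4 (u : V * V * V * V) := c4 ^~ u.1.1.1.
pose cnt G : R := \sum_(u : V * V * V * V) (c4 G u.1.1.1 u.1.1.2 u.1.2 u.2)%:R.
apply: le_trans (_ : prob q (fun G => c <= cnt G) <= _).
  apply: prob_le => // G /le_trans; apply; rewrite -sum1_card natr_sum.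
  rewrite big_mkcond /= /cnt.
  rewrite (partition_big (fun u : V * V * V * V => u.1.1.2) predT) //=.
  apply: ler_sum => x _; rewrite inE; case: ifP => [|_]; last exact: sumr_ge0.
  move=> /existsP[a /existsP[b /existsP[y c4axby]]].
  by rewrite (bigD1 (a, x, b, y)) //= c4axby lerDl sumr_ge0.
apply: le_trans (markov_prob _ _ _) _ => //; first by move=> G; apply: sumr_ge0.
rewrite ler_pM2r ?invr_gt0// /cnt (expect_sum q predT).
have -> : (#|V| ^ 4)%:R * q ^+ 4 = \sum_(u : V * V * V * V) q ^+ 4.
  by rewrite sumr_const !card_prod !expnS expn0 muln1 !mulnA mulr_natl.
apply: ler_sum => -[[[a x] b] y] _ /=.
have [ax|ax] := eqVneq a x.
  rewrite (eq_expect q (g := fun=> 0)) ?expect_const ?exprn_ge0// => G.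
  by rewrite /c4 ax eqxx.
have [by'|by'] := eqVneq b y.
  rewrite (eq_expect q (g := fun=> 0)) ?expect_const ?exprn_ge0// => G.
  by rewrite /c4 by' eqxx andbF.
rewrite (eq_expect q (g := fun G => (`[< (setX [set a; x] [set b; y] \subset G : Prop) >])%:R)).
  have := prob_subset q (setX [set a; x] [set b; y]).
  by rewrite /prob cardsX !cards2 ax by' => ->.
move=> G; rewrite asboolb /c4 ax by' /=; congr (nat_of_bool _)%:R.
apply/and4P/fintype.subsetP => [[h1 h2 h3 h4] [u v]|H].
  by rewrite !inE /= => /andP[/orP[]/eqP -> /orP[]/eqP ->].
by split; apply: H; rewrite !inE /= !eqxx ?orbT.
Qed.

End GraphEvents.

(** * Deleting the exceptional vertices *)

Section Deletion.
Context (R : realType) (V : finType).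
Implicit Types (G : {set V * V}) (X Y I J : {set V}).

Definition few_common_nb G X Y r (tau : nat -> R) := forall I, I \subset X ->
  (0 < #|I| <= r)%N -> #|common_nb G Y I|%:R <= tau #|I|.

(** Disjointness makes the events that the members are bad independent. *)
Definition bad_family G Y i (t : R) (F : {set {set V}}) :=
  [/\ {in F &, forall I J, I != J -> [disjoint I & J]},
      {in F, forall I, #|I| = i} & {in F, forall I, t < #|common_nb G Y I|%:R}].

Lemma bad_family_sub G Y i t (F F' : {set {set V}}) : F' \subset F ->
  bad_family G Y i t F -> bad_family G Y i t F'.
Proof.
move=> /fintype.subsetP sF [h1 h2 h3]; split.
- by move=> I J /sF ? /sF ?; apply: h1.
- by move=> I /sF; apply: h2.
- by move=> I /sF; apply: h3.
Qed.

(** Delete the union of a maximal disjoint family of bad i-sets, for each i: a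
    bad set that avoids the union would extend the family. *)
Lemma delete_bad G X Y r (l : nat -> nat) (tau : nat -> R) :
  (forall i, (0 < i <= r)%N ->
     ~ exists F : {set {set V}}, #|F| = l i /\ bad_family G Y i (tau i) F) ->
  exists X1, [/\ X1 \subset X,
    (#|X| <= #|X1| + \sum_(1 <= i < r.+1) i * l i)%N & few_common_nb G X1 Y r tau].
Proof.
move=> nobad.
(* a bad family inside X of maximal cardinality, for every i *)
have maxF i : exists F : {set {set V}}, [/\ bad_family G Y i (tau i) F,
    finset.cover F \subset X & forall F' : {set {set V}}, bad_family G Y i (tau i) F' ->
    finset.cover F' \subset X -> (#|F'| <= #|F|)%N].
  pose P (F : {set {set V}}) := `[< bad_family G Y i (tau i) F >] && (finset.cover F \subset X).
  have P0 : P finset.set0.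
    rewrite /P; apply/andP; split; last by rewrite /finset.cover big_set0 finset.sub0set.
    by apply/asboolP; split=> [I J|I|I]; rewrite inE.
  case: (@arg_maxnP {set {set V}} _ P (fun F => #|F|) P0) => F /andP[/asboolP bF cF] maxF.
  exists F; split => // F' bF' cF'; apply: maxF.
  by rewrite /P cF' andbT; apply/asboolP.
have [f fP] := choice maxF.
pose D := \bigcup_(i < r) finset.cover (f i.+1).
exists (X :\: D); split; first exact: finset.subsetDl.
  have : (#|D| <= \sum_(1 <= i < r.+1) i * l i)%N.
    apply: (@leq_trans (\sum_(i < r) #|finset.cover (f i.+1)|)).
      apply: (big_ind2 (fun (A : {set V}) a => (#|A| <= a)%N)) => //; first by rewrite cards0.
      move=> A a B b Aa Bb; apply: leq_trans (leq_add Aa Bb).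
      by rewrite cardsU leq_subr.
    rewrite big_add1 /= big_mkord; apply: leq_sum => i _.
    have [[dF cI bad] cX _] := fP i.+1.
    have ltl : (#|f i.+1| <= l i.+1)%N.
      rewrite leqNgt; apply/negP => /ltnW ltl; apply: (nobad i.+1).
        by rewrite /= ltn_ord.
      have /card_gt0P[F'] : (0 < #|[set A : {set {set V}} | A \subset f i.+1 & #|A| == l i.+1]|)%N.
        by rewrite cards_draws bin_gt0.
      rewrite inE => /andP[sF' /eqP cF']; exists F'; split => //.
      by apply: bad_family_sub sF' _.
    apply: leq_trans (leq_card_cover _) _.
    rewrite (eq_bigr (fun=> i.+1)) => [|I /cI //].
    by rewrite sum_nat_const mulnC leq_mul.
  rewrite -(cardsID D X) addnC => leD; rewrite leq_add2l (leq_trans _ leD)//.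
  by rewrite subset_leq_card// finset.subsetIr.
move=> I sI /andP[I0 Ir]; rewrite leNgt; apply/negP => badI.
case cI : #|I| I0 Ir badI => [//|i] _ ltir badI.
have [[dF cF bad] cX maxf] := fP i.+1.
have disI J : J \in f i.+1 -> [disjoint J & I].
  move=> JF; rewrite -setI_eq0; apply/eqP/setP => x; rewrite !inE.
  apply/negP => /andP[xJ xI]; move/fintype.subsetP: sI => /(_ x xI).
  rewrite inE => /andP[/bigcupP[]]; exists (Ordinal ltir) => //=.
  by apply/bigcupP; exists J.
have nIF : I \notin f i.+1.
  apply/negP => /disI; rewrite -setI_eq0 finset.setIid => /eqP I0.
  by move: cI; rewrite I0 cards0.
suff : (#|I |: f i.+1| <= #|f i.+1|)%N by rewrite cardsU1 nIF ltnn.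
apply: maxf.
- split.
  + move=> A B; rewrite !inE => /predU1P[->|AF] /predU1P[->|BF].
    * by rewrite eqxx.
    * by move=> _; rewrite disjoint_sym disI.
    * by move=> _; apply: disI.
    * exact: dF.
  + by move=> A; rewrite !inE => /predU1P[->//|/cF].
  + by move=> A; rewrite !inE => /predU1P[->|/bad //].
- rewrite /finset.cover finset.bigcup_setU big_set1 finset.subUset cX andbT.
  by apply: fintype.subset_trans sI (finset.subsetDl _ _).
Qed.

End Deletion.

(** * Distinct maxima of several linear orders *)

Section Greedy.
Context (V : finType).

Definition chain_order (r : rel V) := [/\ reflexive r, transitive r & total r].

(** A maximal element of a linear order is one with the most elements below
    it. *)
Lemma max_chain (r : rel V) (A : {set V}) : chain_order r -> (0 < #|A|)%N ->
  exists2 m, m \in A & forall x, x \in A -> r x m.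
Proof.
move=> [rr tr tot] /card_gt0P[a aA].
case: (@arg_maxnP _ a (mem A) (fun m => #|[set x in A | r x m]|) aA) => m mA maxm.
exists m => // x xA; apply/negPn/negP => nxm.
have rmx : r m x by have := tot m x; rewrite (negPf nxm) orbF.
have := maxm x xA; rewrite /= leqNgt => /negP; apply.
apply: proper_card; apply/properP; split.
  by apply/fintype.subsetP => z; rewrite !inE => /andP[-> /tr]; apply.
by exists x; rewrite !inE xA ?rr // (negPf nxm).
Qed.

(** Choose f j as the maximum for r j of what earlier choices left over; an
    element that is never chosen was available at every step, and so lies
    below every f j. *)
Lemma greedy d (r : 'I_d -> rel V) : (d <= #|V|)%N ->
  (forall j, chain_order (r j)) ->
  exists f : 'I_d -> V, injective f /\
    forall j x, (forall k, x != f k) -> r j x (f j).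
Proof.
move=> dV ch.
have [s [ss us sP]] : exists s : seq V, [/\ size s = d, uniq s &
    forall (j : 'I_d) x0 x, (j < d)%N -> x \notin s -> r j x (nth x0 s j)].
  suff H k : (k <= d)%N -> exists s : seq V, [/\ size s = k, uniq s &
    forall (j : 'I_d) x0 x, (j < k)%N -> x \notin s -> r j x (nth x0 s j)].
    exact: H.
  elim: k => [|k IHk] kd; first by exists [::]; split.
  have [|s [ss us sP]] := IHk; first exact: ltnW.
  have [||m mA mP] := @max_chain (r (Ordinal kd)) [set x | x \notin s].
  - exact: ch.
  - have := cardsC [set x | x \in s]; have -> : #|[set x | x \in s]| = k.
      by rewrite cardsE; move/card_uniqP: us => ->.
    have -> : ~: [set x | x \in s] = [set x | x \notin s].
      by apply/setP => x; rewrite !inE.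
    by move: (leq_trans kd dV); lia.
  exists (rcons s m); split.
  - by rewrite size_rcons ss.
  - by move: mA; rewrite rcons_uniq us inE => ->.
  - move=> j x0 x; rewrite ltnS leq_eqVlt mem_rcons inE negb_or nth_rcons ss.
    move=> /predU1P[jk|jk] /andP[xm xs].
      rewrite jk ltnn eqxx; have -> : j = Ordinal kd by exact: val_inj.
      by apply: mP; rewrite inE.
    by rewrite jk; apply: sP.
have nthf (j : 'I_d) : (j < size s)%N by rewrite ss.
case: (posnP d) => [d0|d0].
  have noj (j : 'I_d) : False by have := ltn_ord j; rewrite {2}d0.
  by exists (fun j => match noj j with end); split => j; case: (noj j).
have [x0 _] : exists x0 : V, true.
  by case: s ss {us sP nthf} => [|x0 s]; [move: d0 => /[swap] <-|exists x0].
exists (fun j => nth x0 s j); split => [j k /eqP|j x xs].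
  by rewrite nth_uniq ?nthf// => /eqP/val_inj.
apply: sP => //; apply/negP => /(nthP x0)[k]; rewrite ss => kd e.
by have := xs (Ordinal kd); rewrite /= e eqxx.
Qed.

(** The first k elements of X in decreasing order. An element outside the list
    has index k, so the comparison of indices covers this case as well. *)
Lemma top_list (r : rel V) (X : {set V}) k : chain_order r -> (k <= #|X|)%N ->
  exists t : k.-tuple V, [/\ uniq t, {subset t <= X} &
    forall x x', x \in X -> x' \in t -> (index x' t <= index x t)%N -> r x x'].
Proof.
move=> [rr tr tot] kX; pose ge := fun a b => r b a.
have totge : total ge by move=> a b; rewrite /ge orbC; exact: tot.
have trge : transitive ge by move=> a b c; rewrite /ge => h1 h2; exact: tr h2 h1.
pose s := sort ge (enum X).
have ss : size (take k s) == k.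
  by rewrite size_takel// size_sort -cardE.
exists (Tuple ss) => /=; split.
- by rewrite take_uniq// sort_uniq enum_uniq.
- by move=> x /mem_take; rewrite mem_sort mem_enum.
- move=> x x' xX x't lei.
  have us : uniq s by rewrite sort_uniq enum_uniq.
  have xs : x \in s by rewrite mem_sort mem_enum.
  have x's : x' \in s by apply: mem_take x't.
  have srt : sorted ge s by exact: sort_sorted.
  have idx z : z \in take k s -> index z s = index z (take k s).
    by move=> zt; rewrite -[in LHS](cat_take_drop k s) index_cat zt.
  have lei' : (index x' s <= index x s)%N.
    rewrite (idx x')//; have [xt|xt] := boolP (x \in take k s); first by rewrite (idx x).
    apply: leq_trans lei _; rewrite -[in X in (_ <= X)%N](cat_take_drop k s) index_cat (negPf xt).
    by rewrite (memNindex xt) leq_addr.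
  have := sorted_leq_nth trge _ x srt (index x' s) (index x s).
  rewrite !inE !index_mem xs x's !nth_index// /ge; apply => //.
Qed.

End Greedy.

(** * What a realizer yields *)

Section Cover.

Lemma has_realizer_widen (T : finType) (le : rel T) d d' :
  (0 < d <= d')%N -> has_realizer le d -> has_realizer le d'.
Proof.
move=> /andP[d0 dd'] [L [Lext Lreal]].
have lt_d (j : nat) : (minn j d.-1 < d)%N by lia.
exists (fun j : 'I_d' => L (Ordinal (lt_d j))); split => [j|x y]; first exact: Lext.
rewrite Lreal; split => // Lxy j.
have := Lxy (Ordinal (leq_trans (ltn_ord j) dd')).
by rewrite (_ : Ordinal _ = j)//; apply: val_inj => /=; have := ltn_ord j; lia.
Qed.

(** RA j is L_j on A, and RB j is the reverse of L_j on A', so that in both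
    orders a larger element is reversed with more partners. An edge (x', y')
    can fail only by x' < y' in P, which contradicts y' <= y < x <= x' in L_j. *)
Lemma ferrers_cover n (G : {set 'I_n * 'I_n}) d :
  has_realizer (bip_le (~: G)) d -> exists RA RB : 'I_d -> rel 'I_n,
    [/\ forall j, chain_order (RA j), forall j, chain_order (RB j) &
    forall x y, (x, y) \in G -> exists j, forall x' y',
      RA j x x' -> RB j y y' -> (x', y') \in G].
Proof.
move=> [L [Lext Lreal]].
exists (fun j x x' => L j (inl x) (inl x')), (fun j y y' => L j (inr y') (inr y)).
split=> [j|j|x y xyG].
- have [[rL aL tL] totL _] := Lext j.
  by split => [x|x y z|x y]; [exact: rL|exact: tL|exact: totL].
- have [[rL aL tL] totL _] := Lext j.
  split => [x|x y z h1 h2|x y]; [exact: rL|exact: tL h2 h1|].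
  by rewrite orbC; exact: totL.
have : ~ forall j, L j (inl x) (inr y).
  by move=> /Lreal; rewrite /bip_le /= inE xyG.
move=> /existsNP[j /negP nLxy]; exists j => x' y' xx' y'y.
have [[rL aL tL] totL subL] := Lext j.
have Lyx : L j (inr y) (inl x).
  by have := totL (inl x) (inr y); rewrite (negPf nLxy).
have Ly'x' : L j (inr y') (inl x') by apply: tL (tL _ _ _ y'y Lyx) xx'.
apply/negPn/negP => nG.
have Lx'y' : L j (inl x') (inr y') by apply: subL; rewrite /bip_le /= inE nG.
by have := aL (inl x') (inr y'); rewrite Lx'y' Ly'x' => /(_ isT).
Qed.

(** Entries equal to x or standing before x in t are those that a reversal of
    x forces to be adjacent as well. *)
Definition up_adj (V : eqType) (adj : pred V) (t : seq V) (x : V) :=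
  (x \in t) && all adj (take (index x t).+1 t).

Lemma up_adjP (V : eqType) (adj : pred V) (t : seq V) (x : V) : uniq t ->
  reflect (x \in t /\ forall x', x' \in t -> (index x' t <= index x t)%N -> adj x')
    (up_adj adj t x).
Proof.
move=> ut; apply: (iffP andP) => -[xt].
  move=> /allP H; split => // x' x't lei; apply: H.
  by rewrite in_take ?index_mem// ltnS.
move=> H; split => //; apply/allP => x' x't'; apply: H; first exact: mem_take x't'.
have := x't'; rewrite in_take ?(mem_take x't')//.
Qed.

Definition biclique_free (V : finType) (G : {set V * V}) k := ~ exists I J : {set V},
  [/\ #|I| = k, #|J| = k & setX I J \subset G].

(** Either the A-side or the A'-side witnesses the reversal by the j-th
    extension; a j and b j are the greedily chosen elements, T j and S j the
    two lists. *)
Definition covers (V : finType) d k (G : {set V * V}) (X Y : {set V})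
    (a b : 'I_d -> V) (T S : 'I_d -> k.-tuple V) :=
  forall x y, x \in X -> y \in Y -> (x, y) \in G -> exists j,
    up_adj (fun x' => (x', y) \in G) (T j) x && ((a j, y) \in G) ||
    up_adj (fun y' => (x, y') \in G) (S j) y && ((x, b j) \in G).

(** The third property of a and b says that each edge left over is in a
    4-cycle with some a j and b j. For the fourth: if x and y both escaped the
    lists of the extension that reverses (x, y), the two lists would span a
    complete bipartite graph. *)
Lemma cover_structure n (G : {set 'I_n * 'I_n}) d k :
  has_realizer (bip_le (~: G)) d -> (d <= n)%N ->
  exists a b : 'I_d -> 'I_n, [/\ injective a, injective b,
   (forall x y, (forall j, x != a j) -> (forall j, y != b j) -> (x, y) \in G ->
      exists j, [/\ (x, b j) \in G, (a j, y) \in G & (a j, b j) \in G]) &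
   forall X Y : {set 'I_n}, (forall j, a j \notin X) -> (forall j, b j \notin Y) ->
     (k <= #|X|)%N -> (k <= #|Y|)%N -> biclique_free G k ->
     exists T S : 'I_d -> k.-tuple 'I_n,
     [/\ forall j, uniq (T j) /\ {subset T j <= X},
         forall j, uniq (S j) /\ {subset S j <= Y} & covers G X Y a b T S]].
Proof.
move=> /ferrers_cover[RA [RB [chA chB cov]]] dn.
have dV : (d <= #|'I_n|)%N by rewrite card_ord.
have [a [inja aP]] := greedy dV chA.
have [b [injb bP]] := greedy dV chB.
exists a, b; split => //.
  move=> x y xa yb xyG; have [j jP] := cov _ _ xyG.
  have [rA _ _] := chA j; have [rB _ _] := chB j.
  by exists j; split; apply: jP; rewrite ?rA ?rB ?aP ?bP.
move=> X Y aX bY kX kY nK.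
have /choice[T TP] : forall j, exists t : k.-tuple 'I_n, [/\ uniq t,
    {subset t <= X} & forall x x', x \in X -> x' \in t ->
      (index x' t <= index x t)%N -> RA j x x'].
  by move=> j; apply: top_list.
have /choice[S SP] : forall j, exists t : k.-tuple 'I_n, [/\ uniq t,
    {subset t <= Y} & forall x x', x \in Y -> x' \in t ->
      (index x' t <= index x t)%N -> RB j x x'].
  by move=> j; apply: top_list.
exists T, S; split => [j|j|x y xX yY xyG].
- by have [] := TP j.
- by have [] := SP j.
have [j jP] := cov _ _ xyG; exists j.
have [uT sT Tmax] := TP j; have [uS sS Smax] := SP j.
have [rA _ _] := chA j; have [rB _ _] := chB j.
have xa : RA j x (a j) by apply: aP => i; apply: contraTneq xX => ->; exact: aX.
have yb : RB j y (b j) by apply: bP => i; apply: contraTneq yY => ->; exact: bY.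
have [xT|xT] := boolP (x \in T j).
  apply/orP; left; rewrite jP ?rB// andbT; apply/up_adjP => //; split => // x' x'T le.
  by apply: jP; rewrite ?rB ?Tmax.
have [yS|yS] := boolP (y \in S j).
  apply/orP; right; rewrite (jP x (b j)) ?rA// andbT; apply/up_adjP => //; split => // x' x'T le.
  by apply: jP; rewrite ?rA ?Smax.
(* both lists lie on the far side of (x, y), hence are completely joined *)
case: nK; exists [set x' in T j], [set y' in S j]; split.
- by rewrite cardsE; move/card_uniqP: uT => ->; rewrite size_tuple.
- by rewrite cardsE; move/card_uniqP: uS => ->; rewrite size_tuple.
- apply/fintype.subsetP => -[x' y']; rewrite !inE /= => /andP[x'T y'S].
  apply: jP; [apply: Tmax|apply: Smax] => //.
    by rewrite (memNindex xT) ltnW// index_mem.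
  by rewrite (memNindex yS) ltnW// index_mem.
Qed.

End Cover.

(** * The probability that all edges of a rectangle are reversed *)

Section Blocks.
Context (R : realType) (V : finType) (d k : nat).
Implicit Types (H G : {set V * V}) (X Y : {set V}) (T S : 'I_d -> k.-tuple V).

(** The graph with the two sides exchanged; statements about lists in Y are
    obtained from those about lists in X. *)
Definition tr H : {set V * V} := [set e | (e.2, e.1) \in H].
Definition swap (e : V * V) := (e.2, e.1).

(** The j for which a_j can reverse e from the A-side, as far as the trace H
    can tell. *)
Definition covering_steps T H (e : V * V) : {set 'I_d} :=
  [set j | up_adj (fun x' => (x', e.2) \in H) (T j) e.1].

Definition level T H j i : {set V * V} :=
  [set e in H | (j \in covering_steps T H e) && (index e.1 (T j) == i)].

(** The entry x of T j at index i is determined, so an edge of this level is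
    determined by y, a common neighbour of the first i + 1 entries of T j. *)
Lemma level_le T H X Y (tau : nat -> R) j i : H \subset setX X Y ->
  few_common_nb H X Y k tau -> uniq (T j) -> {subset T j <= X} -> (i < k)%N ->
  #|level T H j i|%:R <= tau i.+1.
Proof.
move=> /fintype.subsetP sH sp uT sT ik.
pose I := [set x in take i.+1 (T j)].
have cI : #|I| = i.+1.
  rewrite cardsE; have /card_uniqP -> : uniq (take i.+1 (T j)) by rewrite take_uniq.
  by rewrite size_takel// size_tuple.
have sIX : I \subset X.
  by apply/fintype.subsetP => x; rewrite inE => /mem_take /sT.
have := sp I sIX; rewrite cI ik => /(_ isT); apply: le_trans.
rewrite ler_nat -(card_in_imset (f := snd)).
  apply: subset_leq_card; apply/fintype.subsetP => y /imsetP[[x y'] + ->].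
  rewrite !inE /= => /andP[xyH /andP[/andP[xT /allP adj] /eqP ix]].
  have /andP[_ ->] : (x \in X) && (y' \in Y).
    by have := sH _ xyH; rewrite finset.in_setX.
  apply/fintype.subsetP => -[x'' y'']; rewrite !inE /= => /andP[x''t /eqP ->].
  by apply: adj; rewrite ix.
move=> [x y] [x' y']; rewrite !inE /=.
move=> /andP[_ /andP[/andP[xT _] /eqP ix]] /andP[_ /andP[/andP[xT' _] /eqP ix']] eqy.
congr (_, _) => //; rewrite -(nth_index x xT) -(nth_index x xT').
by rewrite ix ix'.
Qed.

Lemma covering_steps_index T H e j : j \in covering_steps T H e -> (index e.1 (T j) < k)%N.
Proof. by rewrite inE => /andP[xT _]; rewrite -[X in (_ < X)%N](size_tuple (T j)) index_mem. Qed.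

(** Double counting: each j contributes one level for every index i < k. *)
Lemma sum_covering_steps T H X Y (tau : nat -> R) : H \subset setX X Y ->
  few_common_nb H X Y k tau -> (forall j, uniq (T j) /\ {subset T j <= X}) ->
  \sum_(e in H) #|covering_steps T H e|%:R <= d%:R * \sum_(i < k) tau i.+1.
Proof.
move=> sH sp TP.
have -> : \sum_(e in H) #|covering_steps T H e|%:R =
    \sum_(j < d) \sum_(e in H) (j \in covering_steps T H e)%:R :> R.
  rewrite exchange_big; apply: eq_bigr => e _.
  by rewrite -sum1_card natr_sum big_mkcond; apply: eq_bigr => j _; case: ifP.
rewrite mulr_natl -[X in _ *+ X]card_ord -sumr_const; apply: ler_sum => j _.
apply: (@le_trans _ _ (\sum_(i < k) #|level T H j i|%:R)).
  rewrite (eq_bigr (fun i : 'I_k => \sum_(e in H) ((j \in covering_steps T H e) && (index e.1 (T j) == i))%:R)).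
    rewrite exchange_big; apply: ler_sum => e _.
    case: (boolP (j \in _)) => [je|]; last by rewrite sumr_ge0.
    by rewrite (bigD1 (Ordinal (covering_steps_index je))) //= eqxx lerDl sumr_ge0.
  move=> i _; rewrite -sum1_card natr_sum big_mkcond [RHS]big_mkcond.
  by apply: eq_bigr => e _; rewrite [e \in level _ _ _ _]inE; case: (e \in H) => //=; case: (_ && _).
by apply: ler_sum => i _; have [uT sT] := TP j; exact: (level_le sH sp uT sT).
Qed.

(** Edges that some j reaches only through an entry other than the head of its
    list. *)
Definition deep T H : {set V * V} :=
  [set e in H | [exists j, (j \in covering_steps T H e) && (index e.1 (T j) != 0)%N]].

Lemma card_deep T H X Y (tau : nat -> R) : H \subset setX X Y ->
  few_common_nb H X Y k tau -> (forall j, uniq (T j) /\ {subset T j <= X}) ->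
  #|deep T H|%:R <= d%:R * \sum_(1 <= i < k) tau i.+1.
Proof.
move=> sH sp TP.
apply: (@le_trans _ _ (\sum_(j < d) \sum_(1 <= i < k) #|level T H j i|%:R)).
  rewrite -sum1_card natr_sum big_mkcond /=.
  apply: (@le_trans _ _ (\sum_(e : V * V) \sum_(j < d) \sum_(1 <= i < k) (e \in level T H j i)%:R)).
    apply: ler_sum => e _; case: ifP => [|_]; last first.
      by apply: sumr_ge0 => j _; apply: sumr_ge0.
    rewrite inE => /andP[eH /existsP[j /andP[je i0]]].
    rewrite (bigD1 j) //= (bigD1_seq (index e.1 (T j))) //=; last exact: iota_uniq.
      rewrite !inE eH eqxx andbT; move: je; rewrite inE => -> /=.
      rewrite -addrA lerDl addr_ge0// ?sumr_ge0// => j' _; exact: sumr_ge0.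
    by rewrite mem_index_iota lt0n i0 (covering_steps_index je).
  rewrite exchange_big; apply: ler_sum => j _; rewrite exchange_big.
  apply: ler_sum => i _; rewrite -sum1_card natr_sum [leRHS]big_mkcond.
  by apply: ler_sum => e _; case: ifP.
rewrite mulr_natl -[X in _ *+ X]card_ord -sumr_const; apply: ler_sum => j _.
rewrite big_nat [leRHS]big_nat; apply: ler_sum => i /andP[_ ik].
by have [uT sT] := TP j; exact: (level_le sH sp uT sT).
Qed.

Lemma sum_covering_steps_first T H X Y (tau : nat -> R) (E : {set V * V}) : H \subset setX X Y ->
  (0 < k)%N ->
  few_common_nb H X Y k tau -> (forall j, uniq (T j) /\ {subset T j <= X}) ->
  E \subset H :\: deep T H ->
  \sum_(e in E) #|covering_steps T H e|%:R <= d%:R * tau 1%N.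
Proof.
move=> sH k0 sp TP /fintype.subsetP sE.
have -> : \sum_(e in E) #|covering_steps T H e|%:R =
    \sum_(j < d) \sum_(e in E) (j \in covering_steps T H e)%:R :> R.
  rewrite exchange_big; apply: eq_bigr => e _.
  by rewrite -sum1_card natr_sum big_mkcond; apply: eq_bigr => j _; case: ifP.
rewrite mulr_natl -[X in _ *+ X]card_ord -sumr_const; apply: ler_sum => j _.
have [uT sT] := TP j; apply: le_trans (level_le sH sp uT sT k0).
rewrite -sum1_card natr_sum big_mkcond [leRHS]big_mkcond.
apply: ler_sum => e _; case: ifP => [/sE|_]; last by case: ifP.
rewrite finset.in_setD => /andP[nd eH].
case: (boolP (j \in _)) => [je|_]; last by case: ifP.
case: ifP => //; rewrite inE eH je /=.
suff -> : index e.1 (T j) == 0%N by [].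
apply: contraNT nd => i0; rewrite inE eH; apply/existsP; exists j.
by rewrite je.
Qed.

(** Given the trace H, the edge e is reversed only if the graph contains one
    of these pairs; all of them lie outside the rectangle X x Y. *)
Definition block T S (a b : 'I_d -> V) H (e : V * V) : {set V * V} :=
  [set (a j, e.2) | j in covering_steps T H e] :|: [set (e.1, b j) | j in covering_steps S (tr H) (swap e)].

Lemma card_block T S a b H e :
  (#|block T S a b H e| <= #|covering_steps T H e| + #|covering_steps S (tr H) (swap e)|)%N.
Proof.
by rewrite (leq_trans (leq_card_setU _ _))// leq_add// leq_imset_card.
Qed.

(** Necessary for the blocks of e and f to meet, see [block_disjoint]: two
    pairs (a_j, y) coincide only if both j and y do. *)
Definition clash T S H (e f : V * V) :=
  ((e.2 == f.2) && ~~ [disjoint covering_steps T H e & covering_steps T H f]) ||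
  ((e.1 == f.1) && ~~ [disjoint covering_steps S (tr H) (swap e) & covering_steps S (tr H) (swap f)]).

Lemma block_disjoint T S a b H X Y e f : injective a -> injective b ->
  (forall j, a j \notin X) -> e \in setX X Y -> f \in setX X Y ->
  ~~ clash T S H e f -> [disjoint block T S a b H e & block T S a b H f].
Proof.
move=> ia ib aX; rewrite !inE => /andP[eX eY] /andP[fX fY].
rewrite negb_or => /andP[nA nB]; rewrite -setI_eq0; apply/eqP/setP => u.
rewrite !inE; apply/negP => /andP[/orP[]/imsetP[j je ->] /orP[]/imsetP[j' jf []]].
- move=> /ia ejj' e2; move: nA; rewrite e2 eqxx /= negbK => /pred0P /(_ j) /=.
  by rewrite je ejj' jf.
- by move=> af; move: (aX j); rewrite af fX.
- by move=> ef; move: (aX j'); rewrite -ef eX.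
- move=> e1 /ib ejj'; move: nB; rewrite e1 eqxx /= negbK => /pred0P /(_ j) /=.
  by rewrite je ejj' jf.
Qed.

(** Resample G outside the rectangle X x Y: the trace H and hence E and the
    blocks of its members are fixed by the first sample, while the blocks are
    subsets of the complement and are met by the second sample independently. *)
Lemma trace_cover_prob (q : R) T S a b X Y (good : {set V * V} -> Prop) (W : R) :
  0 <= q <= 1 -> injective a -> injective b ->
  (forall j, a j \notin X) -> (forall j, b j \notin Y) ->
  (forall j, uniq (T j) /\ {subset T j <= X}) ->
  (forall j, uniq (S j) /\ {subset S j <= Y}) ->
  (forall H, good H -> H \subset setX X Y -> exists E : {set V * V},
    [/\ E \subset H, {in E &, forall e f, e != f -> ~~ clash T S H e f} &
     W <= \sum_(e in E) (1 - q) ^+ #|block T S a b H e|]) ->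
  prob q (fun G => good (G :&: setX X Y) /\ covers G X Y a b T S) <= expR (- W).
Proof.
move=> q01 ia ib aX bY TP SP goodP; set U := setX X Y.
rewrite /prob (expect_resample q U) -[leRHS](expect_const (V * V)%type q).
apply: expect_le => // G1; set H := G1 :&: U.
have HU : H \subset U by exact: finset.subsetIr.
(* resampling does not change the trace *)
have HE G2 : (H :|: G2 :\: U) :&: U = H.
  by apply/setP => e; rewrite !inE; case: (e \in G1); case: (e.1 \in X); case: (e.2 \in Y); rewrite ?andbF.
have [gH|ngH] := pselect (good H); last first.
  rewrite (eq_expect q (g := fun=> 0)) ?expect_const ?expR_ge0// => G2.
  by case: asboolP => // -[]; rewrite HE.
have [E [sEH noclash WE]] := goodP H gH HU.
have EX e : e \in E -> e \in U by move=> eE; apply: (fintype.subsetP HU); apply: (fintype.subsetP sEH).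
apply: (@le_trans _ _ (prob q (fun G2 => forall e, e \in E -> ~~ [disjoint block T S a b H e & G2]))).
  apply: prob_le => // G2 [_ cov] [x y] eE.
  have xyH : (x, y) \in H by apply: (fintype.subsetP sEH).
  have := EX _ eE; rewrite finset.in_setX /= => /andP[xX yY].
  have [|j] := cov x y xX yY; first by rewrite finset.in_setU xyH.
  have inU x' y' : ((x', y') \in H :|: G2 :\: U) && (x' \in X) && (y' \in Y) -> (x', y') \in H.
    by move=> /andP[/andP[h1 x'X] y'Y]; rewrite -(HE G2) finset.in_setI h1 finset.in_setX /= x'X y'Y.
  have outU x' y' : (x', y') \in H :|: G2 :\: U -> (x' \notin X) || (y' \notin Y) -> (x', y') \in G2.
    move=> + o; rewrite finset.in_setU => /orP[/(fintype.subsetP HU)|].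
      by rewrite finset.in_setX /= => /andP[x'X y'Y]; move: o; rewrite x'X y'Y.
    by rewrite finset.in_setD => /andP[].
  move=> /orP[/andP[up aG]|/andP[up bG]].
    apply/pred0Pn; exists (a j, y) => /=; apply/andP; split; last first.
      by apply: outU => //; rewrite aX.
    rewrite finset.in_setU; apply/orP; left; apply/imsetP; exists j => //.
    have [uT sT] := TP j; rewrite inE; apply/up_adjP => //.
    move/(up_adjP _ _ uT): up => [xT upP]; split => // x' x'T le.
    by apply: inU; rewrite upP// yY sT.
  apply/pred0Pn; exists (x, b j) => /=; apply/andP; split; last first.
    by apply: outU => //; rewrite bY orbT.
  rewrite finset.in_setU; apply/orP; right; apply/imsetP; exists j => //.
  have [uS sS] := SP j; rewrite inE; apply/up_adjP => //.
  move/(up_adjP _ _ uS): up => [xT upP]; split => // x' x'T le.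
  by rewrite inE /=; apply: inU; rewrite upP// xX sS.
apply: le_trans (hit_all_blocks_prob q01 _) _ => [e f eE fE ef|].
  by apply: (block_disjoint ia ib aX) (noclash _ _ eE fE ef); apply: EX.
by rewrite ler_expR lerN2.
Qed.

End Blocks.

(** * Edges with disjoint blocks *)

Section Select.
Context (R : realType).

(** Jensen's inequality for the convex function exp(- lam x), by way of its
    tangent at K. *)
Lemma jensen_pow (I : finType) (E : {set I}) (b kap : I -> nat) (q lam K : R) :
  0 <= lam -> 0 <= 1 - q <= 1 -> expR (- lam) <= 1 - q ->
  (forall e, b e <= kap e)%N ->
  \sum_(e in E) (kap e)%:R <= K * #|E|%:R ->
  #|E|%:R * expR (- (lam * K)) <= \sum_(e in E) (1 - q) ^+ b e.
Proof.
move=> lam0 /andP[p0 p1] lamq bk sumk.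
apply: (@le_trans _ _ (\sum_(e in E) expR (- (lam * K)) * (1 + lam * (K - (kap e)%:R)))).
  rewrite -mulr_sumr mulrC ler_wpM2l ?expR_ge0// big_split /= -mulr_sumr sumrB.
  rewrite !sumr_const -mulr_natr mul1r lerDl mulr_ge0// subr_ge0.
  by apply: le_trans sumk _; rewrite mulr_natr.
apply: ler_sum => e _.
apply: (@le_trans _ _ (expR (- (lam * K)) * expR (lam * (K - (kap e)%:R)))).
  by rewrite ler_wpM2l ?expR_ge0// expR_ge1Dx.
rewrite -expRD.
have -> : - (lam * K) + lam * (K - (kap e)%:R) = - lam * (kap e)%:R by ring.
rewrite expRM_natr.
apply: (@le_trans _ _ ((1 - q) ^+ kap e)).
  by apply: lerXn2r; rewrite ?nnegrE ?expR_ge0.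
by rewrite ler_wiXn2l.
Qed.

(** Greedily: choose a vertex, discard its at most D neighbours, and repeat. *)
Lemma independent_subset (I : finType) (c : rel I) (A : {set I}) (D : R) :
  symmetric c -> (forall e, e \in A -> #|[set f in A | c e f]|%:R <= D) -> 0 <= D ->
  exists E : {set I}, [/\ E \subset A,
    {in E &, forall e f, e != f -> ~~ c e f} & #|A|%:R <= #|E|%:R * (D + 1)].
Proof.
move=> sc + D0; have [m] := ubnP #|A|; elim: m A => // m IHm A; rewrite ltnS => ltm deg.
have [A0|[e eA]] := set_0Vmem A.
  exists finset.set0; split; rewrite ?finset.sub0set// ?A0 ?cards0 ?mul0r//.
  by move=> e f; rewrite inE.
pose N := [set f in A | c e f].
pose A' := A :\: (e |: N).
have sA'A : A' \subset A by exact: finset.subsetDl.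
have [||E [sE iE cE]] := IHm A'.
- apply: leq_trans ltm; apply: proper_card; apply/properP; split => //.
  by exists e; rewrite // !inE eqxx.
- move=> f fA'; apply: le_trans (deg f _); last exact: (fintype.subsetP sA'A).
  rewrite ler_nat subset_leq_card//; apply/fintype.subsetP => g; rewrite !inE.
  by move=> /andP[/andP[_ ->]].
have eE : e \notin E.
  by apply/negP => /(fintype.subsetP sE); rewrite !inE eqxx.
have ncE f : f \in E -> ~~ c e f.
  by move=> /(fintype.subsetP sE); rewrite !inE negb_or => /andP[/andP[_ +] fA]; rewrite fA.
exists (e |: E); split.
- by rewrite finset.subUset finset.sub1set eA (fintype.subset_trans sE).
- move=> f g; rewrite !inE => /predU1P[->|fE] /predU1P[->|gE].
  + by rewrite eqxx.
  + by move=> _; exact: ncE.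
  + by move=> _; rewrite sc ncE.
  + exact: iE.
- rewrite cardsU1 eE natrD mulrDl mul1r addrC.
  apply: (@le_trans _ _ (#|A'|%:R + (D + 1))); last by rewrite lerD2r.
  apply: (@le_trans _ _ (#|A'|%:R + (#|N|%:R + 1))); last by rewrite lerD2l lerD2r deg.
  rewrite -[1 in leRHS]/(1%:R) -!natrD ler_nat -(cardsID (e |: N) A) addnC.
  rewrite leq_add2l (leq_trans (subset_leq_card (finset.subsetIr _ _)))//.
  by rewrite cardsU1 addnC leq_add2l leq_b1.
Qed.

Context (V : finType) (d k : nat).
Implicit Types (H : {set V * V}) (X Y : {set V}) (T S : 'I_d -> k.-tuple V).

(** The properties of the trace that hold with high probability for all
    rectangles, after the deletion of exceptional vertices. *)
Definition good_trace (e0 : R) (tau : nat -> R) X Y H :=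
  [/\ e0 <= #|H|%:R, few_common_nb H X Y k tau & few_common_nb (tr H) Y X k tau].

Lemma tr_sub H X Y : H \subset setX X Y -> tr H \subset setX Y X.
Proof.
move=> /fintype.subsetP sH; apply/fintype.subsetP => -[y x].
by rewrite inE /= => /sH; rewrite !inE andbC.
Qed.

Lemma sum_covering_steps_tr H (E : {set V * V}) S :
  \sum_(e in E) #|covering_steps S (tr H) (swap e)|%:R =
  \sum_(e in tr E) #|covering_steps S (tr H) e|%:R :> R.
Proof.
rewrite (reindex_inj (inv_inj (_ : involutive (@swap V)))); last by case.
by apply: eq_bigl => -[x y]; rewrite inE.
Qed.

Lemma card_tr H : #|tr H| = #|H|.
Proof.
rewrite -(card_imset _ (inv_inj (_ : involutive (@swap V)))); last by case.
apply: eq_card => -[x y]; apply/imsetP/idP => [[[u v]]|xyH].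
  by rewrite inE /= => vuH [-> ->].
by exists (y, x); rewrite // inE.
Qed.

Lemma clash_sym T S H : symmetric (clash T S H).
Proof.
move=> e f; rewrite /clash [e.2 == _]eq_sym [e.1 == _]eq_sym.
by rewrite ![[disjoint _ e & _]]disjoint_sym disjoint_sym [X in _ || _ && ~~ X]disjoint_sym.
Qed.

(** After removing the deep edges, edges that share a j share the head of a
    list, and thus coincide as soon as they have the other vertex in common:
    no two of them clash. The average size of their blocks is governed by tau
    1 alone. *)
Lemma select_shallow (q lam K e0 : R) tau T S a b X Y H :
  0 <= q <= 1 -> 0 <= lam -> expR (- lam) <= 1 - q -> (0 < k)%N ->
  (forall j, uniq (T j) /\ {subset T j <= X}) ->
  (forall j, uniq (S j) /\ {subset S j <= Y}) ->
  H \subset setX X Y -> good_trace e0 tau X Y H ->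
  0 <= K ->
  2 * d%:R * tau 1%N <= K * (e0 - 2 * d%:R * \sum_(1 <= i < k) tau i.+1) ->
  exists E : {set V * V},
    [/\ E \subset H, {in E &, forall e f, e != f -> ~~ clash T S H e f} &
     (e0 - 2 * d%:R * \sum_(1 <= i < k) tau i.+1) * expR (- (lam * K)) <=
     \sum_(e in E) (1 - q) ^+ #|block T S a b H e|].
Proof.
move=> q01 lam0 lamq k0 TP SP HU [He0 spA spB] K0 hK.
set D := \sum_(1 <= i < k) tau i.+1 in hK *.
(* no edge of E is reached beyond the head of a list, on either side *)
pose E := H :\: (deep T H :|: tr (deep S (tr H))).
have HUt := tr_sub HU.
have dA := card_deep HU spA TP; have dB := card_deep HUt spB SP.
have cE : e0 - 2 * d%:R * D <= #|E|%:R.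
  have : (#|H| <= #|E| + (#|deep T H| + #|deep S (tr H)|))%N.
    rewrite -(cardsID (deep T H :|: tr (deep S (tr H))) H) addnC leq_add2l.
    apply: leq_trans (subset_leq_card (finset.subsetIr _ _)) _.
    by rewrite (leq_trans (leq_card_setU _ _))// card_tr.
  rewrite -(ler_nat R) !natrD; rewrite -/D in dA dB; lra.
exists E; split; first exact: finset.subsetDl.
  move=> e f; rewrite !(finset.in_setD, finset.in_setU).
  move=> /andP[/norP[ne1 ne2] eH] /andP[/norP[nf1 nf2] fH].
  move=> nef; apply: contraNN nef => /orP[] /andP[/eqP eq12 /pred0Pn[j /= /andP[je jf]]].
    have idx0 g : g \in H -> ~~ ((g \in H) && [exists j, (j \in covering_steps T H g) && (index g.1 (T j) != 0%N)]) ->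
        j \in covering_steps T H g -> index g.1 (T j) = 0%N.
      move=> gH + jg; rewrite gH /= negb_exists => /forallP /(_ j).
      by rewrite jg /= negbK => /eqP.
    have e0' : index e.1 (T j) = 0%N by apply: idx0 => //; move: ne1; rewrite inE.
    have f0' : index f.1 (T j) = 0%N by apply: idx0 => //; move: nf1; rewrite inE.
    move: je jf; rewrite !inE => /andP[eT _] /andP[fT _].
    rewrite -pair_eqE /pair_eq eq12 eqxx andbT.
    by rewrite -(nth_index e.1 eT) -(nth_index e.1 fT) e0' f0'.
  have idx0 g : g \in H -> ~~ (((g.2, g.1) \in tr H) && [exists j, (j \in covering_steps S (tr H) (g.2,g.1)) && (index g.2 (S j) != 0%N)]) ->
      j \in covering_steps S (tr H) (swap g) -> index g.2 (S j) = 0%N.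
    move=> gH + jg; rewrite inE /= -surjective_pairing gH /= negb_exists => /forallP /(_ j).
    by rewrite jg /= negbK => /eqP.
  have ne2' : ~~ (((e.2, e.1) \in tr H) && [exists j, (j \in covering_steps S (tr H) (e.2,e.1)) && (index e.2 (S j) != 0%N)]).
    by move: ne2; rewrite !inE.
  have nf2' : ~~ (((f.2, f.1) \in tr H) && [exists j, (j \in covering_steps S (tr H) (f.2,f.1)) && (index f.2 (S j) != 0%N)]).
    by move: nf2; rewrite !inE.
  have e0' := idx0 e eH ne2' je; have f0' := idx0 f fH nf2' jf.
  move: je jf; rewrite !inE => /andP[eT _] /andP[fT _].
  rewrite -pair_eqE /pair_eq eq12 eqxx /=.
  by rewrite -(nth_index e.2 (eT : e.2 \in _)) -(nth_index e.2 (fT : f.2 \in _)) e0' f0'.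
apply: (@le_trans _ _ (#|E|%:R * expR (- (lam * K)))); first by rewrite ler_wpM2r ?expR_ge0.
have p01 : 0 <= 1 - q <= 1 by move: q01; lra.
apply: (jensen_pow lam0 p01 lamq (fun e => card_block T S a b H e)).
under eq_bigr do rewrite natrD.
rewrite big_split /= sum_covering_steps_tr.
have sA := sum_covering_steps_first HU k0 spA TP (_ : E \subset H :\: deep T H).
have sB := sum_covering_steps_first HUt k0 spB SP (_ : tr E \subset tr H :\: deep S (tr H)).
apply: le_trans (lerD (sA _) (sB _)) _.
- by rewrite finset.setDS// finset.subsetUl.
- apply/fintype.subsetP => -[y x]; rewrite !inE /= negb_or.
  by move=> /andP[/andP[_ ->]] ->.
have : K * (e0 - 2 * d%:R * D) <= K * #|E|%:R by rewrite ler_wpM2l.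
lra.
Qed.

(** An edge that clashes with e is determined by a common j and an index in
    the list of j. *)
Lemma clash_degree T S H e :
  (forall j, uniq (T j)) -> (forall j, uniq (S j)) ->
  (#|[set f | clash T S H e f]| <=
   (#|covering_steps T H e| + #|covering_steps S (tr H) (swap e)|) * k)%N.
Proof.
move=> uT uS.
pose FA := [set (nth e.1 (T u.1) u.2, e.2) | u : 'I_d * 'I_k in setX (covering_steps T H e) [set: 'I_k]].
pose FB := [set (e.1, nth e.2 (S u.1) u.2) | u : 'I_d * 'I_k in setX (covering_steps S (tr H) (swap e)) [set: 'I_k]].
apply: (@leq_trans #|FA :|: FB|).
  apply: subset_leq_card; apply/fintype.subsetP => -[x y]; rewrite inE => /orP[]/andP[/= /eqP eq12 /pred0Pn[j /= /andP[je jf]]].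
    rewrite finset.in_setU; apply/orP; left; apply/imsetP; exists (j, Ordinal (covering_steps_index jf)) => /=.
      by rewrite finset.in_setX je finset.in_setT.
    by move: jf; rewrite inE => /andP[fT _]; rewrite nth_index// eq12.
  rewrite finset.in_setU; apply/orP; right; apply/imsetP; exists (j, Ordinal (covering_steps_index jf)) => /=.
    by rewrite finset.in_setX je finset.in_setT.
  by move: jf; rewrite inE => /andP[fT _]; rewrite nth_index// eq12.
rewrite (leq_trans (leq_card_setU _ _))// mulnDl leq_add//;
by rewrite (leq_trans (leq_imset_card _ _))// cardsX cardsT card_ord.
Qed.

(** By Markov's inequality at least e0 / 2 edges have at most K covering steps
    on the two sides together; such an edge clashes with at most K k edges. *)
Lemma select_independent (q lam K e0 : R) tau T S a b X Y H :
  0 <= q <= 1 -> 0 <= lam -> expR (- lam) <= 1 - q -> 0 < K ->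
  (forall j, uniq (T j) /\ {subset T j <= X}) ->
  (forall j, uniq (S j) /\ {subset S j <= Y}) ->
  H \subset setX X Y -> good_trace e0 tau X Y H ->
  2 * d%:R * \sum_(i < k) tau i.+1 <= K * (e0 / 2) ->
  exists E : {set V * V},
    [/\ E \subset H, {in E &, forall e f, e != f -> ~~ clash T S H e f} &
     e0 / 2 / (K * k%:R + 1) * expR (- (lam * K)) <=
     \sum_(e in E) (1 - q) ^+ #|block T S a b H e|].
Proof.
move=> q01 lam0 lamq K0 TP SP HU [He0 spA spB] hK.
have HUt := tr_sub HU.
pose kap e := (#|covering_steps T H e| + #|covering_steps S (tr H) (swap e)|)%N.
have sumkap : \sum_(e in H) (kap e)%:R <= K * (e0 / 2).
  apply: le_trans hK; under eq_bigr do rewrite natrD.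
  rewrite big_split /= sum_covering_steps_tr.
  have := sum_covering_steps HU spA TP; have := sum_covering_steps HUt spB SP; lra.
pose E1 := [set e in H | (kap e)%:R <= K].
have cE1 : e0 / 2 <= #|E1|%:R.
  have : K * #|H :\: E1|%:R <= \sum_(e in H) (kap e)%:R.
    rewrite mulr_natr -sumr_const big_mkcond [leRHS]big_mkcond /=.
    apply: ler_sum => e _; rewrite !inE; case: (e \in H); rewrite /= ?andbF// andbT.
    by case: (leP (kap e)%:R K) => [_|/ltW] /=; rewrite ?ler0n.
  have : (#|H| <= #|E1| + #|H :\: E1|)%N.
    by rewrite -(cardsID E1 H) leq_add2r subset_leq_card// finset.subsetIr.
  rewrite -(ler_nat R) natrD => h1 h2.
  have : K * #|H :\: E1|%:R <= K * (e0 / 2) by exact: le_trans h2 sumkap.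
  rewrite ler_pM2l//; lra.
have Kk0 : 0 <= K * k%:R by rewrite mulr_ge0// ltW.
have [|E [sE iE cE]] := @independent_subset _ (clash T S H) E1 (K * k%:R) (@clash_sym T S H) _ Kk0.
  move=> e; rewrite inE => /andP[eH eK].
  apply: (@le_trans _ _ (kap e * k)%:R).
    have uT j : uniq (T j) by have [] := TP j.
    have uS j : uniq (S j) by have [] := SP j.
    rewrite ler_nat; apply: leq_trans _ (clash_degree H e uT uS).
    by apply: subset_leq_card; apply/fintype.subsetP => f; rewrite !inE => /andP[_].
  by rewrite natrM ler_wpM2r.
exists E; split => //; first by apply: fintype.subset_trans sE _; apply/fintype.subsetP => e; rewrite inE => /andP[].
apply: (@le_trans _ _ (#|E|%:R * expR (- (lam * K)))).
  rewrite ler_wpM2r ?expR_ge0// ler_pdivrMr; last lra.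
  exact: le_trans cE1 cE.
have p01 : 0 <= 1 - q <= 1 by move: q01; lra.
apply: (jensen_pow lam0 p01 lamq (fun e => card_block T S a b H e)).
rewrite mulr_natr -sumr_const; apply: ler_sum => e /(fintype.subsetP sE).
by rewrite inE => /andP[].
Qed.

End Select.

(** * The union bound *)

Section Master.
Context (R : realType).

Lemma trK (V : finType) : involutive (@tr V).
Proof. by move=> H; apply/setP => -[x y]; rewrite !inE. Qed.

Lemma expect_tr (V : finType) (q : R) (f : {set V * V} -> R) :
  expect q f = expect q (fun G => f (tr G)).
Proof.
rewrite /expect (reindex_inj (inv_inj (@trK V))); apply: eq_bigr => G _.
congr (_ * _); rewrite /weight (reindex_inj (inv_inj (_ : involutive (@swap V)))).
  by apply: eq_bigr => -[x y] _; rewrite inE.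
by case.
Qed.

Lemma prob_tr (V : finType) (q : R) (P : {set V * V} -> Prop) :
  prob q (fun G => P (tr G)) = prob q P.
Proof. by rewrite /prob [RHS]expect_tr. Qed.

Lemma common_nb_trace (V : finType) (G : {set V * V}) (X Y I : {set V}) : I \subset X ->
  common_nb (G :&: setX X Y) Y I = common_nb G Y I.
Proof.
move=> sI; apply/setP => y; rewrite !inE; case yY : (y \in Y) => //=.
rewrite finset.subsetI; apply/andb_idr => _.
apply/fintype.subsetP => -[x y']; rewrite !inE /= => /andP[xI /eqP ->].
by rewrite yY (fintype.subsetP sI).
Qed.

Lemma few_common_nb_sub (V : finType) (G : {set V * V}) (X Y X' Y' : {set V}) k (tau : nat -> R) :
  X' \subset X -> Y' \subset Y -> few_common_nb G X Y k tau -> few_common_nb G X' Y' k tau.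
Proof.
move=> sX /fintype.subsetP sY sp I sI cI; apply: le_trans (sp I (fintype.subset_trans sI sX) cI).
rewrite ler_nat subset_leq_card//; apply/fintype.subsetP => y; rewrite !inE.
by move=> /andP[/sY -> ->].
Qed.

Lemma few_common_nb_trace (V : finType) (G : {set V * V}) (X Y : {set V}) k (tau : nat -> R) :
  few_common_nb G X Y k tau -> few_common_nb (G :&: setX X Y) X Y k tau.
Proof. by move=> sp I sI cI; rewrite common_nb_trace// sp. Qed.

Lemma tr_trace (V : finType) (G : {set V * V}) (X Y : {set V}) :
  tr (G :&: setX X Y) = tr G :&: setX Y X.
Proof. by apply/setP => -[x y]; rewrite !inE /= [(x \in _) && _]andbC. Qed.

Lemma subset_card (V : finType) (A : {set V}) m : (m <= #|A|)%N ->
  exists2 B : {set V}, B \subset A & #|B| = m.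
Proof.
move=> mA; have /card_gt0P[B] : (0 < #|[set B : {set V} | B \subset A & #|B| == m]|)%N.
  by rewrite cards_draws bin_gt0.
by rewrite inE => /andP[? /eqP ?]; exists B.
Qed.

(** What the choice of E has to achieve in every rectangle with a good trace;
    the two selection lemmas provide it. *)
Definition selectable n d k s1 (q e0 : R) (tau : nat -> R) (W : R) :=
  forall (X Y : {set 'I_n}) (a b : 'I_d -> 'I_n) (T S : 'I_d -> k.-tuple 'I_n)
     (H : {set 'I_n * 'I_n}), #|X| = s1 -> #|Y| = s1 ->
  (forall j, uniq (T j) /\ {subset T j <= X}) ->
  (forall j, uniq (S j) /\ {subset S j <= Y}) ->
  H \subset setX X Y -> good_trace k e0 tau X Y H ->
  exists E : {set 'I_n * 'I_n},
    [/\ E \subset H, {in E &, forall e f, e != f -> ~~ clash T S H e f} &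
     W <= \sum_(e in E) (1 - q) ^+ #|block T S a b H e|].

(** If d = n - s extensions suffice, then G contains K_(k,k), or some s1 x s1
    rectangle has few edges, or there is a large bad family on one of the two
    sides, or the good trace on some rectangle is covered by some a, b, T and
    S. The last factor counts the choices of a, b, X, Y, T and S. *)
Lemma realizer_prob_le n d s s1 k (l : nat -> nat) (q W : R) (lam tau : nat -> R) :
  0 <= q <= 1 -> (d + s = n)%N -> (s1 + \sum_(1 <= i < k.+1) i * l i <= s)%N ->
  (k <= s1)%N -> (forall i, 0 <= lam i) ->
  selectable n d k s1 q (99 / 100 * q * s1%:R ^+ 2) tau W ->
  prob q (fun G => has_realizer (bip_le (~: G : {set 'I_n * 'I_n})) d) <=
    (n ^ k.*2)%:R * q ^+ (k * k) +
    (n ^ s1.*2)%:R * expR (- (q * s1%:R ^+ 2 / (200 * 201))) +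
    2 * \sum_(1 <= i < k.+1) (n ^ s * n ^ (i * l i))%:R *
       expR ((l i)%:R * ((expR (lam i) - 1) * q ^+ i * s%:R - lam i * tau i)) +
    (n ^ d * n ^ d * (2 ^ n * 2 ^ n) * ((n ^ k) ^ d * (n ^ k) ^ d))%:R * expR (- W).
Proof.
move=> q01 dsn hs1 ks1 lam0 sel.
set e0 := 99 / 100 * q * s1%:R ^+ 2 in sel.
pose few (G : {set 'I_n * 'I_n}) := exists X Y : {set 'I_n}, [/\ #|X| = s1, #|Y| = s1 &
     #|G :&: setX X Y|%:R <= e0].
pose clique (G : {set 'I_n * 'I_n}) := exists I J : {set 'I_n}, [/\ #|I| = k, #|J| = k & setX I J \subset G].
pose badi i (G : {set 'I_n * 'I_n}) := exists (Y : {set 'I_n}) (F : {set {set 'I_n}}), [/\ #|Y| = s, #|F| = l i,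
      {in F &, forall I J : {set 'I_n}, I != J -> [disjoint I & J]},
      {in F, forall I : {set 'I_n}, #|I| = i}
    & {in F, forall I, tau i < #|common_nb G Y I|%:R}].
pose bad (G : {set 'I_n * 'I_n}) := exists i : 'I_k, badi i.+1 G.
(* all data that the realizer contributes *)
pose St := ({ffun 'I_d -> 'I_n} * {ffun 'I_d -> 'I_n} * ({set 'I_n} * {set 'I_n}) *
  ({ffun 'I_d -> k.-tuple 'I_n} * {ffun 'I_d -> k.-tuple 'I_n}))%type.
pose Ev (st : St) (G : {set 'I_n * 'I_n}) :=
  let: (a, b, (X, Y), (T, U)) := st in
  [/\ [/\ injective a, injective b, (forall j, a j \notin X) & (forall j, b j \notin Y)],
  [/\ #|X| = s1, #|Y| = s1, (forall j, uniq (T j) /\ {subset T j <= X}) &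
  (forall j, uniq (U j) /\ {subset U j <= Y})], good_trace k e0 tau X Y (G :&: setX X Y) &
  covers G X Y a b T U].
(* the data are extracted only from graphs outside the three unlikely events *)
have split_event G : has_realizer (bip_le (~: G : {set 'I_n * 'I_n})) d ->
    ((clique G \/ few G) \/ (bad G \/ bad (tr G))) \/ exists st : St, st \in [set: St] /\ Ev st G.
  move=> real; apply: contrapT => /not_orP[/not_orP[/not_orP[nclique nfew] /not_orP[nbad nbadt]]]; apply.
  have dn : (d <= n)%N by rewrite -dsn leq_addr.
  have [a [b [ia ib _ lists]]] := cover_structure k real dn.
  have cardC (f : 'I_d -> 'I_n) : injective f -> #|~: [set f j | j : 'I_d]| = s.
    move=> fi; have := cardsC [set f j | j : 'I_d].
    rewrite card_imset// !card_ord => cA; apply: (@addnI d). by rewrite cA dsn.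
  have del G' (X Y : {set 'I_n}) : #|X| = s -> #|Y| = s -> ~ bad G' ->
      exists X1 : {set 'I_n}, [/\ X1 \subset X, (s1 <= #|X1|)%N & few_common_nb G' X1 Y k tau].
    move=> cX cY nb; have [|X1 [sX1 cX1 sp]] := @delete_bad R _ G' X Y k l tau.
      move=> i /andP[i0 ik] [F [cF [dF cI badF]]]; apply: nb.
      case: i i0 ik cF cI badF => // i _ ik cF cI badF.
      by exists (Ordinal ik), Y, F.
    exists X1; split=> //; rewrite cX in cX1.
    by have := leq_trans hs1 cX1; rewrite leq_add2r.
    (* exceptional vertices of one side are judged by the undiminished other
     side; shrinking the latter only helps *)
have [X1 [sX1 cX1 spX]] := del G _ _ (cardC a ia) (cardC b ib) nbad.
  have [Y1 [sY1 cY1 spY]] := del (tr G) _ _ (cardC b ib) (cardC a ia) nbadt.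
  have [X sX cX] := subset_card cX1.
  have [Y sY cY] := subset_card cY1.
  have aX j : a j \notin X.
    apply/negP => /(fintype.subsetP sX) /(fintype.subsetP sX1); rewrite inE => /negP; apply.
    exact: imset_f.
  have bY j : b j \notin Y.
    apply/negP => /(fintype.subsetP sY) /(fintype.subsetP sY1); rewrite inE => /negP; apply.
    exact: imset_f.
  have [||T [S [TP SP cov]]] := lists X Y aX bY _ _ nclique.
  - by rewrite cX.
  - by rewrite cY.
  exists ([ffun j => a j], [ffun j => b j], (X, Y), ([ffun j => T j], [ffun j => S j])).
  split; first exact: finset.in_setT.
  split.
  - by split => [i j|i j|j|j]; rewrite ?ffunE //; [exact: ia|exact: ib].
  - by split => // j; rewrite ffunE.
  - split.
    + by rewrite leNgt; apply/negP => /ltW ltE; apply: nfew; exists X, Y.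
    + apply: few_common_nb_trace; apply: few_common_nb_sub spX => //.
      exact: fintype.subset_trans sY sY1.
    + rewrite tr_trace; apply: few_common_nb_trace; apply: few_common_nb_sub spY => //.
      exact: fintype.subset_trans sX sX1.
  - move=> x y xX yY xyG; have [j jP] := cov x y xX yY xyG; exists j.
    by rewrite !ffunE.
apply: le_trans (prob_le q01 split_event) _.
apply: le_trans (prob_or _ _ q01) _; apply: lerD.
  apply: le_trans (prob_or _ _ q01) _; apply: lerD.
    apply: le_trans (prob_or _ _ q01) _; apply: lerD.
      by have := @biclique_prob R 'I_n q k q01; rewrite card_ord.
    by have := @few_edges_prob R 'I_n q s1 q01; rewrite card_ord.
  apply: le_trans (prob_or _ _ q01) _; rewrite prob_tr.
  suff : prob q bad <= \sum_(1 <= i < k.+1) (n ^ s * n ^ (i * l i))%:R *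
       expR ((l i)%:R * ((expR (lam i) - 1) * q ^+ i * s%:R - lam i * tau i)) by lra.
  apply: le_trans (prob_exists _ q01) _.
  rewrite big_add1 /= big_mkord; apply: ler_sum => i _.
  by have := @bad_family_prob R 'I_n q s i.+1 (l i.+1) (lam i.+1) (tau i.+1) q01 (lam0 _); rewrite card_ord.
have -> : (n ^ d * n ^ d * (2 ^ n * 2 ^ n) * ((n ^ k) ^ d * (n ^ k) ^ d))%N = #|[set: St]|.
  rewrite cardsT !card_prod !card_ffun card_tuple !card_ord.
  by rewrite -!cardsT -!powersetT !card_powerset !cardsT card_ord.
apply: (prob_union (P := Ev)) => // -[[[a b] [X Y]] [T S]] _; rewrite /Ev.
have [[ia ib aX bY]|nv1] := pselect [/\ injective a, injective b,
  (forall j, a j \notin X) & (forall j, b j \notin Y)]; last first.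
  by rewrite prob_false ?expR_ge0// => G [].
have [[cX cY TP SP]|nv2] := pselect [/\ #|X| = s1, #|Y| = s1,
  (forall j, uniq (T j) /\ {subset T j <= X}) & (forall j, uniq (S j) /\ {subset S j <= Y})]; last first.
  by rewrite prob_false ?expR_ge0// => G [].
apply: le_trans (trace_cover_prob (good := good_trace k e0 tau X Y) q01 ia ib aX bY TP SP _).
  by apply: prob_le => // G [].
move=> H gH HU; exact: (sel X Y a b T S H cX cY TP SP HU gH).
Qed.

End Master.

(** * The two middle ranges of q *)

Section MiddleRange.
Context (R : realType).

Lemma natX_expR (n m : nat) : (0 < n)%N ->
  (n ^ m)%:R = expR (m%:R * ln (n%:R : R)).
Proof. by move=> n0; rewrite mulrC expRM_natr lnK ?posrE ?ltr0n// natrX. Qed.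

Lemma expR_half_le : expR (1 / 2) <= 42 / 25 :> R.
Proof.
have h : expR (1 / 16) <= 16 / 15 :> R.
  have e1 : 1 - 1 / 16 <= expR (- (1 / 16)) :> R by apply: expR_ge1Dx.
  rewrite -[leLHS]invrK -expRN; have -> : 16 / 15 = (15 / 16)^-1 :> R by field.
  by rewrite lef_pV2 ?posrE ?expR_gt0//; lra.
have -> : 1 / 2 = (1 / 16) * 8%:R :> R by field.
rewrite expRM_natr; apply: (@le_trans _ _ ((16 / 15) ^+ 8)).
  by apply: lerXn2r; rewrite ?nnegrE ?expR_ge0//; lra.
lra.
Qed.

Lemma expR_m2_ge : 1 / 8 <= expR (- 2) :> R.
Proof.
have e4 : expR 2 <= (42 / 25) ^+ 4 :> R.
  have -> : 2 = 1 / 2 * 4%:R :> R by field.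
  rewrite expRM_natr; have := expR_half_le; have := expR_ge0 (1 / 2 : R).
  set e := expR _ => e0 e1; apply: lerXn2r => //.
  by rewrite nnegrE; lra.
have e8 : expR 2 <= 8 :> R by apply: le_trans e4 _; lra.
by rewrite expRN div1r lef_pV2 ?posrE ?expR_gt0.
Qed.

(** From exp(- c q) <= 1 / (1 + c q), where (1 - q)(1 + c q) >= 1 by the
    assumption. *)
Lemma one_sub_ge_expR (q c : R) : 0 <= q -> 0 <= c -> c * q <= c - 1 ->
  expR (- (c * q)) <= 1 - q.
Proof.
move=> q0 c0 cq.
have h : 1 + c * q <= expR (c * q) by apply: expR_ge1Dx.
have c1 : 0 < 1 + c * q by have := mulr_ge0 c0 q0; lra.
rewrite expRN; apply: (@le_trans _ _ (1 + c * q)^-1).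
  by rewrite lef_pV2 ?posrE ?expR_gt0.
rewrite -[leLHS]div1r ler_pdivrMr//.
by have : q * (c * q) <= q * (c - 1); [rewrite ler_wpM2l|lra].
Qed.

Lemma le_inv_expR (n : nat) (x : R) : (0 < n)%N -> x <= - ln (n%:R) ->
  expR x <= n%:R^-1.
Proof.
move=> n0 xL; rewrite -[leRHS]lnK ?posrE ?invr_gt0 ?ltr0n// lnV ?posrE ?ltr0n//.
by rewrite ler_expR.
Qed.

Lemma few_edges_small (n m : nat) (q : R) : (0 < n)%N -> 1 <= ln (n%:R : R) ->
  (0 < m)%N -> 182 * 10 * 100 * ln (n%:R : R) <= q * m%:R ->
  (n ^ m.*2)%:R * expR (- (q * m%:R ^+ 2 / (200 * 201))) <= n%:R^-1.
Proof.
move=> n0 L1 m0 qm; rewrite natX_expR// -expRD; apply: le_inv_expR => //.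
rewrite -addnn natrD; set L := ln _ in L1 qm *; set u := m%:R in qm *.
have u1 : 1 <= u by rewrite ler1n.
have h1 : u * (182 * 10 * 100 * L) <= u * (q * u) by rewrite ler_wpM2l//; lra.
have h2 : L <= u * L by rewrite ler_peMl//; lra.
rewrite (_ : q * u ^+ 2 = u * (q * u)); last by ring.
lra.
Qed.

(** The s log n from the choice of Y is absorbed by l terms of size c log n. *)
Lemma bad_family_small (n s : nat) (c X : R) (i l : nat) : (0 < n)%N ->
  1 <= ln (n%:R : R) -> s%:R <= c * l%:R -> (0 < l)%N ->
  X <= - (c + i%:R + 1) * ln (n%:R : R) ->
  (n ^ s * n ^ (i * l))%:R * expR (l%:R * X) <= n%:R^-1.
Proof.
move=> n0 L1 Sc l0 XL; rewrite -expnD natX_expR// -expRD; apply: le_inv_expR => //.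
rewrite natrD natrM; set L := ln _ in L1 XL *; set S := s%:R in Sc *.
have l1 : 1 <= l%:R :> R by rewrite ler1n.
have h1 : l%:R * X <= l%:R * (- (c + i%:R + 1) * L) by rewrite ler_wpM2l//; lra.
have h2 : S * L <= c * l%:R * L by rewrite ler_wpM2r//; lra.
have h3 : L <= l%:R * L by rewrite ler_peMl//; lra.
rewrite (_ : l%:R * (- (c + i%:R + 1) * L) =
  - (c * l%:R * L) - (i%:R * l%:R) * L - l%:R * L) in h1; last by ring.
lra.
Qed.

(** The size of the bad families of i-sets to be excluded. A larger
    denominator deletes fewer vertices, but asks for a smaller tail in
    [bad_family_small]; with these values all deletions together cost at most
    9 percent of s. *)
Definition allowance (s i : nat) : nat :=
  (if i == 1 then s %/ 400 else if i == 2 then s %/ 27 else s %/ (50 * 100))%N.+1.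

Lemma divn_bounds (s m : nat) : (0 < m)%N ->
  s%:R <= m%:R * (s %/ m)%N.+1%:R :> R /\ m%:R * (s %/ m)%N.+1%:R <= s%:R + m%:R :> R.
Proof.
move=> m0; rewrite -!natrM -natrD !ler_nat.
have := divn_eq s m; have := ltn_pmod s m0; nia.
Qed.

Lemma sum_1_10 (F : nat -> R) :
  \sum_(1 <= i < 10) F i = F 1%N + F 2%N + F 3%N + F 4%N + F 5%N + F 6%N + F 7%N + F 8%N + F 9%N.
Proof. by rewrite /index_iota /= !big_cons big_nil addr0 !addrA. Qed.

Section Params.
Variables (n s : nat) (q : R).
Let N : R := n%:R.
Let L : R := ln N.
Let S : R := s%:R.
Hypotheses (n4 : (4 <= n)%N) (sn : (s <= n)%N) (L1 : 1 <= L).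
Hypotheses (q0 : 0 < q) (q11 : q <= 1 / 11).
Hypotheses (hS : 113 / 20 * q * N <= S) (hH : 32 * 32 * N * L <= q * S ^+ 2).
Hypotheses (hB : 200 * 200 * 5 * L <= q * S) (hK : N ^+ 19 * q ^+ 81 <= 1).
Hypotheses (hlam : expR (200 * 200) * q <= 1) (S4 : 100 * 100 <= S).

Let n0 : (0 < n)%N. Proof. exact: leq_trans n4. Qed.
Let N0 : 0 < N. Proof. by rewrite ltr0n. Qed.
Let S0 : 0 < S. Proof. by move: S4; lra. Qed.
Let Hh : R := q * S ^+ 2 / N.

(** For single vertices and pairs the threshold is a constant factor above the
    mean. For larger sets the mean is smaller than H by a factor of order q,
    and a small multiple of H suffices. *)
Let tauM (i : nat) : R :=
  if i == 1%N then 11 / 10 * (q * S) else if i == 2%N then 3 / 10 * Hh else Hh / (50 * 100).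
(** For sets of size at least 3 the large value makes the exponent lam * tau =
    8 H, at least 8 * 1024 log n, exceed the 5000 log n that the choice of Y
    costs per member of the family. *)
Let lamM (i : nat) : R :=
  if i == 1%N then 1 / 20 else if i == 2%N then 1 / 2 else 200 * 200.

Let HhN : Hh * N = q * S ^+ 2.
Proof. by rewrite /Hh divfK// gt_eqF. Qed.

Let HhL : 32 * 32 * L <= Hh.
Proof. by rewrite -(ler_pM2r N0) HhN; move: hH; rewrite mulrAC. Qed.

Let q2S : q ^+ 2 * S <= 20 / 113 * Hh.
Proof.
rewrite -(ler_pM2r N0).
have -> : 20 / 113 * Hh * N = 20 / 113 * (Hh * N) by ring.
have -> : q ^+ 2 * S * N = q ^+ 2 * (S * N) by ring.
rewrite HhN.
have : 0 <= q * S * (S - 113 / 20 * q * N).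
  by rewrite mulr_ge0 ?subr_ge0// mulr_ge0 ?ltW.
rewrite (_ : 20 / 113 * (q * S ^+ 2) = q ^+ 2 * (S * N) + 20 / 113 * (q * S * (S - 113 / 20 * q * N))); last by field.
lra.
Qed.

Let s1M : nat := (s - \sum_(1 <= i < 10) i * allowance s i)%N.

Let sum_lM : (\sum_(1 <= i < 10) i * allowance s i)%N%:R <= 9 / 100 * S.
Proof.
rewrite natr_sum sum_1_10 !natrM /allowance /=.
have [_ h1] := @divn_bounds s 400 isT.
have [_ h2] := @divn_bounds s 27 isT.
have [_ h3] := @divn_bounds s (50 * 100) isT.
move: h1 h2 h3; rewrite natrM.
set a := (s %/ 400)%N.+1%:R; set b := (s %/ 27)%N.+1%:R; set c := (s %/ (50 * 100))%N.+1%:R.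
rewrite -/S; move: S4; lra.
Qed.

Let s1M_ge : 91 / 100 * S <= s1M%:R.
Proof.
have le : (\sum_(1 <= i < 10) i * allowance s i <= s)%N.
  by rewrite -(ler_nat R); apply: le_trans sum_lM _; rewrite -/S; move: S0; lra.
by rewrite natrB//; move: sum_lM; rewrite -/S; lra.
Qed.

Let s1M0 : 9 <= s1M%:R :> R.
Proof. by have := s1M_ge; move: S4; lra. Qed.

Let clique_term : (n ^ 9.*2)%:R * q ^+ (9 * 9) <= N^-1.
Proof.
have -> : (9.*2 = 18)%N by []; have -> : (9 * 9 = 81)%N by [].
rewrite natrX -/N -[leRHS]mulr1 -ler_pdivrMl ?invr_gt0// invrK mulrA.
by have -> : N * N ^+ 18 = N ^+ 19 by rewrite -exprS.
Qed.

Let few_edges_term : (n ^ s1M.*2)%:R * expR (- (q * s1M%:R ^+ 2 / (200 * 201))) <= N^-1.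
Proof.
apply: few_edges_small => //; first by rewrite -(ltr_nat R); have := s1M0; lra.
apply: (@le_trans _ _ (91 / 100 * (q * S))); first by move: hB; rewrite -/N -/L; lra.
rewrite (_ : 91 / 100 * (q * S) = q * (91 / 100 * S)); last by ring.
by rewrite ler_pM2l.
Qed.

Let bad_family_term i : (0 < i < 10)%N ->
  (n ^ s * n ^ (i * allowance s i))%:R *
   expR ((allowance s i)%:R * ((expR (lamM i) - 1) * q ^+ i * S - lamM i * tauM i)) <= N^-1.
Proof.
case: i => [//|[|[|i]]] i10.
- apply: (bad_family_small (c := 400)) => //; rewrite -/N -/L /allowance /lamM /tauM /=.
    by have [] := @divn_bounds s 400 isT.
  have e : expR (1 / 20) - 1 <= 1 / 19 :> R.
    have e1 : 1 - 1 / 20 <= expR (- (1 / 20)) :> R by apply: expR_ge1Dx.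
    have : expR (1 / 20) <= 20 / 19 :> R.
      rewrite -[leLHS]invrK -expRN; have -> : 20 / 19 = (19 / 20)^-1 :> R by field.
      by rewrite lef_pV2 ?posrE ?expR_gt0//; lra.
    lra.
  have : (expR (1 / 20) - 1) * (q * S) <= 1 / 19 * (q * S).
    by rewrite ler_wpM2r// mulr_ge0// ltW.
  rewrite expr1 -mulrA; move: hB L1; lra.
- apply: (bad_family_small (c := 27)) => //; rewrite -/N -/L /allowance /lamM /tauM /=.
    by have [] := @divn_bounds s 27 isT.
  have : (expR (1 / 2) - 1) * (q ^+ 2 * S) <= 17 / 25 * (20 / 113 * Hh).
    have c0 : 0 <= 17 / 25 :> R by lra.
    apply: le_trans (ler_wpM2l c0 q2S).
    have q2S0 : 0 <= q ^+ 2 * S by rewrite mulr_ge0 ?exprn_ge0// ltW.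
    apply: (ler_wpM2r q2S0).
    by have := expR_half_le; lra.
  rewrite -mulrA; move: HhL L1; lra.
- have -> : allowance s i.+3 = (s %/ (50 * 100)).+1%N by [].
  have -> : lamM i.+3 = 200 * 200 by [].
  have -> : tauM i.+3 = Hh / (50 * 100) by [].
  apply: (bad_family_small (c := 50 * 100)) => //.
    by have [] := @divn_bounds s (50 * 100) isT; rewrite natrM.
  rewrite -/N -/L.
  have i7 : i.+3%:R <= 9 :> R by rewrite ler_nat.
  have qi : q ^+ i.+3 * S <= q * (20 / 113 * Hh).
    rewrite exprS -mulrA ler_pM2l//; apply: le_trans q2S.
    apply: (ler_wpM2r (ltW S0)); rewrite -[i.+2]addn2 exprD.
    apply: ler_piMl; first by rewrite exprn_ge0 ?ltW.
    by apply: exprn_ile1; [exact: ltW|move: q11; lra].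
  have Hh0 : 0 <= Hh by move: HhL L1; lra.
  have : (expR (200 * 200) - 1) * q ^+ i.+3 * S <= 20 / 113 * Hh.
    rewrite -mulrA; apply: (@le_trans _ _ (expR (200 * 200) * (q ^+ i.+3 * S))).
      have qS0 : 0 <= q ^+ i.+3 * S by rewrite mulr_ge0 ?exprn_ge0 ?ltW.
      by apply: (ler_wpM2r qS0); rewrite lerBlDr lerDl.
    apply: (@le_trans _ _ (expR (200 * 200) * (q * (20 / 113 * Hh)))).
      exact: (ler_wpM2l (expR_ge0 _) qi).
    rewrite mulrA; apply: ler_piMl; last exact: hlam.
    by apply: mulr_ge0 => //; lra.
  have : i.+3%:R * L <= 9 * L by rewrite ler_wpM2r//; move: L1; lra.
  move: HhL L1; lra.
Qed.

Let selectable_middle : selectable n (n - s) 9 s1M q (99 / 100 * q * s1M%:R ^+ 2) tauM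
  (27 * (N * L)).
Proof.
move=> X Y a b T U H _ _ TP UP HU gH.
have d_le : (n - s)%:R <= N by rewrite ler_nat leq_subr.
have d0 : 0 <= (n - s)%:R :> R by [].
have Hh0 : 0 < Hh by move: HhL L1; lra.
have qS0 : 0 < q * S by rewrite mulr_gt0.
have sumtau : \sum_(1 <= i < 9) tauM i.+1 = (3 / 10 + 7 / (50 * 100)) * Hh.
  by rewrite /index_iota /= !big_cons big_nil /tauM /=; lra.
set e0 := 99 / 100 * q * s1M%:R ^+ 2 in gH *.
have e0_ge : 9 / 11 * (Hh * N) <= e0.
  rewrite HhN /e0; have := s1M_ge; set u := s1M%:R => uS.
  have : (91 / 100 * S) ^+ 2 <= u ^+ 2.
    by rewrite lerXn2r ?nnegrE//; move: S0; lra.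
  move=> h; have : q * (91 / 100 * S) ^+ 2 <= q * u ^+ 2 by rewrite ler_pM2l.
  have : 0 <= q * S ^+ 2 by rewrite mulr_ge0 ?exprn_ge0 ?ltW.
  rewrite exprMn; lra.
have m_ge : 3 / 14 * (Hh * N) <= e0 - 2 * (n - s)%:R * \sum_(1 <= i < 9) tauM i.+1.
  rewrite sumtau; have : (n - s)%:R * Hh <= N * Hh by rewrite ler_wpM2r// ltW.
  have : 0 <= Hh * N by rewrite mulr_ge0// ltW.
  lra.
have lamq : expR (- (11 / 10 * q)) <= 1 - q.
  have c0 : 0 <= 11 / 10 :> R by rewrite divr_ge0.
  have h : 11 / 10 * q <= 11 / 10 - 1 by move: q11; lra.
  exact: (one_sub_ge_expR (ltW q0) c0 h).
have K0 : 0 <= 2 / (11 / 10 * q) by rewrite divr_ge0// mulr_ge0 ?ltW//; lra.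
have q01 : 0 <= q <= 1 by move: q0 q11; lra.
have hK2 : 2 * (n - s)%:R * tauM 1%N <= 2 / (11 / 10 * q) *
    (e0 - 2 * (n - s)%:R * \sum_(1 <= i < 9) tauM i.+1).
  apply: (@le_trans _ _ (2 / (11 / 10 * q) * (3 / 14 * (Hh * N)))); last by rewrite ler_wpM2l.
  rewrite HhN /tauM /=.
  have -> : 2 / (11 / 10 * q) * (3 / 14 * (q * S ^+ 2)) = (60 / 154) * (S * S).
    by field; rewrite gt_eqF.
  have : (n - s)%:R * (q * S) <= N * (q * S) by rewrite ler_wpM2r// ltW.
  have : 113 / 20 * q * N * S <= S * S by rewrite ler_pM2r.
  have : 0 <= N * (q * S) by rewrite mulr_ge0// ltW.
  lra.
have lam0 : 0 <= 11 / 10 * q by move: q0; lra.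
have [E [sE iE WE]] := @select_shallow R _ _ _ q (11 / 10 * q) (2 / (11 / 10 * q)) e0
  tauM T U a b X Y H q01 lam0 lamq isT TP UP HU gH K0 hK2.
  exists E; split => //; apply: le_trans WE.
  have -> : 11 / 10 * q * (2 / (11 / 10 * q)) = 2 by field; rewrite gt_eqF.
  have e2 := expR_m2_ge.
  apply: (@le_trans _ _ (3 / 14 * (Hh * N) * (1 / 8))).
    have : 32 * 32 * L * N <= Hh * N by rewrite ler_pM2r.
    have : 0 <= L * N by rewrite mulr_ge0 ?ltW//; move: L1; lra.
    lra.
  have HN0 : 0 <= 3 / 14 * (Hh * N) by apply: mulr_ge0; [rewrite divr_ge0|rewrite mulr_ge0 ?ltW].
  apply: le_trans (ler_wpM2l HN0 e2) _.
  exact: (ler_wpM2r (expR_ge0 _) m_ge).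
Qed.

Let choices_term : (n ^ (n - s) * n ^ (n - s) * (2 ^ n * 2 ^ n) *
   ((n ^ 9) ^ (n - s) * (n ^ 9) ^ (n - s)))%:R * expR (- (27 * (N * L))) <= N^-1.
Proof.
apply: (@le_trans _ _ ((n ^ (21 * n))%:R * expR (- (27 * (N * L))))).
  rewrite ler_wpM2r ?expR_ge0// ler_nat.
  have dn : (n ^ (n - s) <= n ^ n)%N by rewrite leq_pexp2l// leq_subr.
  have d9 : ((n ^ 9) ^ (n - s) <= n ^ (9 * n))%N.
    by rewrite -expnM leq_pexp2l// leq_mul2l leq_subr.
  have t4 : (2 ^ n * 2 ^ n <= n ^ n)%N.
    by rewrite -expnMn; case: (n) n4 => // n' n4'; rewrite leq_exp2r.
  have -> : (21 * n = n + n + n + (9 * n + 9 * n))%N by clear; lia.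
  rewrite 4!expnD; exact: leq_mul (leq_mul (leq_mul dn dn) t4) (leq_mul d9 d9).
rewrite natX_expR// -expRD; apply: le_inv_expR => //; rewrite -/L -/N natrM -/N.
have : L <= N * L by rewrite ler_peMl ?ler1n//; move: L1; lra.
have : 0 <= N * L by rewrite mulr_ge0 ?ltW//; move: L1; lra.
lra.
Qed.

(** Lists of length 9 suffice as G has no K_(9,9). Per extension there are H =
    q s^2 / n edges of the rectangle to be reversed, at least 1024 log n, and
    a pair of vertices has about q^2 s <= (20/113) H common neighbours; the
    thresholds leave 3/14 of the n H edges after the removal of deep ones,
    with blocks of average size at most 2 / (1.1 q). This gives an exponent of
    27 n log n against 21 n log n for the number of choices. *)
Lemma middle_prob : prob q (fun G => has_realizer (bip_le (~: G : {set 'I_n * 'I_n})) (n - s)) <=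
  21 / N.
Proof.
have q01 : 0 <= q <= 1 by move: q0 q11; lra.
have s1s : (s1M + \sum_(1 <= i < 10) i * allowance s i <= s)%N.
  rewrite /s1M subnK// -(ler_nat R); apply: le_trans sum_lM _; rewrite -/S; move: S0; lra.
have s19 : (9 <= s1M)%N by rewrite -(ler_nat R) s1M0.
have lamM0 i : 0 <= lamM i.
  by rewrite /lamM; case: ifP => _; [lra|case: ifP => _; lra].
apply: le_trans (realizer_prob_le q01 (subnK sn) s1s s19 lamM0 selectable_middle) _.
have pc : \sum_(1 <= i < 10) (n ^ s * n ^ (i * allowance s i))%:R *
   expR ((allowance s i)%:R * ((expR (lamM i) - 1) * q ^+ i * S - lamM i * tauM i)) <= 9 * N^-1.
  rewrite (_ : 9 * N^-1 = \sum_(1 <= i < 10) N^-1); last first.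
    by rewrite sumr_const_nat subn1 mulr_natl.
  by rewrite big_nat [leRHS]big_nat; apply: ler_sum => i i9; apply: bad_family_term.
move: clique_term few_edges_term choices_term pc; rewrite -/S.
set A := _ * _ ^+ (9 * 9); set B := _ * expR _; set D := _ * expR (- (27 * _)); set C := \sum_(_ <= _ < _) _.
lra.
Qed.


End Params.

End MiddleRange.

(** * The dense range of q *)

Section DenseRange.
Context (R : realType).

Lemma geo_sum_le (q : R) k : 0 <= q <= 1 / 2 -> \sum_(i < k) q ^+ i.+1 <= 2 * q.
Proof.
move=> /andP[q0 q2].
suff : \sum_(i < k) q ^+ i.+1 <= 2 * q - 2 * q ^+ k.+1 :> R.
  have : 0 <= q ^+ k.+1 by rewrite exprn_ge0.
  lra.
elim: k => [|k IHk]; first by rewrite big_ord0 expr1; lra.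
rewrite big_ord_recr /=.
have qk : 0 <= q ^+ k.+1 by rewrite exprn_ge0.
have : q ^+ k.+2 <= 1 / 2 * q ^+ k.+1 by rewrite [leLHS]exprS ler_wpM2r.
by move: IHk; lra.
Qed.

Section Params.
Variables (n s k l : nat) (q z : R).
Let N : R := n%:R.
Let L : R := ln N.
Let S : R := s%:R.
Hypotheses (n4 : (4 <= n)%N) (sn : (s <= n)%N) (L4 : 100 * 100 <= L).
Hypotheses (q0 : 0 < q) (q2 : q <= 1 / 2) (z1 : 1 <= z) (zL : z <= L).
Hypotheses (ez : expR z * L ^+ 8 = N * q ^+ 4) (hS : 24 * q * N <= z * S).
Hypotheses (hqS : 70 * L ^+ 6 <= q * S) (k6 : 6 * L <= k%:R) (k7 : k%:R <= 7 * L).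
Hypotheses (lS : S <= L ^+ 3 * l%:R) (lS2 : L ^+ 3 * l%:R <= 2 * S).

Let n0 : (0 < n)%N. Proof. exact: leq_trans n4. Qed.
Let N0 : 0 < N. Proof. by rewrite ltr0n. Qed.
Let L1 : 1 <= L. Proof. by move: L4; lra. Qed.
Let L0 : 0 < L. Proof. by move: L4; lra. Qed.
Let LX i : 0 < L ^+ i. Proof. by rewrite exprn_gt0. Qed.
Let S0 : 0 < S.
Proof. by have := LX 6; have := hqS; rewrite -(pmulr_rgt0 S q0); lra. Qed.
Let q01 : 0 <= q <= 1. Proof. by move: q0 q2; lra. Qed.

(** The term L^5 is there for large i, where the mean q^i s may be tiny: it
    alone makes the tail small enough for families of about s / L^3 members. *)
Let tauD (i : nat) : R := 6 / 5 * S * q ^+ i + L ^+ 5.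
Let lamD (i : nat) : R := 1 / 10.

Let s1D : nat := (s - \sum_(1 <= i < k.+1) i * l)%N.

Let k1 : (1 < k)%N. Proof. by rewrite -(ltr_nat R); move: k6 L4; lra. Qed.

Let sum_lD : (\sum_(1 <= i < k.+1) i * l)%N%:R <= S / 100.
Proof.
have h : (\sum_(1 <= i < k.+1) i * l <= k * (k * l))%N.
  rewrite -[X in (_ <= X * _)%N](subn1 k.+1) -sum_nat_const_nat big_nat [X in (_ <= X)%N]big_nat.
  by apply: leq_sum => i /andP[_ ik]; rewrite leq_mul2r -ltnS ik orbT.
apply: (@le_trans _ _ (k * (k * l))%N%:R); first by rewrite ler_nat.
rewrite !natrM; move: k7 lS2; set K := k%:R; set l' := l%:R => kL l2S.
have l0 : 0 <= l' by [].
have K0 : 0 <= K by [].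
have KK : K * K <= 7 * L * (7 * L) by apply: ler_pM.
have : K * K * l' <= 7 * L * (7 * L) * l' by rewrite ler_wpM2r.
have h2 : L * (L ^+ 2 * l') <= 2 * S by rewrite mulrA -exprS.
have h3 : 100 * 100 * (L ^+ 2 * l') <= L * (L ^+ 2 * l').
  by rewrite ler_wpM2r// mulr_ge0// exprn_ge0// ltW.
rewrite (_ : 7 * L * (7 * L) * l' = 49 * (L ^+ 2 * l')); last by ring.
rewrite mulrA; move: S0; lra.
Qed.

Let s1D_ge : 99 / 100 * S <= s1D%:R.
Proof.
have le : (\sum_(1 <= i < k.+1) i * l <= s)%N.
  by rewrite -(ler_nat R); apply: le_trans sum_lD _; rewrite -/S; move: S0; lra.
by rewrite natrB//; move: sum_lD; rewrite -/S; lra.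
Qed.

Let S_ge : 140 * L ^+ 6 <= S.
Proof.
have : q * S <= 1 / 2 * S by rewrite ler_pM2r.
by move: hqS; lra.
Qed.

Let LX1 i j : (i <= j)%N -> L ^+ i <= L ^+ j.
Proof. by move=> ij; apply: ler_weXn2l. Qed.

Let clique_term : (n ^ k.*2)%:R * q ^+ (k * k) <= N^-1.
Proof.
have half : 1 / 2 <= expR (- (1 / 2)) :> R.
  have : 1 + - (1 / 2) <= expR (- (1 / 2)) :> R by apply: expR_ge1Dx.
  lra.
apply: (@le_trans _ _ ((n ^ k.*2)%:R * expR (- (1 / 2)) ^+ (k * k))).
  rewrite ler_wpM2l//; apply: lerXn2r; rewrite ?nnegrE ?expR_ge0//; first exact: ltW.
  exact: le_trans q2 half.
rewrite -expRM_natr natX_expR// -expRD; apply: le_inv_expR => //; rewrite -/L.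
rewrite -addnn natrD natrM; move: k6; set K := k%:R => kL.
have K1 : 1 <= K by rewrite ler1n; exact: ltnW k1.
have : K * (6 * L) <= K * K by rewrite ler_wpM2l//; lra.
have : L <= K * L by rewrite ler_peMl// ltW.
lra.
Qed.

Let s1D0 : (0 < s1D)%N.
Proof. by rewrite -(ltr_nat R); have := s1D_ge; move: S0; lra. Qed.

Let few_edges_term : (n ^ s1D.*2)%:R * expR (- (q * s1D%:R ^+ 2 / (200 * 201))) <= N^-1.
Proof.
apply: few_edges_small s1D0 _ => //.
apply: (@le_trans _ _ (99 / 100 * (q * S))); last first.
  rewrite (_ : 99 / 100 * (q * S) = q * (99 / 100 * S)); last by ring.
  by rewrite ler_pM2l.
have h : 100 * 100 * 100 * L <= L ^+ 6.
  apply: (@le_trans _ _ (L ^+ 3)); last exact: LX1.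
  have : 100 * 100 * L <= L * L by rewrite ler_wpM2r// ltW.
  have : 100 * (L * L) <= L * (L * L) by rewrite ler_wpM2r ?mulr_ge0 ?ltW//; move: L4; lra.
  rewrite (_ : L ^+ 3 = L * (L * L)); last by ring.
  lra.
by move: hqS L0; rewrite -/N -/L; lra.
Qed.

Let bad_family_term i : (0 < i < k.+1)%N ->
  (n ^ s * n ^ (i * l))%:R *
   expR (l%:R * ((expR (lamD i) - 1) * q ^+ i * S - lamD i * tauD i)) <= N^-1.
Proof.
move=> /andP[_ ik].
have l0 : (0 < l)%N.
  by rewrite lt0n; apply/eqP => l0; move: lS; rewrite l0 mulr0; move: S0; lra.
apply: (bad_family_small (c := L ^+ 3)) => //; rewrite /lamD /tauD -/N -/L.
have e : expR (1 / 10) - 1 <= 1 / 9 :> R.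
  have e1 : 1 - 1 / 10 <= expR (- (1 / 10)) :> R by apply: expR_ge1Dx.
  have : expR (1 / 10) <= 10 / 9 :> R.
    rewrite -[leLHS]invrK -expRN; have -> : 10 / 9 = (9 / 10)^-1 :> R by field.
    by rewrite lef_pV2 ?posrE ?expR_gt0//; lra.
  lra.
have qi0 : 0 <= q ^+ i * S by rewrite mulr_ge0 ?exprn_ge0 ?ltW.
have : (expR (1 / 10) - 1) * (q ^+ i * S) <= 1 / 9 * (q ^+ i * S) by rewrite ler_wpM2r.
have iL : i%:R <= 7 * L by apply: le_trans k7; rewrite ler_nat -ltnS.
have h5 : 100 * 100 * L ^+ 4 <= L ^+ 5 by rewrite [leRHS]exprS ler_wpM2r ?(ltW (LX 4)).
have h4 : 1 * L ^+ 3 <= L ^+ 4 by rewrite [leRHS]exprS ler_wpM2r ?(ltW (LX 3)).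
have : (L ^+ 3 + i%:R + 1) * L <= L ^+ 4 + 7 * L ^+ 4 + L ^+ 4.
  rewrite (_ : L ^+ 4 = L ^+ 3 * L); last by ring.
  have LL : L <= L ^+ 3 by rewrite -[leLHS]expr1 LX1.
  rewrite (_ : L ^+ 3 * L + 7 * (L ^+ 3 * L) + L ^+ 3 * L = (L ^+ 3 + 7 * L ^+ 3 + L ^+ 3) * L); last by ring.
  apply: (ler_wpM2r (ltW L0)); move: L1; lra.
have := LX 4; lra.
Qed.

Let selectable_dense : selectable n (n - s) k s1D q (99 / 100 * q * s1D%:R ^+ 2) tauD
  (20 * (N * L ^+ 2)).
Proof.
move=> X Y a b T U H _ _ TP UP HU gH.
have d_le : (n - s)%:R <= N by rewrite ler_nat leq_subr.
set D := (n - s)%:R in d_le *.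
have d0 : 0 <= D by [].
have qS0 : 0 < q * S by rewrite mulr_gt0.
have sumtau : \sum_(i < k) tauD i.+1 <= 5 / 2 * (q * S).
  rewrite /tauD big_split /= -mulr_sumr sumr_const card_ord.
  have g : 6 / 5 * S * \sum_(i < k) q ^+ i.+1 <= 6 / 5 * S * (2 * q).
    rewrite ler_wpM2l ?geo_sum_le ?(ltW q0)// mulr_ge0 ?ltW// divr_ge0//.
  have f : L ^+ 5 *+ k <= 7 * L ^+ 6.
    by rewrite -mulr_natl [L ^+ 6]exprS mulrA; apply: (ler_wpM2r (ltW (LX 5))).
  have : 7 * L ^+ 6 <= 1 / 10 * (q * S) by move: hqS; lra.
  rewrite (_ : 6 / 5 * S * (2 * q) = 12 / 5 * (q * S)) in g; last by field.
  move: f g; set A := _ *+ k; set B := _ * \sum_(_ < _) _; lra.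
set e0 := 99 / 100 * q * s1D%:R ^+ 2 in gH *.
have e0_ge : 97 / 100 * (q * S ^+ 2) <= e0.
  rewrite /e0; have := s1D_ge; set u := s1D%:R => uS.
  have h : (99 / 100 * S) ^+ 2 <= u ^+ 2.
    by rewrite lerXn2r ?nnegrE//; move: S0; lra.
  have : q * (99 / 100 * S) ^+ 2 <= q * u ^+ 2 by rewrite ler_pM2l.
  have : 0 <= q * S ^+ 2 by rewrite mulr_ge0 ?exprn_ge0 ?ltW.
  rewrite exprMn; lra.
have lamq : expR (- (2 * q)) <= 1 - q.
  have h : 2 * q <= 2 - 1 by move: q2; lra.
  exact: (one_sub_ge_expR (ltW q0) _ h).
have z0 : 0 < z by move: z1; lra.
have K0 : 0 < z / (2 * q) by rewrite divr_gt0// mulr_gt0.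
have hK2 : 2 * D * \sum_(i < k) tauD i.+1 <= z / (2 * q) * (e0 / 2).
  apply: (@le_trans _ _ (z / (2 * q) * (97 / 200 * (q * S ^+ 2)))); last first.
    by rewrite (ler_pM2l K0); move: e0_ge; lra.
  have -> : z / (2 * q) * (97 / 200 * (q * S ^+ 2)) = 97 / (4 * 100) * (z * S * S).
    by field; rewrite gt_eqF.
  apply: (@le_trans _ _ (2 * D * (5 / 2 * (q * S)))).
    by rewrite ler_wpM2l// mulr_ge0.
  have : D * (q * S) <= N * (q * S) by rewrite ler_wpM2r// ltW.
  have : 24 * q * N * S <= z * S * S by rewrite ler_pM2r.
  have : 0 <= N * (q * S) by rewrite mulr_ge0// ltW.
  lra.
have lam0 : 0 <= 2 * q by move: q0; lra.
have [E [sE iE WE]] := @select_independent R _ _ _ q (2 * q) (z / (2 * q)) e0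
  tauD T U a b X Y H q01 lam0 lamq K0 TP UP HU gH hK2.
exists E; split => //; apply: le_trans WE.
have -> : 2 * q * (z / (2 * q)) = z by field; rewrite gt_eqF.
have ezE : expR (- z) = L ^+ 8 / (N * q ^+ 4).
  by rewrite -ez expRN invfM mulrA mulrAC divff ?mul1r// gt_eqF.
have Kk : z / (2 * q) * k%:R + 1 <= 4 * (z * L / q).
  have h : z / (2 * q) * k%:R <= z / (2 * q) * (7 * L) by rewrite ler_pM2l.
  have h1 : z / (2 * q) * (7 * L) = 7 / 2 * (z * L / q) by field; rewrite gt_eqF.
  have : 2 <= z * L / q.
    rewrite ler_pdivlMr//; have : 1 * 1 <= z * L by apply: ler_pM.
    by move: q2; lra.
  lra.
rewrite ezE.
have Kk0 : 0 < z / (2 * q) * k%:R + 1 by have := mulr_ge0 (ltW K0) (ler0n R k); lra.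
apply: (@le_trans _ _ (97 / 200 * (q * S ^+ 2) / (4 * (z * L / q)) * (L ^+ 8 / (N * q ^+ 4)))); last first.
  rewrite ler_wpM2r//.
    by rewrite divr_ge0 ?exprn_ge0 ?mulr_ge0 ?exprn_ge0 ?ltW.
  apply: ler_pM.
  - by rewrite mulr_ge0 ?divr_ge0// mulr_ge0 ?exprn_ge0 ?ltW.
  - by rewrite invr_ge0 mulr_ge0// divr_ge0 ?mulr_ge0 ?ltW.
  - by move: e0_ge; lra.
  - by rewrite lef_pV2 ?posrE// mulr_gt0// divr_gt0 ?mulr_gt0.
have -> : 97 / 200 * (q * S ^+ 2) / (4 * (z * L / q)) * (L ^+ 8 / (N * q ^+ 4)) =
   97 / (8 * 100) * ((S / q) ^+ 2 * L ^+ 7 / (z * N)).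
  by field; rewrite !gt_eqF.
have Sq : 24 * N / z <= S / q.
  rewrite ler_pdivrMr// mulrAC ler_pdivlMr//; move: hS; lra.
have Sq2 : (24 * N / z) ^+ 2 <= (S / q) ^+ 2.
  by rewrite lerXn2r ?nnegrE// ?divr_ge0 ?mulr_ge0 ?ltW.
apply: (@le_trans _ _ (97 / (8 * 100) * ((24 * N / z) ^+ 2 * L ^+ 7 / (z * N)))); last first.
  have c1 : 0 <= 97 / (8 * 100) :> R by lra.
  have zN : 0 <= (z * N)^-1 by rewrite invr_ge0 mulr_ge0 ?ltW.
  apply: (ler_wpM2l c1); apply: (ler_wpM2r zN).
  exact: (ler_wpM2r (ltW (LX 7)) Sq2).
have -> : 97 / (8 * 100) * ((24 * N / z) ^+ 2 * L ^+ 7 / (z * N)) =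
   97 * 18 / 25 * (N * (L ^+ 7 / z ^+ 3)).
  by field; rewrite !gt_eqF.
have : L ^+ 2 <= L ^+ 7 / z ^+ 3.
  rewrite ler_pdivlMr ?exprn_gt0//; apply: (@le_trans _ _ (L ^+ 2 * L ^+ 3)).
    rewrite ler_pM2l ?LX//; apply: lerXn2r => //; rewrite nnegrE; exact: ltW.
  by rewrite -exprD; exact: LX1.
move=> h; have h2 : N * L ^+ 2 <= N * (L ^+ 7 / z ^+ 3) by rewrite ler_pM2l.
have : 0 < N * L ^+ 2 by rewrite mulr_gt0.
lra.
Qed.

Let choices_term : (n ^ (n - s) * n ^ (n - s) * (2 ^ n * 2 ^ n) *
   ((n ^ k) ^ (n - s) * (n ^ k) ^ (n - s)))%:R * expR (- (20 * (N * L ^+ 2))) <= N^-1.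
Proof.
apply: (@le_trans _ _ ((n ^ (n + n + n + (k * n + k * n)))%:R * expR (- (20 * (N * L ^+ 2))))).
  rewrite ler_wpM2r ?expR_ge0// ler_nat.
  have dn : (n ^ (n - s) <= n ^ n)%N by rewrite leq_pexp2l// leq_subr.
  have d9 : ((n ^ k) ^ (n - s) <= n ^ (k * n))%N.
    by rewrite -expnM leq_pexp2l// leq_mul2l leq_subr orbT.
  have t4 : (2 ^ n * 2 ^ n <= n ^ n)%N.
    by rewrite -expnMn; case: (n) n4 => // n' n4'; rewrite leq_exp2r.
  rewrite 4!expnD; exact: leq_mul (leq_mul (leq_mul dn dn) t4) (leq_mul d9 d9).
rewrite natX_expR// -expRD; apply: le_inv_expR => //; rewrite -/L -/N !natrD natrM -/N.
have NL0 : 0 < N * L by rewrite mulr_gt0.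
have : L <= N * L by rewrite ler_peMl ?ler1n//; exact: ltW.
have : k%:R * (N * L) <= 7 * L * (N * L) by rewrite ler_wpM2r// ltW.
have : 100 * 100 * (N * L) <= L * (N * L) by rewrite ler_wpM2r// ltW.
rewrite (_ : N * L ^+ 2 = L * (N * L)); last by ring.
lra.
Qed.

(** Now lists have length about 6 log n. Blocks of the chosen edges have size
    at most z / (2 q), so (1 - q) to this power is at least exp(- z) = (log
    n)^8 / (n q^4), and the number of chosen edges is of order q^2 s^2 / (z
    log n). The exponent is at least 20 n (log n)^2, which exceeds the
    logarithm of the number of choices. *)
Lemma dense_prob : prob q (fun G => has_realizer (bip_le (~: G : {set 'I_n * 'I_n})) (n - s)) <=
  17 * L / N.
Proof.
have s1s : (s1D + \sum_(1 <= i < k.+1) i * l <= s)%N.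
  rewrite /s1D subnK// -(ler_nat R); apply: le_trans sum_lD _; rewrite -/S; move: S0; lra.
have s1k : (k <= s1D)%N.
  rewrite -(ler_nat R); apply: le_trans k7 _; apply: le_trans s1D_ge.
  have : L <= L ^+ 6 by rewrite -[leLHS]expr1 LX1.
  move: S_ge L0; lra.
have lamD0 i : 0 <= lamD i by rewrite /lamD; lra.
apply: le_trans (realizer_prob_le (l := fun=> l) q01 (subnK sn) s1s s1k lamD0 selectable_dense) _.
have pc : \sum_(1 <= i < k.+1) (n ^ s * n ^ (i * l))%:R *
   expR (l%:R * ((expR (lamD i) - 1) * q ^+ i * S - lamD i * tauD i)) <= k%:R * N^-1.
  rewrite (_ : k%:R * N^-1 = \sum_(1 <= i < k.+1) N^-1); last first.
    by rewrite sumr_const_nat subn1 mulr_natl.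
  by rewrite big_nat [leRHS]big_nat; apply: ler_sum => i i9; apply: bad_family_term.
have Ni : 0 < N^-1 by rewrite invr_gt0.
have kN : k%:R * N^-1 <= 7 * L * N^-1 by rewrite ler_pM2r.
have LN : 1 * N^-1 <= L * N^-1 by rewrite ler_pM2r.
move: clique_term few_edges_term choices_term pc; rewrite -/S.
set A := _ * _ ^+ (k * k); set B := _ * expR (- (q * _ / _)); set D := _ * expR (- (20 * _)); set C := \sum_(_ <= _ < _) _.
rewrite (_ : 17 * L / N = 17 * (L * N^-1)); last by rewrite mulrA.
lra.
Qed.

End Params.

End DenseRange.

(** * The sparse range of q *)

Section SparseRange.
Context (R : realType).

(** By induction, from (1 + 1/m)^m <= e. *)
Lemma expn_le_fact m : m%:R ^+ m <= expR m%:R * m`!%:R :> R.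
Proof.
elim: m => [|m IHm]; first by rewrite expr0 expR0 mul1r.
have step : m.+1%:R ^+ m <= expR 1 * m%:R ^+ m :> R.
  case: m {IHm} => [|m]; first by rewrite !expr0 mulr1 -[leLHS]expR0 ler_expR.
  have m0 : (0 : R) < m.+1%:R by [].
  have -> : m.+2%:R = (1 + m.+1%:R^-1) * m.+1%:R :> R.
    by rewrite mulrDl mul1r mulVf ?gt_eqF// -[m.+2]addn1 natrD.
  rewrite exprMn ler_wpM2r ?exprn_ge0//.
  have -> : expR 1 = expR (m.+1%:R^-1) ^+ m.+1 :> R.
    by rewrite -expRM_natr mulVf ?gt_eqF.
  by apply: lerXn2r; rewrite ?nnegrE ?expR_ge0 ?expR_ge1Dx// addr_ge0.
have -> : expR m.+1%:R = expR m%:R * expR 1 :> R by rewrite -[m.+1]addn1 natrD expRD.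
rewrite exprS factS natrM.
apply: (@le_trans _ _ (m.+1%:R * (expR 1 * (expR m%:R * m`!%:R)))).
  rewrite ler_wpM2l//; apply: le_trans step _.
  by rewrite ler_wpM2l ?expR_ge0.
by rewrite le_eqVlt; apply/orP; left; apply/eqP; ring.
Qed.

Lemma bin_le_expR (n m : nat) (t : R) : (0 < m)%N -> 0 <= t ->
  expR 1 * n%:R <= t * m%:R -> 'C(n, m)%:R <= t ^+ m.
Proof.
move=> m0 t0 h; have mm : 0 < m%:R ^+ m :> R by rewrite exprn_gt0// ltr0n.
have f0 : 0 < m`!%:R :> R by rewrite ltr0n fact_gt0.
rewrite -(ler_pM2r mm) -exprMn.
apply: (@le_trans _ _ (expR m%:R * n%:R ^+ m)).
  apply: (@le_trans _ _ ('C(n, m)%:R * (expR m%:R * m`!%:R))).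
    by rewrite ler_wpM2l// expn_le_fact.
  rewrite mulrCA ler_wpM2l ?expR_ge0// -natrM -natrX ler_nat bin_ffact.
  elim: m {m0 h mm f0} => // m IHm; rewrite ffactnSr expnSr leq_mul//.
  exact: leq_subr.
have -> : expR m%:R = expR 1 ^+ m :> R by rewrite -expRM_natr mul1r.
rewrite -exprMn; apply: lerXn2r => //.
  by rewrite nnegrE mulr_ge0 ?expR_ge0.
by rewrite nnegrE mulr_ge0.
Qed.

(** Discard from X the vertices in 4-cycles. Either there are at least c of
    these, or what remains contains an independent m x m rectangle. *)
Lemma realizer_c4_prob n s m (q c : R) : 0 <= q <= 1 -> (s <= n)%N -> 0 < c ->
  m%:R + c <= s%:R ->
  prob q (fun G => has_realizer (bip_le (~: G : {set 'I_n * 'I_n})) (n - s)) <=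
  (n ^ 4)%:R * q ^+ 4 / c + ('C(n, m) ^ 2)%:R * (1 - q) ^+ (m * m).
Proof.
move=> q01 sn c0 mcs.
pose V4 (G : {set 'I_n * 'I_n}) := [set x | [exists a, exists b, exists y, c4 G a x b y]].
pose indep (G : {set 'I_n * 'I_n}) := exists X Y : {set 'I_n},
  [/\ #|X| = m, #|Y| = m & [disjoint setX X Y & G]].
have split_event G : has_realizer (bip_le (~: G : {set 'I_n * 'I_n})) (n - s) ->
    c <= #|V4 G|%:R \/ indep G.
  move=> real; have [|V4c] := leP c (#|V4 G|%:R); [by left|right].
  have [a [b [ia ib cov _]]] := cover_structure 0 real (leq_subr _ _).
  have cardC (f : 'I_(n - s) -> 'I_n) : injective f -> #|~: [set f j | j : 'I_(n - s)]| = s.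
    move=> fi; have := cardsC [set f j | j : 'I_(n - s)].
    rewrite card_imset// !card_ord => cA; apply: (@addnI (n - s)%N).
    by rewrite cA subnK.
  have [X sX cX] : exists2 X : {set 'I_n}, X \subset ~: [set a j | j : 'I_(n - s)] :\: V4 G & #|X| = m.
    apply: subset_card; have := cardsID (V4 G) (~: [set a j | j : 'I_(n - s)]).
    rewrite (cardC a ia); set A := #|_|; set B := #|_ :\: _| => AB.
    have : (A <= #|V4 G|)%N by rewrite subset_leq_card// finset.subsetIr.
    rewrite -(ler_nat R) => AV; rewrite -(ler_nat R).
    have : A%:R + B%:R = s%:R :> R by rewrite -natrD AB.
    lra.
  have [Y sY cY] : exists2 Y : {set 'I_n}, Y \subset ~: [set b j | j : 'I_(n - s)] & #|Y| = m.
    apply: subset_card; rewrite (cardC b ib) -(ler_nat R); lra.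
  exists X, Y; split => //.
  apply/pred0P => -[x y] /=; apply/negP; rewrite finset.in_setX => /andP[/andP[xX yY] xyG].
  have := fintype.subsetP sX _ xX; rewrite !inE => /andP[nV4 nax].
  have := fintype.subsetP sY _ yY; rewrite !inE => nby.
  have xa j : x != a j by apply: contraNneq nax => ->; exact: imset_f.
  have yb j : y != b j by apply: contraNneq nby => ->; exact: imset_f.
  have [j [xb ay ab]] := cov x y xa yb xyG.
  case/negP: nV4; apply/existsP; exists (a j); apply/existsP; exists (b j).
  by apply/existsP; exists y; rewrite /c4 eq_sym xa eq_sym yb ab ay xb.
apply: le_trans (prob_le q01 split_event) _.
apply: le_trans (prob_or _ _ q01) _; apply: lerD.
  by have := @c4_prob R 'I_n q c q01 c0; rewrite card_ord.
by have := @indep_prob R 'I_n q m q01; rewrite card_ord.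
Qed.

(** With m about (2 + eps/2) Lam / q, the number of rectangles is at most (q
    n)^(2 m), while each is independent with probability at most exp(- q m^2). *)
Lemma sparse_prob n s (q eps : R) : let N : R := n%:R in let Lam := ln (q * N) in
  0 < eps < 1 -> 0 < q <= 3 / 4 * eps -> 2 <= Lam -> (s <= n)%N ->
  N ^+ 4 * q ^+ 5 <= 1 -> (2 + eps) * Lam / q <= s%:R ->
  prob q (fun G => has_realizer (bip_le (~: G : {set 'I_n * 'I_n})) (n - s)) <=
    8 / (eps * Lam) + expR (- (eps / 2 * Lam)).
Proof.
move=> N Lam /andP[eps0 eps1] /andP[q0 qe] Lam2 sn hq hs.
have Lam0 : 0 < Lam by lra.
have Lq : 0 < Lam / q by rewrite divr_gt0.
have qN0 : 0 < q * N.
  rewrite ltNge; apply/negP => qN; have := Lam0; rewrite /Lam ln0 ?ltxx//.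
pose m := Num.truncn ((2 + eps / 2) * (Lam / q)).
have x0 : 0 <= (2 + eps / 2) * (Lam / q) by rewrite mulr_ge0 ?ltW//; lra.
have /andP[m1 m2] := truncn_itv x0; rewrite -/m in m1 m2; clearbody m.
have c0 : 0 < eps / 8 * (Lam / q) by rewrite mulr_gt0//; lra.
have big : 1 <= 3 / 8 * eps * (Lam / q).
  rewrite mulrA ler_pdivlMr// mul1r.
  have : eps * 2 <= eps * Lam by rewrite ler_pM2l.
  lra.
have mcs : m.+1%:R + eps / 8 * (Lam / q) <= s%:R.
  apply: le_trans hs; rewrite -mulrA mulrDl -[m.+1]addn1 natrD; lra.
have q01 : 0 <= q <= 1 by lra.
apply: le_trans (realizer_c4_prob q01 sn c0 mcs) _; apply: lerD.
  rewrite natrX -/N ler_pdivrMr//.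
  have -> : 8 / (eps * Lam) * (eps / 8 * (Lam / q)) = 1 / q.
    by field; rewrite !gt_eqF.
  by rewrite ler_pdivlMr// -mulrA -exprSr.
have mL : (2 + eps / 2) * Lam <= q * m.+1%:R.
  have -> : (2 + eps / 2) * Lam = q * ((2 + eps / 2) * (Lam / q)) by field; rewrite gt_eqF.
  by rewrite ler_pM2l// ltW.
have qN2 : 'C(n, m.+1)%:R <= (q * N) ^+ m.+1.
  apply: bin_le_expR => //; first exact: ltW.
  have e4 : expR 1 <= 4 :> R.
    have h : expR (1 / 2) <= 2 :> R by have := expR_half_le R; lra.
    have -> : expR 1 = expR (1 / 2) * expR (1 / 2) :> R by rewrite -expRD; congr expR; field.
    have : expR (1 / 2) * expR (1 / 2) <= 2 * 2 :> R by apply: ler_pM; rewrite ?expR_ge0.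
    lra.
  rewrite mulrAC; apply: (@le_trans _ _ (4 * N)); first by rewrite ler_wpM2r.
  rewrite ler_wpM2r//; apply: le_trans mL.
  have : 0 <= eps / 2 * Lam by rewrite mulr_ge0 ?ltW//; lra.
  lra.
have qE : q * N = expR Lam by rewrite lnK// posrE.
apply: (@le_trans _ _ (((q * N) ^+ m.+1) ^+ 2 * expR (- q) ^+ (m.+1 * m.+1))).
  apply: ler_pM => //; first by rewrite exprn_ge0//; lra.
    by rewrite natrX; apply: lerXn2r; rewrite ?nnegrE// exprn_ge0// ltW.
  apply: lerXn2r; rewrite ?nnegrE ?expR_ge0//; first lra.
  by have := expR_ge1Dx (- q).
rewrite qE -exprM -!expRM_natr -expRD ler_expR !natrM.
set M := m.+1%:R in mL *.
have M1 : 1 <= M by rewrite ler1n.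
have : M * ((2 + eps / 2) * Lam) <= M * (q * M) by rewrite ler_wpM2l//; lra.
have : 1 * (eps / 2 * Lam) <= M * (eps / 2 * Lam).
  by rewrite ler_wpM2r// mulr_ge0 ?ltW//; lra.
lra.
Qed.

End SparseRange.

(** * Asymptotics in n and the passage to the dimension *)

Section Asymptotics.
Local Open Scope classical_set_scope.
Local Open Scope ring_scope.
Context (R : realType).

Lemma near_ln_ge (A : R) : \forall n \near \oo, A <= ln (n%:R : R).
Proof.
near=> n; have nA : expR A <= n%:R by near: n; exact: nbhs_infty_ger.
by rewrite -(expRK A) ler_ln ?posrE ?expR_gt0// (lt_le_trans (expR_gt0 A)).
Unshelve. all: by end_near.
Qed.

Lemma near_poly_ln (C : R) k :
  \forall n \near \oo, C * ln (n%:R : R) ^+ k <= n%:R.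
Proof.
near=> n.
have L0 : 0 <= ln (n%:R : R) by near: n; exact: near_ln_ge.
have LC : C * k.+1%:R ^+ k.+1 <= ln (n%:R : R) by near: n; exact: near_ln_ge.
have n0 : 0 < n%:R :> R by rewrite ltr0n; near: n; exists 1%N.
rewrite [leRHS](_ : _ = expR (ln n%:R / k.+1%:R) ^+ k.+1 :> R); last first.
  by rewrite -expRM_natr divfK ?lnK.
apply: (@le_trans _ _ ((ln n%:R / k.+1%:R) ^+ k.+1)); last first.
  have x0 : 0 <= ln (n%:R : R) / k.+1%:R by rewrite divr_ge0.
  apply: lerXn2r; rewrite ?nnegrE ?expR_ge0//.
  by apply: le_trans (expR_ge1Dx _); rewrite lerDr.
rewrite expr_div_n ler_pdivlMr ?exprn_gt0// mulrAC [leRHS]exprS.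
by rewrite ler_wpM2r ?exprn_ge0.
Unshelve. all: by end_near.
Qed.

Lemma powRN_exp (N a : R) (k m : nat) : 0 < N -> a * m%:R = k%:R ->
  (N `^ (- a)) ^+ m = (N ^+ k)^-1.
Proof.
move=> N0 am; rewrite -powR_mulrn ?powR_ge0// -powRrM mulNr am.
by rewrite powRN powR_mulrn// ltW.
Qed.

Lemma powR_exp (x a : R) (m : nat) : 0 <= x -> a * m%:R = 1 -> (x `^ a) ^+ m = x.
Proof.
by move=> x0 am; rewrite -powR_mulrn ?powR_ge0// -powRrM am powRr1.
Qed.

Lemma Pr_eq_prob n (q : R) (ev : pred {set 'I_n * 'I_n}) :
  Pr (1 - q) ev = prob q (fun G => ev (~: G)).
Proof.
rewrite /prob expect_setC /expect /Pr big_mkcond /=; apply: eq_bigr => E _.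
by rewrite finset.setCK asboolb; case: (ev E); rewrite ?mulr1 ?mulr0.
Qed.

(** Take for s the least integer above S. A dimension of at most n - S gives a
    realizer of that size, and copies of its members make it one of size n - s
    exactly. *)
Lemma small_dim_prob n (q S B : R) : 0 <= q <= 1 -> 0 <= S -> 0 <= B ->
  (forall s, S <= s%:R -> (s <= n)%N ->
     prob q (fun G => has_realizer (bip_le (~: G : {set 'I_n * 'I_n})) (n - s)) <= B) ->
  prob q (fun G => ~ (n%:R - S < (poset_dim (bip_le (~: G : {set 'I_n * 'I_n})))%:R)) <= B.
Proof.
move=> q01 S0 B0 HB.
have exS : exists s : nat, S <= s%:R.
  exists (Num.truncn S).+1; have /andP[_ h] := truncn_itv S0; exact: ltW.
case: (ex_minnP exS) => s Ss smin.
have key (G : {set 'I_n * 'I_n}) :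
    ~ (n%:R - S < (poset_dim (bip_le (~: G)))%:R) ->
    (s <= n)%N /\ has_realizer (bip_le (~: G)) (n - s).
  move=> /negP; rewrite -leNgt.
  have [po _ _ _] := bip_le_partial_order (~: G).
  have [d0 real _] := poset_dimP po; set d := poset_dim _ in d0 real *.
  move=> dS; have dn : (d <= n)%N by rewrite -(ler_nat R); lra.
  have sd : (s <= n - d)%N by apply: smin; rewrite natrB//; lra.
  split; first exact: leq_trans sd (leq_subr _ _).
  by apply: has_realizer_widen real; rewrite d0 /=; lia.
have [sn|ns] := leqP s n.
  by apply: le_trans (HB s Ss sn); apply: prob_le => // G /key[].
by rewrite prob_false// => G /key[]; rewrite leqNgt ns.
Qed.

End Asymptotics.

(** * The four ranges for large n *)

Section Ranges.
Local Open Scope classical_set_scope.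
Local Open Scope ring_scope.
Context (R : realType).

Definition fail_prob n (q S : R) : R :=
  prob q (fun G => ~ (n%:R - S < (poset_dim (bip_le (~: G : {set 'I_n * 'I_n})))%:R)).

Lemma le_of_exp (x y : R) m : 0 <= x -> 0 <= y -> x ^+ m.+1 <= y ^+ m.+1 -> x <= y.
Proof. by move=> x0 y0; rewrite ler_pXn2r ?nnegrE. Qed.

Lemma near_div_le (C eta : R) k : 0 < eta ->
  \forall n \near \oo, C * ln (n%:R : R) ^+ k / n%:R <= eta.
Proof.
move=> eta0; near=> n.
have n0 : 0 < n%:R :> R by rewrite ltr0n; near: n; exists 1%N.
rewrite ler_pdivrMr//; have h : C / eta * ln (n%:R : R) ^+ k <= n%:R by near: n; exact: near_poly_ln.
have := ler_wpM2l (ltW eta0) h.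
by rewrite (_ : eta * (C / eta * _) = C * ln n%:R ^+ k); last by field; rewrite gt_eqF.
Unshelve. all: by end_near.
Qed.

(** The hypothesis q <= n^(-4/5) says n^4 q^5 <= 1, and the lower bound on q
    gives q n >= (log n)^2, so that log (q n) tends to infinity. *)
Lemma range1_near (eps eta : R) : 0 < eps < 1 -> 0 < eta ->
  \forall n \near \oo, forall q : R, (n%:R)^-1 * ln (n%:R : R) ^+ 2 <= q ->
    q <= n%:R `^ (- (4 / 5)) ->
    fail_prob n q ((2 + eps) * ln (q * n%:R) / q) <= eta.
Proof.
move=> eps01 eta0; have /andP[eps0 eps1] := eps01.
pose A : R := 2 + 10 / (eps * eta).
have ee : 0 < eps * eta by rewrite mulr_gt0.
have c0 : 0 < 3 / 4 * eps by rewrite mulr_gt0.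
near=> n => q hq1 hq2.
have N0 : 0 < n%:R :> R by rewrite ltr0n; near: n; exists 1%N.
have L1 : 1 <= ln (n%:R : R) by near: n; exact: near_ln_ge.
have LA : expR A <= ln (n%:R : R) by near: n; exact: near_ln_ge.
have NC : ((3 / 4 * eps) ^+ 5)^-1 <= n%:R by near: n; exact: nbhs_infty_ger.
set N : R := n%:R in N0 L1 LA NC hq1 hq2 *; set L := ln N in L1 LA hq1 *.
have N1 : 1 <= N by rewrite /N ler1n -(ltr0n R).
have L2 : L <= L ^+ 2 by rewrite expr2 ler_peMl//; lra.
have qN : L ^+ 2 <= q * N by rewrite mulrC -ler_pdivrMl.
have q0 : 0 < q.
  by apply: lt_le_trans hq1; rewrite mulr_gt0 ?invr_gt0// exprn_gt0//; lra.
have q5 : q ^+ 5 <= (N ^+ 4)^-1.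
  rewrite -(@powRN_exp R N (4 / 5) 4 5)//; last by field.
  by apply: lerXn2r; rewrite ?nnegrE ?powR_ge0// ltW.
have N4q : N ^+ 4 * q ^+ 5 <= 1.
  by rewrite mulrC -ler_pdivlMr ?exprn_gt0// div1r.
have qe : q <= 3 / 4 * eps.
  apply: (@le_of_exp _ _ 4); [exact: ltW|exact: ltW|].
  apply: le_trans q5 _; rewrite -[leRHS]invrK lef_pV2 ?posrE ?invr_gt0 ?exprn_gt0//.
  by apply: le_trans NC _; rewrite -[leLHS]expr1; apply: ler_weXn2l.
have qN0 : 0 < q * N by rewrite mulr_gt0.
have LamA : A <= ln (q * N).
  rewrite -(expRK A) ler_ln ?posrE ?expR_gt0//; exact: le_trans LA (le_trans L2 qN).
set Lam := ln (q * N) in LamA *.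
have i0 : 0 < 10 / (eps * eta) by rewrite divr_gt0.
have Lam2 : 2 <= Lam by apply: le_trans LamA; rewrite /A; lra.
have Lam0 : 0 < Lam by lra.
have q01 : 0 <= q <= 1 by lra.
apply: small_dim_prob => //.
- by rewrite mulr_ge0 ?invr_ge0 ?ltW// mulr_gt0//; lra.
- exact: ltW.
move=> s Ss sn.
have qq : 0 < q <= 3 / 4 * eps by rewrite q0.
apply: le_trans (@sparse_prob R n s q eps eps01 qq Lam2 sn N4q Ss) _.
rewrite -/N -/Lam.
have eL : 0 < eps * Lam by rewrite mulr_gt0.
have ex : expR (- (eps / 2 * Lam)) <= 2 / (eps * Lam).
  have h : eps / 2 * Lam <= expR (eps / 2 * Lam).
    by apply: le_trans (expR_ge1Dx _); rewrite lerDr.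
  have -> : 2 / (eps * Lam) = (eps / 2 * Lam)^-1 by field; rewrite !gt_eqF.
  by rewrite expRN lef_pV2 ?posrE ?expR_gt0// mulr_gt0// divr_gt0.
apply: (@le_trans _ _ (10 / (eps * Lam))).
  by rewrite (_ : 10 / (eps * Lam) = 8 / (eps * Lam) + 2 / (eps * Lam)) ?lerD2l//; field; rewrite !gt_eqF.
rewrite ler_pdivrMr//.
have : 10 / (eps * eta) <= Lam by apply: le_trans LamA; rewrite /A; lra.
rewrite ler_pdivrMr//; lra.
Unshelve. all: by end_near.
Qed.

Lemma middle_near (eta : R) : 0 < eta ->
  \forall n \near \oo, forall q S : R, 0 < q -> q <= 1 / 11 ->
    expR (200 * 200) * q <= 1 -> n%:R ^+ 19 * q ^+ 81 <= 1 ->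
    113 / 20 * q * n%:R <= S -> 32 * 32 * n%:R * ln (n%:R) <= q * S ^+ 2 ->
    200 * 200 * 5 * ln (n%:R) <= q * S ->
    fail_prob n q S <= eta.
Proof.
move=> eta0; near=> n => q S q0 q11 qe qN hS hH hB.
have n4 : (4 <= n)%N by near: n; exists 4%N.
have L1 : 1 <= ln (n%:R : R) by near: n; exact: near_ln_ge.
have : 21 * ln (n%:R : R) ^+ 0 / n%:R <= eta by near: n; exact: near_div_le.
rewrite expr0 mulr1 => NE.
have S0 : 0 <= S.
  apply: le_trans hS; rewrite mulr_ge0// mulr_ge0 ?ltW//; lra.
apply: small_dim_prob => //; [lra|exact: ltW|].
move=> s Ss sn; apply: le_trans NE.
have qS : q * S <= q * s%:R by rewrite ler_pM2l.
apply: middle_prob => //.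
- exact: le_trans hS Ss.
- apply: le_trans hH _; rewrite ler_pM2l//; apply: lerXn2r; rewrite ?nnegrE//.
- exact: le_trans hB qS.
- have : q * s%:R <= 1 * s%:R by rewrite ler_wpM2r//; lra.
  lra.
Unshelve. all: by end_near.
Qed.

End Ranges.

Section MiddleRanges.
Local Open Scope classical_set_scope.
Local Open Scope ring_scope.
Context (R : realType).

Lemma small_of_pow (N q c B : R) m : 0 < N -> 0 <= q -> 0 < c ->
  q ^+ m.+1 * N <= B -> (c ^+ m.+1)^-1 * B <= N -> q <= c.
Proof.
move=> N0 q0 c0 h1 h2; apply: (@le_of_exp _ _ _ m) => //; first exact: ltW.
have cm : 0 < c ^+ m.+1 by rewrite exprn_gt0.
rewrite -(ler_pM2r N0); apply: le_trans h1 _.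
by rewrite -ler_pdivrMl.
Qed.

(** Here 1 <= q^5 n^4 and q^3 n <= 32 log n; with S = 32 (n log n / q)^(1/2)
    the number q S^2 is exactly 1024 n log n. *)
Lemma range2_near (eta : R) : 0 < eta ->
  \forall n \near \oo, forall q : R, n%:R `^ (- (4 / 5)) <= q ->
    q <= 32 `^ (1 / 3) * n%:R `^ (- (1 / 3)) * ln (n%:R) `^ (1 / 3) ->
    fail_prob n q (32 * (n%:R * ln (n%:R) / q) `^ (1 / 2)) <= eta.
Proof.
move=> eta0; near=> n => q hq1 hq2.
have M0 : forall q S : R, 0 < q -> q <= 1 / 11 ->
    expR (200 * 200) * q <= 1 -> n%:R ^+ 19 * q ^+ 81 <= 1 ->
    113 / 20 * q * n%:R <= S -> 32 * 32 * n%:R * ln (n%:R) <= q * S ^+ 2 ->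
    200 * 200 * 5 * ln (n%:R) <= q * S -> fail_prob n q S <= eta.
  by near: n; exact: middle_near.
have N0 : 0 < n%:R :> R by rewrite ltr0n; near: n; exists 1%N.
have L1 : 1 <= ln (n%:R : R) by near: n; exact: near_ln_ge.
have F1 : ((1 / 11) ^+ 3)^-1 * 32 * ln (n%:R : R) ^+ 1 <= n%:R by near: n; exact: near_poly_ln.
have F2 : ((expR (200 * 200))^-1 ^+ 3)^-1 * 32 * ln (n%:R : R) ^+ 1 <= n%:R by near: n; exact: near_poly_ln.
have F3 : (200 * 200 * (5 * 200)) ^+ 5 * ln (n%:R : R) ^+ 5 <= n%:R by near: n; exact: near_poly_ln.
have F4 : 32 ^+ 4 * ln (n%:R : R) ^+ 4 <= n%:R by near: n; exact: near_poly_ln.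
move: M0 N0 L1 F1 F2 F3 F4 hq1 hq2; set N : R := n%:R; set L := ln N.
move=> M0 N0 L1 F1 F2 F3 F4 hq1 hq2.
have L0 : 0 < L by exact: lt_le_trans L1.
have q0 : 0 < q by apply: lt_le_trans hq1; exact: powR_gt0.
have q3 : q ^+ 3 * N <= 32 * L.
  rewrite -ler_pdivlMr//.
  apply: (@le_trans _ _ ((32 `^ (1 / 3) * N `^ (- (1 / 3)) * L `^ (1 / 3)) ^+ 3)).
    by apply: lerXn2r; rewrite ?nnegrE ?mulr_ge0 ?powR_ge0// ltW.
  rewrite !exprMn (@powRN_exp R N (1 / 3) 1 3)//; last by field.
  rewrite !powR_exp ?(ltW L0)//; try by field.
  by rewrite expr1 mulrAC.
have q5 : 1 <= q ^+ 5 * N ^+ 4.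
  rewrite -ler_pdivrMr ?exprn_gt0// div1r -(@powRN_exp R N (4 / 5) 4 5)//; last by field.
  by apply: lerXn2r; rewrite ?nnegrE ?powR_ge0// ltW.
pose w := (N * L / q) `^ (1 / 2).
have w0 : 0 <= w by exact: powR_ge0.
have w2 : q * w ^+ 2 = N * L.
  rewrite /w powR_exp; first by rewrite mulrC divfK// gt_eqF.
    by rewrite divr_ge0 ?mulr_ge0 ?ltW.
  by field.
rewrite -/w; apply: M0; first exact: q0.
- apply: (@small_of_pow N q (1 / 11) _ 2 N0 (ltW q0) _ q3); first by lra.
  by move: F1; rewrite expr1 mulrA.
- rewrite mulrC -ler_pdivlMr ?expR_gt0// div1r.
  apply: (@small_of_pow N q _ _ 2 N0 (ltW q0) _ q3); first by rewrite invr_gt0 expR_gt0.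
  by move: F2; rewrite expr1 mulrA.
- have N8 : 0 < N ^+ 8 by rewrite exprn_gt0.
  rewrite -(ler_pM2r N8) mul1r.
  have -> : N ^+ 19 * q ^+ 81 * N ^+ 8 = (q ^+ 3 * N) ^+ 27.
    by rewrite exprMn -exprM mulrAC -exprD mulrC.
  have h32 : 1 <= 32 * L by lra.
  apply: (@le_trans _ _ ((32 * L) ^+ 27)).
    have a0 : 0 <= q ^+ 3 * N by rewrite mulr_ge0 ?exprn_ge0 ?(ltW q0) ?(ltW N0).
    by apply: lerXn2r; rewrite ?nnegrE//; lra.
  apply: (@le_trans _ _ ((32 * L) ^+ (4 * 8))); first exact: ler_weXn2l.
  have c0 : 0 <= (32 * L) ^+ 4 by rewrite exprn_ge0//; lra.
  by rewrite exprM; apply: lerXn2r; rewrite ?nnegrE ?(ltW N0)// exprMn.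
- apply: (@le_of_exp _ _ _ 1).
  + by rewrite mulr_ge0 ?ltW// mulr_gt0//; lra.
  + by rewrite mulr_ge0.
  rewrite -(ler_pM2l q0).
  have -> : q * (113 / 20 * q * N) ^+ 2 = 113 / 20 * (113 / 20) * N * (q ^+ 3 * N) by ring.
  have -> : q * (32 * w) ^+ 2 = 32 * 32 * (q * w ^+ 2) by ring.
  rewrite w2.
  have : N * (q ^+ 3 * N) <= N * (32 * L) by rewrite ler_pM2l.
  have : 0 < N * L by rewrite mulr_gt0.
  rewrite -(mulrA _ N); set a := N * (q ^+ 3 * N); lra.
- have -> : q * (32 * w) ^+ 2 = 32 * 32 * (q * w ^+ 2) by ring.
  by rewrite w2 !mulrA.
- have w0' : 0 <= 32 * w by rewrite mulr_ge0.
  apply: (@le_of_exp _ _ _ 1).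
  + by rewrite !mulr_ge0 ?ler0n ?(ltW L0).
  + by rewrite mulr_ge0// ltW.
  have -> : (q * (32 * w)) ^+ 2 = 32 * 32 * q * (q * w ^+ 2) by ring.
  rewrite w2.
    (* from q^5 n^4 >= 1, as (q n)^5 >= n exceeds any power of log n *)
have qN : 200 * 200 * (5 * 200) * L <= q * N.
    apply: (@le_of_exp _ _ _ 4).
    + by rewrite !mulr_ge0 ?ler0n ?(ltW L0).
    + by rewrite mulr_ge0 ?ltW.
    rewrite exprMn; apply: le_trans F3 _.
    have -> : (q * N) ^+ 5 = q ^+ 5 * N ^+ 4 * N by ring.
    by rewrite ler_peMl// ltW.
  have : 200 * 200 * (5 * 200) * L * L <= q * N * L by rewrite ler_pM2r.
  have : 0 < L * L by rewrite mulr_gt0.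
  rewrite (_ : 32 * 32 * q * (N * L) = 32 * 32 * (q * N * L)); last by ring.
  rewrite (_ : (200 * 200 * 5 * L) ^+ 2 = 200 * 200 * 5 * (200 * 200 * 5) * (L * L)); last by ring.
  rewrite -(mulrA _ L L); set a := q * N * L; set b := L * L; lra.
Unshelve. all: by end_near.
Qed.

End MiddleRanges.

Section DenseRanges.
Local Open Scope classical_set_scope.
Local Open Scope ring_scope.
Context (R : realType).

(** Here 32 log n <= q^3 n and q^4 n <= (log n)^12; with S = 8 q n the number
    q S^2 is 64 n (q^3 n). *)
Lemma range3_near (eta : R) : 0 < eta ->
  \forall n \near \oo, forall q : R,
    32 `^ (1 / 3) * n%:R `^ (- (1 / 3)) * ln (n%:R) `^ (1 / 3) <= q ->
    q <= 1 / 8 * n%:R `^ (- (1 / 4)) * ln (n%:R) ^+ 3 -> q <= 1 / 2 ->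
    fail_prob n q (8 * q * n%:R) <= eta.
Proof.
move=> eta0; near=> n => q hq1 hq2 qhalf.
have M0 : forall q S : R, 0 < q -> q <= 1 / 11 ->
    expR (200 * 200) * q <= 1 -> n%:R ^+ 19 * q ^+ 81 <= 1 ->
    113 / 20 * q * n%:R <= S -> 32 * 32 * n%:R * ln (n%:R) <= q * S ^+ 2 ->
    200 * 200 * 5 * ln (n%:R) <= q * S -> fail_prob n q S <= eta.
  by near: n; exact: middle_near.
have N0 : 0 < n%:R :> R by rewrite ltr0n; near: n; exists 1%N.
have L1 : 1 <= ln (n%:R : R) by near: n; exact: near_ln_ge.
have F1 : ((1 / 11) ^+ 4)^-1 * ln (n%:R : R) ^+ 12 <= n%:R by near: n; exact: near_poly_ln.
have F2 : ((expR (200 * 200))^-1 ^+ 4)^-1 * ln (n%:R : R) ^+ 12 <= n%:R by near: n; exact: near_poly_ln.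
have F3 : (200 * 125) ^+ 3 * ln (n%:R : R) ^+ 3 <= n%:R by near: n; exact: near_poly_ln.
have F4 : 1 * ln (n%:R : R) ^+ (12 * 20) <= n%:R by near: n; exact: near_poly_ln.
move: M0 N0 L1 F1 F2 F3 F4 hq1 hq2; set N : R := n%:R; set L := ln N.
move=> M0 N0 L1 F1 F2 F3 F4 hq1 hq2.
have L0 : 0 < L by apply: lt_le_trans L1.
have q0 : 0 < q.
  by apply: lt_le_trans hq1; rewrite !mulr_gt0 ?powR_gt0.
have q3 : 32 * L <= q ^+ 3 * N.
  rewrite -ler_pdivrMr//.
  apply: (@le_trans _ _ ((32 `^ (1 / 3) * N `^ (- (1 / 3)) * L `^ (1 / 3)) ^+ 3)); last first.
    by apply: lerXn2r; rewrite ?nnegrE ?mulr_ge0 ?powR_ge0// ltW.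
  rewrite !exprMn (@powRN_exp R N (1 / 3) 1 3)//; last by field.
  rewrite !powR_exp ?(ltW L0)//; try by field.
  by rewrite expr1 mulrAC.
have q4 : q ^+ 4 * N <= L ^+ 12.
  rewrite -ler_pdivlMr//.
  apply: (@le_trans _ _ ((1 / 8 * N `^ (- (1 / 4)) * L ^+ 3) ^+ 4)).
    apply: lerXn2r => //; rewrite nnegrE ?(ltW q0)//.
    by rewrite !mulr_ge0 ?powR_ge0 ?exprn_ge0 ?divr_ge0 ?(ltW L0).
  have -> : (1 / 8 * N `^ (- (1 / 4)) * L ^+ 3) ^+ 4 =
    (1 / 8) ^+ 4 * ((N `^ (- (1 / 4))) ^+ 4 * L ^+ 12) by ring.
  rewrite (@powRN_exp R N (1 / 4) 1 4)//; last by field.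
  rewrite expr1 [leRHS]mulrC; apply: ler_piMl.
    by rewrite mulr_ge0 ?invr_ge0 ?exprn_ge0 ?(ltW L0) ?(ltW N0).
  by rewrite exprn_ile1 ?divr_ge0 ?ler0n// ler_pdivrMr ?mul1r ?ler1n ?ltr0n.
have q4' : q ^+ 4 * N <= 1 * L ^+ 12 by rewrite mul1r.
apply: M0; first exact: q0.
- by apply: (@small_of_pow _ N q (1 / 11) _ 3 N0 (ltW q0) _ q4 F1); lra.
- rewrite mulrC -ler_pdivlMr ?expR_gt0// div1r.
  by apply: (@small_of_pow _ N q _ _ 3 N0 (ltW q0) _ q4 F2); rewrite invr_gt0 expR_gt0.
- rewrite -(ler_pM2r N0) mul1r.
  have -> : N ^+ 19 * q ^+ 81 * N = q * (q ^+ 4 * N) ^+ 20.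
    rewrite exprMn -exprM (exprSr N 19) (exprS q 80).
    set a := N ^+ 19; set b := q ^+ (4 * 20); rewrite -/b; ring.
  have a0 : 0 <= q ^+ 4 * N by rewrite mulr_ge0 ?exprn_ge0 ?(ltW q0) ?(ltW N0).
  apply: (@le_trans _ _ ((q ^+ 4 * N) ^+ 20)).
    by apply: ler_piMl; [exact: exprn_ge0|lra].
  apply: le_trans F4; rewrite mul1r exprM.
  by apply: lerXn2r; rewrite ?nnegrE ?exprn_ge0 ?(ltW L0).
- have : 0 < q * N by rewrite mulr_gt0.
  rewrite -!mulrA; set a := q * N; lra.
- have -> : q * (8 * q * N) ^+ 2 = 8 * 8 * N * (q ^+ 3 * N) by ring.
  have : N * (32 * L) <= N * (q ^+ 3 * N) by rewrite ler_pM2l.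
  have : 0 < N * L by rewrite mulr_gt0.
  rewrite -!mulrA; set a := N * L; set b := N * (q ^+ 3 * N).
  rewrite (_ : N * (32 * L) = 32 * a); last by rewrite /a; ring.
  lra.
-   (* (q^2 n)^3 = (q^3 n)^2 n exceeds any power of log n *)
have q2N : 200 * 125 * L <= q ^+ 2 * N.
    apply: (@le_of_exp _ _ _ 2).
    + by rewrite !mulr_ge0 ?ler0n ?(ltW L0).
    + by rewrite mulr_ge0 ?exprn_ge0 ?ltW.
    rewrite exprMn; apply: le_trans F3 _.
    have -> : (q ^+ 2 * N) ^+ 3 = (q ^+ 3 * N) ^+ 2 * N by ring.
    apply: ler_peMl; first exact: ltW.
    by apply: exprn_ege1; apply: le_trans q3; lra.
  have -> : q * (8 * q * N) = 8 * (q ^+ 2 * N) by ring.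
  have -> : 200 * 200 * 5 * L = 8 * (200 * 125 * L) by ring.
  by rewrite ler_pM2l.
Unshelve. all: by end_near.
Qed.

(** Here (log n)^12 <= 8^4 q^4 n, which gives z >= 1, as exp z = n q^4 / (log
    n)^8. *)
Lemma range4_near (eta : R) : 0 < eta ->
  \forall n \near \oo, forall q : R,
    1 / 8 * n%:R `^ (- (1 / 4)) * ln (n%:R) ^+ 3 <= q -> q <= 1 / 2 ->
    fail_prob n q (24 * q * n%:R / (ln n%:R + 4 * ln q - 8 * ln (ln n%:R))) <= eta.
Proof.
move=> eta0; near=> n => q hq1 q2.
have n4 : (4 <= n)%N by near: n; exists 4%N.
have N0 : 0 < n%:R :> R by rewrite ltr0n; near: n; exists 1%N.
have L4 : 100 * 100 <= ln (n%:R : R) by near: n; exact: near_ln_ge.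
have F1 : 9 * 8 ^+ 4 * ln (n%:R : R) ^+ 2 <= n%:R by near: n; exact: near_poly_ln.
have F2 : 17 * ln (n%:R : R) ^+ 1 / n%:R <= eta by near: n; exact: near_div_le.
move: N0 L4 F1 F2 hq1; set N : R := n%:R; set L := ln N.
move=> N0 L4 F1 F2 hq1.
have L0 : 0 < L by apply: lt_le_trans L4; rewrite mulr_gt0.
have L1 : 1 <= L by apply: le_trans L4; lra.
have q0 : 0 < q.
  by apply: lt_le_trans hq1; rewrite !mulr_gt0 ?powR_gt0 ?exprn_gt0.
have q4 : L ^+ 12 <= 8 ^+ 4 * (q ^+ 4 * N).
  have e0 : 0 <= 1 / 8 * N `^ (- (1 / 4)) * L ^+ 3.
    by rewrite !mulr_ge0 ?powR_ge0 ?exprn_ge0 ?divr_ge0 ?(ltW L0).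
  have : (1 / 8 * N `^ (- (1 / 4)) * L ^+ 3) ^+ 4 <= q ^+ 4.
    by apply: lerXn2r; rewrite ?nnegrE ?(ltW q0).
  have -> : (1 / 8 * N `^ (- (1 / 4)) * L ^+ 3) ^+ 4 =
    ((N `^ (- (1 / 4))) ^+ 4 * L ^+ 12) / 8 ^+ 4 by field.
  rewrite (@powRN_exp R N (1 / 4) 1 4)//; last by field.
  rewrite expr1 ler_pdivrMr ?exprn_gt0// ler_pdivrMl// => h.
  by rewrite mulrA [_ * N]mulrC [8 ^+ 4 * _]mulrC.
set z := L + 4 * ln q - 8 * ln L.
have ez : expR z * L ^+ 8 = N * q ^+ 4.
  have e4 : expR (4 * ln q) = q ^+ 4 by rewrite mulrC expRM_natr lnK ?posrE.
  have e8 : expR (8 * ln L) = L ^+ 8 by rewrite mulrC expRM_natr lnK ?posrE.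
  rewrite /z !expRD expRN e4 e8 /L lnK ?posrE// -/L -mulrA mulVf ?mulr1//.
  by rewrite gt_eqF// exprn_gt0.
have z1 : 1 <= z.
  have e3 : expR 1 <= L.
    have h : expR (1 / 2) <= 2 :> R by have := expR_half_le R; lra.
    have e : expR 1 = expR (1 / 2) * expR (1 / 2) :> R by rewrite -expRD; congr expR; field.
    have : expR (1 / 2) * expR (1 / 2) <= 2 * 2 :> R by apply: ler_pM; rewrite ?expR_ge0.
    by move=> h4; rewrite e; apply: le_trans L4; lra.
  rewrite -ler_expR -(ler_pM2r (exprn_gt0 8 L0)) ez.
  have P8 : 0 < 8 ^+ 4 :> R by rewrite exprn_gt0.
  rewrite -(ler_pM2l P8); apply: (@le_trans _ _ (L ^+ 12)); last first.
    by rewrite [N * _]mulrC.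
  apply: (@le_trans _ _ (L ^+ 3 * (L * L ^+ 8))); last by rewrite -!exprS -exprD.
  apply: ler_pM => //.
  - by rewrite mulr_ge0 ?expR_ge0 ?exprn_ge0 ?(ltW L0).
  - apply: (@le_trans _ _ ((100 * 100) ^+ 3)); first by rewrite (_ : 8 ^+ 4 = 16 ^+ 3) ?lerXn2r ?nnegrE//; [lra|ring].
    by apply: lerXn2r; rewrite ?nnegrE ?(ltW L0).
  - by rewrite ler_wpM2r ?exprn_ge0 ?(ltW L0).
have zL : z <= L.
  have : ln q <= 0 by apply: ln_le0; lra.
  have : 0 <= ln L by apply: ln_ge0.
  rewrite /z; lra.
have z0 : 0 < z by lra.
have S0 : 0 <= 24 * q * N / z by rewrite divr_ge0 ?mulr_ge0 ?ltW.
have F2' : 17 * L / N <= eta by move: F2; rewrite expr1.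
apply: small_dim_prob => //; [lra|exact: ltW|].
move=> s Ss sn; apply: le_trans F2'.
have hS : 24 * q * N <= z * s%:R by rewrite [z * _]mulrC -ler_pdivrMr.
(* (q^2 n)^2 = q^4 n * n, and q^4 n is bounded below *)
have q2N : 3 * L ^+ 7 <= q ^+ 2 * N.
  apply: (@le_of_exp _ _ _ 1).
  - by rewrite mulr_ge0 ?exprn_ge0 ?(ltW L0).
  - by rewrite mulr_ge0 ?exprn_ge0 ?ltW.
  have P8 : 0 < 8 ^+ 4 :> R by rewrite exprn_gt0.
  rewrite -(ler_pM2l P8).
  have -> : 8 ^+ 4 * (q ^+ 2 * N) ^+ 2 = N * (8 ^+ 4 * (q ^+ 4 * N)) by ring.
  apply: (@le_trans _ _ (N * L ^+ 12)); last by rewrite ler_pM2l.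
  have -> : 8 ^+ 4 * (3 * L ^+ 7) ^+ 2 = 9 * 8 ^+ 4 * L ^+ 2 * L ^+ 12 by ring.
  by rewrite ler_wpM2r ?exprn_ge0 ?(ltW L0).
have hqS : 70 * L ^+ 6 <= q * s%:R.
  have h : q * (24 * q * N) <= q * (z * s%:R) by rewrite ler_pM2l.
  have h2 : z * (q * s%:R) <= L * (q * s%:R) by rewrite ler_wpM2r// mulr_ge0// ltW.
  rewrite -(ler_pM2l L0).
  have -> : L * (70 * L ^+ 6) = 70 * L ^+ 7 by ring.
  have : 0 < L ^+ 7 by rewrite exprn_gt0.
  rewrite (_ : q * (24 * q * N) = 24 * (q ^+ 2 * N)) in h; last by ring.
  rewrite (_ : q * (z * s%:R) = z * (q * s%:R)) in h; last by ring.
  lra.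
have L6 : 0 <= 6 * L by rewrite !mulr_ge0 ?ler0n ?(ltW L0).
pose k := (Num.truncn (6 * L)).+1.
have /andP[k1 k2] := truncn_itv L6.
have k6 : 6 * L <= k%:R by exact: ltW.
have k7 : k%:R <= 7 * L by rewrite /k -addn1 natrD; lra.
have L3 : 0 < L ^+ 3 by rewrite exprn_gt0.
have x0 : 0 <= s%:R / L ^+ 3 by rewrite divr_ge0 ?(ltW L3).
pose l := (Num.truncn (s%:R / L ^+ 3)).+1.
have /andP[l1 l2] := truncn_itv x0.
have lS : s%:R <= L ^+ 3 * l%:R by rewrite [leRHS]mulrC -ler_pdivrMr// ltW.
have lS2 : L ^+ 3 * l%:R <= 2 * s%:R.
  have : L ^+ 3 * (Num.truncn (s%:R / L ^+ 3))%:R <= s%:R.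
    by rewrite mulrC -ler_pdivlMr.
  have : L ^+ 3 <= s%:R.
    apply: (@le_trans _ _ (q * s%:R)); last by apply: ler_piMl; lra.
    apply: le_trans hqS; apply: (@le_trans _ _ (L ^+ 6)); first exact: ler_weXn2l.
    by apply: ler_peMl; [rewrite exprn_ge0 ?(ltW L0)|lra].
  have -> : l%:R = (Num.truncn (s%:R / L ^+ 3))%:R + 1 :> R by rewrite natr1.
  rewrite mulrDr mulr1; lra.
exact: (dense_prob n4 sn L4 q0 q2 z1 zL ez hS hqS k6 k7 lS lS2).
Unshelve. all: by end_near.
Qed.

End DenseRanges.

Local Open Scope classical_set_scope.
Local Open Scope ring_scope.

(** Each clause fails with probability at most eta, whether or not its range
    applies. *)
Lemma four_clauses_prob (R : realType) n (q eta : R) (b1 b2 b3 b4 : bool)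
    (S1 S2 S3 S4 : R) : 0 <= q <= 1 -> 0 <= eta ->
  (b1 -> fail_prob n q S1 <= eta) -> (b2 -> fail_prob n q S2 <= eta) ->
  (b3 -> fail_prob n q S3 <= eta) -> (b4 -> fail_prob n q S4 <= eta) ->
  1 - 4 * eta <= Pr (1 - q) (fun E : {set 'I_n * 'I_n} =>
    let d : R := (poset_dim (bip_le E))%:R in
    [&& b1 ==> (n%:R - S1 < d), b2 ==> (n%:R - S2 < d),
        b3 ==> (n%:R - S3 < d) & b4 ==> (n%:R - S4 < d)]) <= 1.
Proof.
move=> q01 eta0 H1 H2 H3 H4; rewrite Pr_eq_prob prob_le1// andbT prob_compl.
rewrite lerD2l lerN2.
pose bad (b : bool) (S : R) (G : {set 'I_n * 'I_n}) :=
  b /\ ~ (n%:R - S < (poset_dim (bip_le (~: G)))%:R).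
have badP (b : bool) S : (b -> fail_prob n q S <= eta) -> prob q (bad b S) <= eta.
  case: b => H; last by rewrite prob_false// => G [].
  by apply: le_trans (H isT); apply: prob_le => // G [].
apply: (@le_trans _ _ (prob q (fun G => (bad b1 S1 G \/ bad b2 S2 G) \/ (bad b3 S3 G \/ bad b4 S4 G)))).
  apply: prob_le => // G /negP; rewrite !negb_and !negb_imply.
  move=> /or4P[] /andP[bi /negP ni]; [left; left|left; right|right; left|right; right]; by split.
apply: le_trans (prob_or _ _ q01) _.
have := prob_or (bad b1 S1) (bad b2 S2) q01; have := prob_or (bad b3 S3) (bad b4 S4) q01.
have := badP _ _ H1; have := badP _ _ H2; have := badP _ _ H3; have := badP _ _ H4.
lra.
Qed.

Theorem theorem1p10 (R : realType) (eps : R) (q : nat -> R)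
    (heps : 0 < eps < 1)
    (hq : \forall n \near \oo,
       (n%:R)^-1 * ln (n%:R : R) ^+ 2 <= q n <= 1 / 2) :
  (fun n : nat =>
     let N : R := n%:R in
     let z : R := ln N + 4 * ln (q n) - 8 * ln (ln N) in
     Pr (1 - q n) (fun E : {set 'I_n * 'I_n} =>
       let d : R := (poset_dim (bip_le E))%:R in
       [&& (N^-1 * ln N ^+ 2 <= q n <= N `^ (- (4 / 5))) ==>
             (N - (2 + eps) * ln (q n * N) / q n < d),
           (N `^ (- (4 / 5)) <= q n <=
              32 `^ (1 / 3) * N `^ (- (1 / 3)) * ln N `^ (1 / 3)) ==>
             (N - 32 * (N * ln N / q n) `^ (1 / 2) < d),
           (32 `^ (1 / 3) * N `^ (- (1 / 3)) * ln N `^ (1 / 3) <= q n <=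
              1 / 8 * N `^ (- (1 / 4)) * ln N ^+ 3) ==>
             (N - 8 * q n * N < d)
         & (1 / 8 * N `^ (- (1 / 4)) * ln N ^+ 3 <= q n <= 1 / 2) ==>
             (N - 24 * q n * N / z < d)]))
    @ \oo --> (1 : R).
Proof.
apply/cvgrPdist_le => e e0; have e4 : 0 < e / 4 by rewrite divr_gt0.
near=> n.
have /andP[q1 q2] : (n%:R)^-1 * ln (n%:R : R) ^+ 2 <= q n <= 1 / 2 by near: n.
have L1 : 1 <= ln (n%:R : R) by near: n; exact: near_ln_ge.
have H1 : forall x : R, (n%:R)^-1 * ln (n%:R : R) ^+ 2 <= x ->
    x <= n%:R `^ (- (4 / 5)) -> fail_prob n x ((2 + eps) * ln (x * n%:R) / x) <= e / 4.
  by near: n; exact: range1_near.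
have H2 : forall x : R, n%:R `^ (- (4 / 5)) <= x ->
    x <= 32 `^ (1 / 3) * n%:R `^ (- (1 / 3)) * ln (n%:R) `^ (1 / 3) ->
    fail_prob n x (32 * (n%:R * ln (n%:R) / x) `^ (1 / 2)) <= e / 4.
  by near: n; exact: range2_near.
have H3 : forall x : R, 32 `^ (1 / 3) * n%:R `^ (- (1 / 3)) * ln (n%:R) `^ (1 / 3) <= x ->
    x <= 1 / 8 * n%:R `^ (- (1 / 4)) * ln (n%:R) ^+ 3 -> x <= 1 / 2 ->
    fail_prob n x (8 * x * n%:R) <= e / 4.
  by near: n; exact: range3_near.
have H4 : forall x : R, 1 / 8 * n%:R `^ (- (1 / 4)) * ln (n%:R) ^+ 3 <= x -> x <= 1 / 2 ->
    fail_prob n x (24 * x * n%:R / (ln n%:R + 4 * ln x - 8 * ln (ln n%:R))) <= e / 4.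
  by near: n; exact: range4_near.
have q01 : 0 <= q n <= 1.
  apply/andP; split; last by lra.
  by apply: le_trans q1; rewrite mulr_ge0 ?invr_ge0 ?exprn_ge0//; lra.
rewrite /=; have /andP[lo hi] := four_clauses_prob q01 (ltW e4)
  (fun h => let: conj h1 h2 := andP h in H1 (q n) h1 h2)
  (fun h => let: conj h1 h2 := andP h in H2 (q n) h1 h2)
  (fun h => let: conj h1 h2 := andP h in H3 (q n) h1 h2 q2)
  (fun h => let: conj h1 h2 := andP h in H4 (q n) h1 h2).
rewrite ger0_norm ?subr_ge0//.
rewrite lerBlDl -lerBlDr; apply: le_trans lo.
by rewrite lerD2l lerN2; lra.
Unshelve. all: by end_near.
Qed.
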